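(* Let $d\ge 2$, let $K$ be a field, and let $H\subseteq\mathbb N^d$ be a slim semigroup with extremal rays $\mathbf a_1,\dots,\mathbf a_d$. Let $R=K[H]$, let $\mathfrak m$ be the graded maximal ideal of $R$, and let $\omega_R$ be the canonical ideal of $R$. Let $\mathbf b\in\omega_H$, $u=\mathbf x^{\mathbf b}$, and $J=(\mathbf x^{\mathbf a_i}-\mathbf x^{\mathbf a_j} : i,j=1,\dots,d)R$. Then $\mathbf b$ is an Ulrich element in $H$ if and only if $\mathfrak m\,\omega_R\subseteq uR+J\omega_R$.
   Context: $\mathbb N=\{0,1,2,\dots\}$. An affine semigroup $H\subseteq\mathbb N^d$ is a finitely generated submonoid of $\mathbb N^d$; it is always assumed that the group generated by $H$ is $\mathbb Z^d$. Let $C\subseteq\mathbb R^d$ be the cone generated by $H$. $H$ is normal if $H=C\cap\mathbb Z^d$, and simplicial if $C$ has exactly $d$ extremal rays (one-dimensional faces). $\mathcal N_d$ is the class of normal simplicial affine semigroups in $\mathbb N^d$ generating $\mathbb Z^d$ as a group. For $H\in\mathcal N_d$, the extremal rays of $H$ are the primitive lattice vectors $\mathbf a_1,\dots,\mathbf a_d\in H$ lying on the extremal rays of $C$; they form an $\mathbb R$-basis of $\mathbb R^d$. For $\mathbf z=\sum_i\lambda_i\mathbf a_i$ put $[\mathbf z]_i=\lambda_i$. $B_H$ (the Hilbert basis) is the unique minimal generating set of $H$, and $\omega_H=\mathbb Z^d\cap\operatorname{relint}C=\{\mathbf h\in\mathbb Z^d:[\mathbf h]_i>0\text{ for all }i\}$.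 $H\in\mathcal N_d$ is called slim if $\sum_{i=1}^d[\mathbf c]_i\ge 1$ for every $\mathbf c\in B_H\setminus\omega_H$. $K[H]$ is the subalgebra of $K[x_1,\dots,x_d]$ spanned by the monomials $\mathbf x^{\mathbf h}$, $\mathbf h\in H$; its graded maximal ideal $\mathfrak m$ is generated by $\mathbf x^{\mathbf h}$, $0\ne\mathbf h\in H$. The canonical module $\omega_R$ of $R=K[H]$ is the ideal of $R$ spanned over $K$ by the monomials $\mathbf x^{\mathbf h}$, $\mathbf h\in\omega_H$. Ulrich modules: a graded Cohen–Macaulay $R$-module $E$ is Ulrich if its minimal number of generators equals its multiplicity $e(E)$ with respect to $\mathfrak m$; the zero module counts as Ulrich. An element $\mathbf b\in\omega_H$ is called an Ulrich element in $H$ if $E=\omega_R/\mathbf x^{\mathbf b}R$ is an Ulrich $R$-module. *)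

(* Defs.v *)
From HB Require Import structures.
From mathcomp Require Import all_boot all_order all_algebra.
From mathcomp Require Import generic_quotient ring_quotient.
From mathcomp Require Import boolp classical_sets reals.
From mathcomp Require Import mpoly.

Set Implicit Arguments.
Unset Strict Implicit.
Unset Printing Implicit Defensive.

Import Order.TTheory GRing.Theory Num.Theory.

Local Open Scope ring_scope.
Local Open Scope classical_set_scope.
Local Open Scope quotient_scope.

Section Submodules.
Variables (R : comNzRingType) (V : lmodType R).

Definition span (A : set V) : set V :=
  [set x | exists2 s : seq (R * V), (forall p, p \in s -> A p.2)
                                  & x = \sum_(p <- s) p.1 *: p.2].

Definition submodule (N : set V) : Prop :=
  [/\ N 0, forall x y, N x -> N y -> N (x + y)
         & forall r x, N x -> N (r *: x)].

Definition sum_set (A B : set V) : set V := [set x + y | x in A & y in B].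

(* The product I N; with V := R^o this is also the product of ideals. *)
Definition prod_set (I : set R) (N : set V) : set V :=
  span [set r *: x | r in I & x in N].

(* Length of M / N, as the length of a composition series from N to M. *)
Definition has_length (N M : set V) (l : nat) : Prop :=
  exists c : nat -> set V,
    [/\ c 0 = N, c l = M, forall i, (i <= l)%N -> submodule (c i)
      & forall i, (i < l)%N -> c i `<` c i.+1 /\
          forall L, submodule L -> c i `<=` L -> L `<=` c i.+1 ->
            L = c i \/ L = c i.+1].

End Submodules.

Definition ideal_gen (R : comNzRingType) (A : set R) : set R :=
  span (A : set R^o).

Definition prime_ideal (R : comNzRingType) (P : set R) : Prop :=
  [/\ submodule (P : set R^o), ~ P 1
    & forall x y, P (x * y) -> P x \/ P y].

Section UlrichModules.
Variables (R : comNzRingType) (E : lmodType R).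

Definition annihilator : set R := [set r | forall x : E, r *: x = 0].

(* For a finitely generated E the primes of Supp E are those containing
   the annihilator of E. *)
Definition support_chain (n : nat) : Prop :=
  exists p : nat -> set R,
    (forall i, (i <= n)%N -> prime_ideal (p i) /\ annihilator `<=` p i) /\
    (forall i, (i < n)%N -> p i `<` p i.+1).

Definition krull_dim (n : nat) : Prop :=
  support_chain n /\ forall k, support_chain k -> (k <= n)%N.

Definition regular_sequence (s : seq R) : Prop :=
  (forall i (x : E), (i < size s)%N ->
     let N := prod_set [set r | r \in take i s] [set: E] in
     N (s`_i *: x) -> N x) /\
  prod_set [set r | r \in s] [set: E] <> [set: E].

Variable m : set R.

Definition depth (n : nat) : Prop :=
  (exists s, [/\ {subset s <= [pred r | `[< m r >]]},
                 regular_sequence s & size s = n]) /\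
  (forall s, {subset s <= [pred r | `[< m r >]]} ->
     regular_sequence s -> (size s <= n)%N).

Definition cohen_macaulay : Prop := exists n, krull_dim n /\ depth n.

Definition min_generators (n : nat) : Prop :=
  (exists s : seq E, span [set x | x \in s] = [set: E] /\ size s = n) /\
  (forall s : seq E, span [set x | x \in s] = [set: E] -> (n <= size s)%N).

(* e(E) is the limit of d! * length(E / m^n E) / n^d, where d = dim E and
   m^n E is obtained by applying the product with m to E n times. *)
Definition multiplicity (e : nat) : Prop :=
  exists (d : nat) (l : nat -> nat),
    [/\ krull_dim d,
        forall n, has_length (iter n (prod_set m) [set: E]) [set: E] (l n)
      & forall eps : rat, 0 < eps -> exists N : nat, forall n, (N <= n)%N ->
          `|(d`! * l n)%:R / (n ^ d)%:R - e%:R| < eps].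

(* Meant for a finitely generated graded module E over a graded ring with
   graded maximal ideal m: there dim E, depth with respect to m, the minimal
   number of generators and the multiplicity are those of E localized at m. *)
Definition ulrich : Prop :=
  (forall x : E, x = 0) \/
  (cohen_macaulay /\ exists n, min_generators n /\ multiplicity n).

End UlrichModules.

Section QuotientModule.
Variables (R : comNzRingType) (V : lmodType R) (N : submodClosed V).

(* submodClosed does not inherit from zmodClosed, which Quotient.quot needs. *)
Definition quot_pred : {pred V} := fun x => x \in N.

Lemma quot_pred_closed : submod_closed quot_pred.
Proof. exact: submodClosedP. Qed.

HB.instance Definition _ := GRing.isSubmodClosed.Build R V quot_pred
  (GRing.submod_closed_semi quot_pred_closed).

Definition quot_lmod := @Quotient.quot V quot_pred.
HB.instance Definition _ := GRing.Zmodule.on quot_lmod.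

Definition quot_pi (x : V) : quot_lmod := \pi_(@Quotient.quot V quot_pred) x.

Definition quot_scale (r : R) (x : quot_lmod) : quot_lmod :=
  quot_pi (r *: repr (x : @Quotient.quot V quot_pred)).

Lemma quot_piP (x y : V) : (quot_pi x == quot_pi y) = (x - y \in N).
Proof. by rewrite /quot_pi -Quotient.idealrBE. Qed.

Lemma quot_piK (x : quot_lmod) : quot_pi (repr (x : @Quotient.quot V quot_pred)) = x.
Proof. exact: reprK. Qed.

Lemma quot_piD : {morph quot_pi : x y / x + y}.
Proof. by move=> x y; rewrite /quot_pi raddfD. Qed.

Lemma quot_piZ r x : quot_scale r (quot_pi x) = quot_pi (r *: x).
Proof.
apply/eqP; rewrite quot_piP -scalerBr; apply: rpredZ.
by rewrite -quot_piP quot_piK.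
Qed.

Lemma quot_scalerA a b x :
  quot_scale a (quot_scale b x) = quot_scale (a * b) x.
Proof. by rewrite -[x]quot_piK !quot_piZ scalerA. Qed.

Lemma quot_scale1r : left_id 1 quot_scale.
Proof. by move=> x; rewrite -[x]quot_piK quot_piZ scale1r. Qed.

Lemma quot_scalerDr : right_distributive quot_scale +%R.
Proof.
move=> r x y; rewrite -[x]quot_piK -[y]quot_piK.
by rewrite -quot_piD !quot_piZ scalerDr quot_piD.
Qed.

Lemma quot_scalerDl x : {morph quot_scale^~ x : a b / a + b}.
Proof.
by move=> a b; rewrite -[x]quot_piK !quot_piZ scalerDl quot_piD.
Qed.

HB.instance Definition _ := GRing.Zmodule_isLmodule.Build R quot_lmod
  quot_scalerA quot_scale1r quot_scalerDr quot_scalerDl.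

End QuotientModule.

Definition zvec (d : nat) (h : 'X_{1..d}) : 'rV[int]_d := \row_i (h i)%:Z.

Definition sg_generates (d : nat) (H B : set 'X_{1..d}) : Prop :=
  B `<=` H /\
  forall h, H h -> exists2 s : seq 'X_{1..d},
    (forall x, x \in s -> B x) & h = (\sum_(x <- s) x)%MM.

Record affine_semigroup (d : nat) := AffineSemigroup {
  sg_car :> 'X_{1..d} -> Prop;
  sg0 : sg_car 0%MM;
  sgD : forall g h, sg_car g -> sg_car h -> sg_car (g + h)%MM;
  sg_fingen : exists s : seq 'X_{1..d},
    sg_generates sg_car [set x | x \in s];
  sg_group : forall z : 'rV[int]_d, exists2 s : seq (int * 'X_{1..d}),
    (forall p, p \in s -> sg_car p.2) & z = \sum_(p <- s) p.1 *: zvec p.2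
}.

Section HilbertBasis.
Variables (d : nat) (H : affine_semigroup d).

Definition minimal_generating_set (B : set 'X_{1..d}) : Prop :=
  sg_generates H B /\
  forall B', B' `<=` B -> sg_generates H B' -> B' = B.

Definition hilbert_basis : set 'X_{1..d} :=
  [set c | exists2 B, minimal_generating_set B & B c].

End HilbertBasis.

Section Cones.
Variables (F : realType) (d : nat).
Implicit Types C : set 'rV[F]_d.

Definition real_vec (z : 'rV[int]_d) : 'rV[F]_d := map_mx intr z.

Definition ray (v : 'rV[F]_d) : set 'rV[F]_d :=
  [set t *: v | t in [set t : F | 0 <= t]].

Definition is_face C (G : set 'rV[F]_d) : Prop :=
  G `<=` C /\ forall x y, C x -> C y -> G (x + y) -> G x /\ G y.

Definition extremal_ray C (v : 'rV[F]_d) : Prop :=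
  v != 0 /\ is_face C (ray v).

(* Since 0 belongs to C, the affine hull of C is its linear span. *)
Definition relint C : set 'rV[F]_d :=
  [set x | C x /\ exists2 eps : F, 0 < eps &
     forall y, span C y -> (forall j, `|y 0 j - x 0 j| < eps) -> C y].

Variable H : affine_semigroup d.

Definition cone : set 'rV[F]_d :=
  [set x | exists2 s : seq (F * 'X_{1..d}),
     (forall p, p \in s -> 0 <= p.1 /\ H p.2)
     & x = \sum_(p <- s) p.1 *: real_vec (zvec p.2)].

Definition normal : Prop :=
  [set zvec h | h in (H : set _)] = [set z | cone (real_vec z)].

Definition simplicial : Prop :=
  exists v : 'I_d -> 'rV[F]_d,
    [/\ forall i, extremal_ray cone (v i),
        forall i j, ray (v i) = ray (v j) -> i = j
      & forall w, extremal_ray cone w -> exists i, ray w = ray (v i)].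

Definition primitive (h : 'X_{1..d}) : Prop :=
  \big[gcdn/0%N]_(i < d) h i = 1%N.

Definition extremal_rays (a : 'I_d -> 'X_{1..d}) : Prop :=
  [/\ injective a,
      forall i, [/\ H (a i), primitive (a i)
                  & extremal_ray cone (real_vec (zvec (a i)))]
    & forall w, extremal_ray cone w ->
        exists i, ray w = ray (real_vec (zvec (a i)))].

(* The coordinate [x]_i of x in the basis a_1, ..., a_d. *)
Definition coord_ray (a : 'I_d -> 'X_{1..d}) (x : 'rV[F]_d) (i : 'I_d) : F :=
  (x *m invmx (\matrix_k real_vec (zvec (a k)))) 0 i.

Definition omega : set 'rV[int]_d := [set z | relint cone (real_vec z)].

Definition slim : Prop :=
  [/\ normal, simplicial
    & forall a, extremal_rays a -> forall c, hilbert_basis H c ->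
        ~ omega (zvec c) ->
        1 <= \sum_(i < d) coord_ray a (real_vec (zvec c)) i].

Lemma zvecD (g h : 'X_{1..d}) : zvec (g + h)%MM = zvec g + zvec h.
Proof. by apply/rowP => i; rewrite !mxE mnmDE PoszD. Qed.

Lemma cone_sg h : H h -> cone (real_vec (zvec h)).
Proof.
move=> Hh; exists [:: (1, h)]; last by rewrite big_seq1 scale1r.
by move=> p; rewrite inE => /eqP ->.
Qed.

Lemma cone_add x y : cone x -> cone y -> cone (x + y).
Proof.
move=> [s sP ->] [t tP ->]; exists (s ++ t); last by rewrite big_cat.
by move=> p; rewrite mem_cat => /orP[/sP|/tP].
Qed.

Lemma omegaDl g h : H g -> omega (zvec h) -> omega (zvec (g + h)%MM).
Proof.
move=> /cone_sg Cg [Ch [eps eps0 hC]]; rewrite /omega /= zvecD.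
have -> : real_vec (zvec g + zvec h) = real_vec (zvec g) + real_vec (zvec h).
  exact: map_mxD.
split; first exact: cone_add.
exists eps => // y [s sC ->] ys.
set y0 := \sum_(p <- s) _ in ys *.
rewrite -[y0](subrK (real_vec (zvec g))); apply: cone_add => //.
apply: hC => [|j]; last first.
  by have := ys j; rewrite !mxE opprD addrA.
exists ((-1, real_vec (zvec g)) :: s); last by rewrite big_cons scaleN1r addrC.
by move=> p; rewrite inE => /orP[/eqP ->|/sC].
Qed.

End Cones.

Section SemigroupRing.
Variables (K : fieldType) (d : nat) (H : affine_semigroup d).

Definition sgring_pred : {pred {mpoly K[d]}} :=
  fun p => `[< forall h, h \in msupp p -> H h >].

Lemma sgring_subring_closed : subring_closed sgring_pred.
Proof.
split=> [|p q /asboolP Hp /asboolP Hq|p q /asboolP Hp /asboolP Hq];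
  apply/asboolP => h.
- by rewrite msupp1 inE => /eqP ->; exact: sg0.
- by move/msuppB_le; rewrite mem_cat => /orP[/Hp|/Hq].
- by case/msuppM_le/allpairsP => -[g g'] /= [/Hp ? /Hq ? ->]; exact: sgD.
Qed.

HB.instance Definition _ :=
  GRing.isSubringClosed.Build {mpoly K[d]} sgring_pred sgring_subring_closed.

Record sgring := SgRing { sgring_val :> {mpoly K[d]};
                          _ : sgring_val \in sgring_pred }.

HB.instance Definition _ := [isSub for sgring_val].
HB.instance Definition _ := [Choice of sgring by <:].
HB.instance Definition _ := [SubChoice_isSubComNzRing of sgring by <:].

(* x^h as an element of K[H]; meaningful for h in H only (0 otherwise). *)
Definition sgmon (h : 'X_{1..d}) : sgring := insubd (0 : sgring) 'X_[h].

Definition max_ideal : set sgring :=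
  ideal_gen [set sgmon h | h in [set h | H h /\ h != 0%MM]].

Variable F : realType.

Definition canonical_ideal : set sgring :=
  [set p | forall h, h \in msupp (sgring_val p) -> omega F H (zvec h)].

Definition canonical_pred : {pred sgring^o} := fun p => `[< canonical_ideal p >].

Lemma canonical_submod_closed : submod_closed canonical_pred.
Proof.
have vD (x y : sgring) : sgring_val (x + y) = sgring_val x + sgring_val y.
  exact: (raddfD (val : sgring -> _)).
have vM (x y : sgring) : sgring_val (x * y) = sgring_val x * sgring_val y.
  exact: (rmorphM (val : sgring -> _)).
have v0 : sgring_val 0 = 0 by exact: (raddf0 (val : sgring -> _)).
split=> [|r p q /asboolP Op /asboolP Oq]; apply/asboolP => h.
  by rewrite v0 msupp0.
rewrite vD => /msuppD_le; rewrite mem_cat => /orP[|/Oq //].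
rewrite vM => /msuppM_le/allpairsP[[g g'] /=].
move=> [gr /Op Og ->]; apply: omegaDl => //.
by have /asboolP := valP r; apply.
Qed.

HB.instance Definition _ := GRing.isSubmodClosed.Build sgring sgring^o
  canonical_pred (GRing.submod_closed_semi canonical_submod_closed).

Record canonical_module := CanonicalModule {
  canonical_val : sgring^o; _ : canonical_val \in canonical_pred }.

HB.instance Definition _ := [isSub for canonical_val].
HB.instance Definition _ := [Choice of canonical_module by <:].
HB.instance Definition _ := [SubChoice_isSubLmodule of canonical_module by <:].

Variable b : 'X_{1..d}.

(* The submodule uR of omega_R, for u = x^b with b in omega_H. *)
Definition principal_pred : {pred canonical_module} :=
  fun w => `[< ideal_gen [set sgmon b] (canonical_val w) >].

Lemma principal_submod_closed : submod_closed principal_pred.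
Proof.
have idealE (x : sgring) :
    ideal_gen [set sgmon b] x <-> exists r : sgring, x = r * sgmon b.
  split=> [[s sb ->]|[r ->]]; last first.
    exists [:: (r, sgmon b)]; last by rewrite big_seq1.
    by move=> p; rewrite inE => /eqP ->.
  exists (\sum_(p <- s) p.1); rewrite mulr_suml; apply: eq_big_seq => p /sb /= ->.
  by [].
have vZD r (x y : canonical_module) :
    canonical_val (r *: x + y) = r * canonical_val x + canonical_val y.
  exact: (linearP (val : canonical_module -> sgring^o)).
have v0 : canonical_val 0 = 0.
  exact: (raddf0 (val : canonical_module -> sgring^o)).
split=> [|r p q /asboolP/idealE[x px] /asboolP/idealE[y qy]];
  apply/asboolP/idealE.
  by exists 0; rewrite mul0r v0.
by exists (r * x + y); rewrite vZD px qy mulrDl mulrA.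
Qed.

HB.instance Definition _ := GRing.isSubmodClosed.Build sgring canonical_module
  principal_pred (GRing.submod_closed_semi principal_submod_closed).

Definition canonical_quot : lmodType sgring := quot_lmod principal_pred.

Definition ulrich_element : Prop :=
  omega F H (zvec b) /\ ulrich canonical_quot max_ideal.

End SemigroupRing.

Arguments cone F {d} H _.
Arguments sgmon K {d} H h.
Arguments max_ideal K {d} H _.
Arguments canonical_ideal K {d} H F _.
Arguments canonical_quot K {d} H F b.
Arguments ulrich_element K {d} H F b.

(* Main.v *)
From mathcomp Require Import all_boot all_order all_algebra.
From mathcomp Require Import zify ring lra.
From mathcomp Require Import perm generic_quotient ring_quotient.
From mathcomp Require Import boolp classical_sets reals.
From mathcomp Require Import mpoly.
Require Import Defs.

Set Implicit Arguments.
Unset Strict Implicit.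
Unset Printing Implicit Defensive.

Import Order.TTheory GRing.Theory Num.Theory.

Local Open Scope ring_scope.
Local Open Scope classical_set_scope.

(* In the coordinates along the extremal rays, scaled by some N > 0 to become
   integers, the points of omega_H correspond to pairs (rho, q) of a residue
   modulo N and a vector q in N^d; adding a_i to a point adds the i-th unit
   vector to q, and the points of b + H with residue rho are those with
   q >= v_rho, for a fixed v_rho in N^d.  So over A = K[x^(a_1), ..., x^(a_d)]
   the module E = omega_R / x^b R is the direct sum of the A / (y^(v_rho)).

   Slimness makes the filtration of E by the powers of m comparable, up to a
   bounded shift, to the one by |q|, and counting monomials gives
   e(E) = sum_rho |v_rho|.  The minimal generators of E are among the monomials
   with q = 0 and v_rho <> 0, so E has at most e(E) of them, and there is
   equality iff |q| >= |v_rho| for all monomials of m omega_R.  Setting all the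
   y_i equal turns A / (y^v) into K[t] / (t^|v|), so the latter condition says
   that m omega_R is contained in uR + J omega_R.

   E is Cohen-Macaulay of dimension d - 1.  The differences x^(a_1) - x^(a_j)
   form a regular sequence, and the faces of the cone give a chain of primes.
   Longer chains of primes (or regular sequences) x_1, ..., x_n would provide
   k^n linearly independent monomials in the x_i of degree O(k), whereas only
   O(k^(d-1)) monomials of bounded degree lie outside b + H. *)

(** * Finitely generated cones and extremal rays *)

(** Regularity of the ray differences and the final inclusion rest on one computation. With the rays
    numbered from 0, identifying only [y_0, ..., y_m] still turns each [A / (y^v)] into a polynomial
    ring modulo one monomial, so membership in the sum of [x^b R] and of the
    [(x^(a_0) - x^(a_j)) omega_R] with [j <= m] can be read off from coefficients ([zsum m]).
    Passing from [m] to [m + 1] is the regularity of the next difference, and [m = d - 1] is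
    membership in [uR + J omega_R]. Length is a relation, and the multiplicity quantifies
    existentially over the dimension and the lengths. So a composition series above [m^n E] has to
    be constructed, and every other one has to be shown equally long. Dimension theory is replaced
    by a counting argument that bounds chains of primes and regular sequences alike. *)

Section ConeOf.
Variables (F : realType) (d : nat).
Implicit Types (A B : set 'rV[F]_d) (x y v : 'rV[F]_d) (s : seq 'rV[F]_d).

Definition cone_of A : set 'rV[F]_d :=
  [set x | exists2 l : seq (F * 'rV[F]_d),
     (forall p, p \in l -> 0 <= p.1 /\ A p.2) & x = \sum_(p <- l) p.1 *: p.2].

Lemma cone_of0 A : cone_of A 0.
Proof. by exists [::] => //; rewrite big_nil. Qed.

Lemma cone_ofD A x y : cone_of A x -> cone_of A y -> cone_of A (x + y).
Proof.
move=> [l lP ->] [k kP ->]; exists (l ++ k); last by rewrite big_cat.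
by move=> p; rewrite mem_cat => /orP[/lP|/kP].
Qed.

Lemma cone_ofZ A t x : 0 <= t -> cone_of A x -> cone_of A (t *: x).
Proof.
move=> t0 [l lP ->]; exists [seq (t * p.1, p.2) | p <- l].
  by move=> _ /mapP[p /lP[p0 Ap] ->]; split=> //=; exact: mulr_ge0.
by rewrite big_map scaler_sumr; apply: eq_bigr => p _; rewrite scalerA.
Qed.

Lemma cone_of_mem A x : A x -> cone_of A x.
Proof.
move=> Ax; exists [:: (1, x)]; last by rewrite big_seq1 scale1r.
by move=> p; rewrite inE => /eqP ->.
Qed.

Lemma cone_of_sub A B : A `<=` cone_of B -> cone_of A `<=` cone_of B.
Proof.
move=> AB x [l lP ->]; elim: l lP => [|p l IH] lP.
  by rewrite big_nil; exact: cone_of0.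
rewrite big_cons; apply: cone_ofD.
  by have [p0 /AB] := lP p (mem_head _ _); exact: cone_ofZ.
by apply: IH => q ql; apply: lP; rewrite inE ql orbT.
Qed.

Lemma cone_of_split A v x : cone_of A x ->
  exists2 t, 0 <= t & exists2 y, cone_of (A `&` [set w | w != v]) y &
    x = t *: v + y.
Proof.
move=> [l lP ->]; elim: l lP => [|p l IH] lP.
  exists 0 => //; exists 0; first exact: cone_of0.
  by rewrite big_nil scale0r addr0.
have [|t t0 [y Cy e]] := IH.
  by move=> q ql; apply: lP; rewrite inE ql orbT.
have [p0 Ap] := lP p (mem_head _ _); rewrite big_cons e.
have [pv|pv] := eqVneq p.2 v.
  exists (p.1 + t); first exact: addr_ge0.
  by exists y => //; rewrite pv scalerDl addrA.
exists t => //; exists (p.1 *: p.2 + y); last by rewrite addrCA.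
by apply: cone_ofD => //; apply: cone_ofZ => //; exact: cone_of_mem.
Qed.

Lemma minimal_cone_generators s :
  exists s', [/\ {subset s' <= s}, cone_of [set x | x \in s] `<=` cone_of [set x | x \in s']
    & forall v, v \in s' -> ~ cone_of ([set x | x \in s'] `&` [set w | w != v]) v].
Proof.
have [n] := ubnP (size s); elim: n s => // n IH s.
rewrite ltnS => sn; have [[v vs Cv]|min] := pselect (exists2 v, v \in s &
  cone_of ([set x | x \in s] `&` [set w | w != v]) v); last first.
  by exists s; split=> // v vs Cv; apply: min; exists v.
have [|s' [s's Cs' min]] := IH [seq w <- s | w != v].
  apply: leq_trans sn; rewrite size_filter -(count_predC (pred1 v) s).
  by rewrite -[X in (X < _)%N]add0n ltn_add2r -has_count has_pred1.
have sub : [set x | x \in s] `<=` cone_of [set x | x \in [seq w <- s | w != v]].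
  move=> w /= ws; have [->|wv] := eqVneq w v.
    apply: cone_of_sub Cv => u [/= us uv]; apply: cone_of_mem.
    by rewrite /= mem_filter uv.
  by apply: cone_of_mem; rewrite /= mem_filter wv.
exists s'; split=> // [w /s's|w]; first by rewrite mem_filter => /andP[].
by move/(cone_of_sub sub)/Cs'.
Qed.

(* If [x + y] lies on the ray of a generator [v] outside the cone of the other
   generators, then the components of [x] and [y] along those others have sum
   a nonpositive multiple of [v], and vanish as all coordinates are [>= 0]. *)
Lemma minimal_generator_ray A v :
    (forall w, A w -> forall j, 0 <= w 0 j) -> A v ->
    ~ cone_of (A `&` [set w | w != v]) v ->
  v != 0 /\ is_face (cone_of A) (ray v).
Proof.
set B := A `&` _ => Apos Av vB.
have Bpos x : cone_of B x -> forall j, 0 <= x 0 j.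
  move=> [l lP ->] j; rewrite summxE big_seq; apply: sumr_ge0 => p pl.
  rewrite mxE; have [p0 [Ap _]] := lP _ pl; apply: mulr_ge0 => //; exact: Apos.
split.
  by apply/eqP => v0; apply: vB; rewrite v0; exact: cone_of0.
split=> [_ [t t0 <-]|x y Cx Cy [t /= t0 txy]].
  by apply: cone_ofZ => //; exact: cone_of_mem.
have [r r0 [x' Bx' ex]] := cone_of_split v Cx.
have [q q0 [y' By' ey]] := cone_of_split v Cy.
have e : (t - r - q) *: v = x' + y'.
  by apply/eqP; rewrite !scalerBl txy ex ey; apply/eqP/rowP => j; rewrite !mxE; ring.
have [le0|gt0] := leP (t - r - q) 0; last first.
  case: vB; rewrite -[v](scalerK (lt0r_neq0 gt0)) e.
  apply: cone_ofZ; first by rewrite invr_ge0 ltW.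
  exact: cone_ofD.
have z j : x' 0 j = 0 /\ y' 0 j = 0.
  have := Bpos _ Bx' j; have := Bpos _ By' j; have := Apos _ Av j.
  move/rowP/(_ j): e; rewrite !mxE => e v0 y0 x0.
  have : (t - r - q) * v 0 j <= 0 by rewrite mulr_le0_ge0.
  by rewrite e => ?; split; lra.
have x'0 : x' = 0 by apply/rowP => j; rewrite mxE; exact: (z j).1.
have y'0 : y' = 0 by apply/rowP => j; rewrite mxE; exact: (z j).2.
by split; [exists r|exists q] => //; rewrite ?ex ?ey ?x'0 ?y'0 addr0.
Qed.

(** Minkowski's theorem for a finitely generated cone, pointed because its coordinates are
    nonnegative: each vector of an irredundant list of generators spans an extremal ray, so vectors
    chosen on the extremal rays already generate. *)
Lemma cone_of_extremal s (E : set 'rV[F]_d) :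
    (forall w, w \in s -> forall j, 0 <= w 0 j) ->
    (forall v, v != 0 -> is_face (cone_of [set x | x \in s]) (ray v) ->
       exists2 w, E w & ray v = ray w) ->
  cone_of [set x | x \in s] `<=` cone_of E.
Proof.
move=> spos sE; have [s' [s's Cs' min]] := minimal_cone_generators s.
have eC : cone_of [set x | x \in s] = cone_of [set x | x \in s'].
  apply/seteqP; split=> //; apply: cone_of_sub => x /= /s's xs.
  exact: cone_of_mem.
rewrite eC; apply: cone_of_sub => v /= vs'.
have [|v0] := @minimal_generator_ray [set x | x \in s'] v _ vs' (min v vs').
  by move=> w /= /s's; exact: spos.
rewrite -eC => /(sE _ v0)[w Ew rvw].
have [t /= t0 <-] : ray w v by rewrite -rvw; exists 1; rewrite ?scale1r //= ler01.
by apply: cone_ofZ => //; exact: cone_of_mem.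
Qed.

End ConeOf.

Section RayCoordinates.
Variables (F : realType) (d : nat) (H : affine_semigroup d).
Variable a : 'I_d -> 'X_{1..d}.
Implicit Types (g h : 'X_{1..d}) (x : 'rV[F]_d) (z : 'rV[int]_d).

Local Notation rz h := (real_vec F (zvec h)).

Lemma zvec_inj : injective (@zvec d).
Proof.
move=> g h /rowP e; apply/mnmP => i.
by have := e i; rewrite !mxE => -[].
Qed.

Lemma zvec_sum (s : seq 'X_{1..d}) : zvec (\sum_(x <- s) x)%MM = \sum_(x <- s) zvec x.
Proof.
apply: (big_morph _ (@zvecD d)).
by apply/rowP => i; rewrite !mxE mnm0E.
Qed.

Lemma real_vecD z z' : real_vec F (z + z') = real_vec F z + real_vec F z'.
Proof. exact: map_mxD. Qed.

Lemma real_vec_sum I (r : seq I) (f : I -> 'rV[int]_d) :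
  real_vec F (\sum_(i <- r) f i) = \sum_(i <- r) real_vec F (f i).
Proof. by apply: (big_morph _ real_vecD); rewrite /real_vec map_mx0. Qed.

Lemma coneE_cone_of : cone F H = cone_of [set rz h | h in (H : set _)].
Proof.
apply/seteqP; split=> x.
  move=> [l lP ->]; exists [seq (p.1, rz p.2) | p <- l]; last by rewrite big_map.
  by move=> _ /mapP[p /lP[p0 Hp] ->]; split=> //; exists p.2.
move=> [l lP ->]; elim: l lP => [|p l IH] lP.
  by rewrite big_nil; exists [::]; rewrite ?big_nil.
rewrite big_cons; apply: cone_add; last first.
  by apply: IH => q ql; apply: lP; rewrite inE ql orbT.
have [p0 [h Hh <-]] := lP p (mem_head _ _).
exists [:: (p.1, h)]; last by rewrite big_seq1.
by move=> q; rewrite inE => /eqP ->.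
Qed.

Lemma cone_fingen : exists2 s : seq 'rV[F]_d,
  (forall w, w \in s -> forall j, 0 <= w 0 j) &
  cone F H = cone_of [set x | x \in s].
Proof.
have [s [sH sgen]] := sg_fingen H; exists [seq rz h | h <- s].
  by move=> _ /mapP[h _ ->] j; rewrite !mxE ler0n.
rewrite coneE_cone_of; apply/seteqP; split; apply: cone_of_sub => x.
  move=> [h /sgen[l ls ->] <-]; rewrite zvec_sum real_vec_sum.
  exists [seq (1, rz g) | g <- l].
    by move=> _ /mapP[g /ls gs ->]; split=> //=; apply: map_f.
  by rewrite big_map; apply: eq_bigr => g _; rewrite scale1r.
by move=> /mapP[h hs ->]; apply: cone_of_mem; exists h => //; exact: sH.
Qed.

Hypothesis ha : extremal_rays F H a.

Definition ray_mx : 'M[F]_d := \matrix_k rz (a k).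

Lemma cone_rays x : cone F H x ->
  exists2 t : 'rV[F]_d, (forall i, 0 <= t 0 i) & x = t *m ray_mx.
Proof.
have [s spos eC] := cone_fingen; rewrite eC => Cx.
have : cone_of (range (fun i => rz (a i))) x.
  apply: cone_of_extremal Cx => // v v0; rewrite -eC => fv.
  have [_ _ /(_ v)[//|i ->]] := ha.
  by exists (rz (a i)) => //; exists i.
move=> [l lP ->]; elim: l lP => [|p l IH] lP.
  by exists 0 => [i|]; rewrite ?mxE // big_nil mul0mx.
have [|t t0 e] := IH; first by move=> q ql; apply: lP; rewrite inE ql orbT.
have [p0 [i _ pi]] := lP p (mem_head _ _).
exists (p.1 *: delta_mx 0 i + t) => [j|]; rewrite ?mxE.
  by apply: addr_ge0 => //; apply: mulr_ge0 => //; case: eqP => // _; case: eqP.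
by rewrite big_cons e mulmxDl -scalemxAl -rowE rowK pi.
Qed.

(** The unit vectors are integer combinations of elements of [H], which lie in the span of the rays
    by [cone_rays]; so the [d] rays span the space. *)
Lemma ray_mx_unit : ray_mx \in unitmx.
Proof.
rewrite -row_full_unit -sub1mx; apply/row_subP => j; rewrite row1.
have [s sH e] := sg_group H (delta_mx 0 j).
have -> : delta_mx 0 j = real_vec F (delta_mx 0 j).
  by apply/rowP => k; rewrite !mxE; case: (_ && _).
rewrite e real_vec_sum big_seq; apply: summx_sub => p ps.
have -> : real_vec F (p.1 *: zvec p.2) = p.1%:~R *: rz p.2.
  by rewrite /real_vec map_mxZ.
apply: scalemx_sub; have [t _ ->] := cone_rays (cone_sg F (sH _ ps)).
exact: submxMl.
Qed.

Lemma coord_rayE x i : coord_ray a x i = (x *m invmx ray_mx) 0 i.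
Proof. by []. Qed.

Lemma cone_coord x : cone F H x <-> forall i, 0 <= coord_ray a x i.
Proof.
split=> [/cone_rays[t t0 ->] i|x0].
  by rewrite coord_rayE mulmxK // ray_mx_unit.
rewrite -[x](mulmxKV ray_mx_unit) mulmx_sum_row.
exists [seq (coord_ray a x i, a i) | i <- enum 'I_d].
  move=> _ /mapP[i _ ->]; split=> //=.
  by have [_ /(_ i)[]] := ha.
by rewrite big_map big_enum; apply: eq_bigr => i _; rewrite rowK.
Qed.

Lemma relint_coord x : relint (cone F H) x <-> forall i, 0 < coord_ray a x i.
Proof.
split=> [[Cx [e e0 xe]] i|x0].
  have /cone_coord/(_ i) := Cx; rewrite le_eqVlt => /orP[/eqP xi|//].
  pose M := \sum_j `|rz (a i) 0 j|; have M0 : 0 <= M by exact: sumr_ge0.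
  (* Moving [x] by [t] against [a i] changes every entry by less than [e], yet turns the vanishing
     [i]-th ray coordinate into [- t]. *)
  pose t := e / (M + 1); have t0 : 0 < t by rewrite divr_gt0 // ltr_wpDl.
  have : cone F H (x - t *: rz (a i)).
    apply: xe => [|j].
      exists [:: (1, x); (- t, rz (a i))].
        move=> p; rewrite !inE => /orP[]/eqP -> //=; apply: cone_sg.
        by have [_ /(_ i)[]] := ha.
      by rewrite big_cons big_seq1 scale1r scaleNr.
    have -> : (x - t *: rz (a i)) 0 j - x 0 j = - (t * rz (a i) 0 j).
      by rewrite !mxE; ring.
    rewrite normrN normrM (gtr0_norm t0) /t mulrAC ltr_pdivrMr ?ltr_wpDl //.
    rewrite ltr_pM2l //; apply: le_lt_trans (_ : M < _); last by rewrite ltrDl.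
    by rewrite /M (bigD1 j) //= lerDl sumr_ge0.
  move/cone_coord/(_ i); rewrite coord_rayE mulmxBl mxE -coord_rayE -xi.
  rewrite add0r mxE -scalemxAl mxE -[rz (a i)](rowK (fun k => rz (a k))) -row_mul.
  by rewrite mulmxV ?ray_mx_unit // row1 !mxE !eqxx mulr1 oppr_ge0 leNgt t0.
split; first by apply/cone_coord => i; exact: ltW.
(* [M i] is the sum of the absolute coefficients of the [i]-th ray coordinate as a linear form, so a
   perturbation below [eps] moves that coordinate by at most [eps * M i]. The added 1 keeps the
   denominator positive. *)
pose M i := \sum_j `|invmx ray_mx j i|.
have M0 i : 0 <= M i by exact: sumr_ge0.
pose eps := \big[Order.min/1]_i (coord_ray a x i / (M i + 1)).
have epsP i : eps <= coord_ray a x i / (M i + 1) by exact: bigmin_le_cond.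
exists eps => [|y _ yx].
  by apply: lt_bigmin => // i _; rewrite divr_gt0 // ltr_wpDl.
apply/cone_coord => i; rewrite coord_rayE -[y](subrK x) mulmxDl mxE -coord_rayE.
suff : `|((y - x) *m invmx ray_mx) 0 i| <= coord_ray a x i.
  by rewrite ler_norml -lerBlDr sub0r => /andP[].
rewrite mxE; apply: le_trans (ler_norm_sum _ _ _) _.
apply: (@le_trans _ _ (eps * M i)).
  rewrite mulr_sumr; apply: ler_sum => j _; rewrite normrM ler_wpM2r // ltW //.
  by have := yx j; rewrite !mxE.
have := epsP i; rewrite ler_pdivlMr ?ltr_wpDl //; apply: le_trans.
rewrite ler_wpM2l ?lerDl //.
by apply: ltW; apply: lt_bigmin => // k _; rewrite divr_gt0 // ltr_wpDl.
Qed.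

End RayCoordinates.

(** * Integral coordinates *)

Section HilbertBasis.
Variables (d : nat) (H : affine_semigroup d).

Definition sg_irreducible (c : 'X_{1..d}) : Prop :=
  [/\ H c, c != 0%MM & forall g h, H g -> H h -> c = (g + h)%MM -> g = 0%MM \/ h = 0%MM].

Lemma sg_generates_irreducible : sg_generates H sg_irreducible.
Proof.
split=> [c [] //|h]; have [n] := ubnP (mdeg h); elim: n h => // n IH h hn Hh.
have [->|h0] := eqVneq h 0%MM; first by exists [::]; rewrite ?big_nil.
have [ih|ih] := pselect (sg_irreducible h).
  by exists [:: h]; rewrite ?big_seq1 // => x; rewrite inE => /eqP ->.
have [[g k] [Hg Hk e g0 k0]] : exists p : 'X_{1..d} * 'X_{1..d},
    [/\ H p.1, H p.2, h = (p.1 + p.2)%MM, p.1 != 0%MM & p.2 != 0%MM].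
  apply: contrapT => nex; apply: ih; split=> // g k Hg Hk e.
  have [->|g0] := eqVneq g 0%MM; first by left.
  have [->|k0] := eqVneq k 0%MM; first by right.
  by case: nex; exists (g, k).
rewrite /= in Hg Hk e g0 k0.
move: g0 k0; rewrite -!mdeg_eq0 -!lt0n => g0 k0.
have hd : mdeg h = (mdeg g + mdeg k)%N by rewrite e mdegD.
have [|s sP eg] := IH g _ Hg; first lia.
have [|t tP ek] := IH k _ Hk; first lia.
exists (s ++ t); last by rewrite e eg ek big_cat.
by move=> x; rewrite mem_cat => /orP[/sP|/tP].
Qed.

(** An irreducible element written as a sum over [B] coincides with one of the summands, so no
    proper subset of the irreducibles generates [H]. *)
Lemma irreducible_hilbert_basis c : sg_irreducible c -> hilbert_basis H c.
Proof.
move=> ic; exists sg_irreducible => //; split; first exact: sg_generates_irreducible.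
move=> B BI [BH Bgen]; apply/seteqP; split=> // h ih.
have [Hh h0 irr] := ih; have [s sB e] := Bgen _ Hh.
have [x xs x0] : exists2 x, x \in s & x != 0%MM.
  apply: contrapT => nx; move: h0; rewrite e big_seq big1 ?eqxx // => x xs.
  by apply/eqP; apply: contrapT => /negP x0; apply: nx; exists x.
suff -> : h = x by exact: sB.
have es : h = (x + \sum_(y <- rem x s) y)%MM by rewrite e (big_rem x).
have Hs : H (\sum_(y <- rem x s) y)%MM.
  rewrite big_seq; apply: big_ind; [exact: sg0|exact: sgD|].
  by move=> y /mem_rem/sB/BH.
case: (irr _ _ (BH _ (sB _ xs)) Hs es) => [/eqP|e0]; first by rewrite (negbTE x0).
by rewrite es e0 addm0.
Qed.

End HilbertBasis.

Section LatticeCoordinates.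
Variables (F : realType) (d : nat) (H : affine_semigroup d).
Variable a : 'I_d -> 'X_{1..d}.

(* [c h i] is [N] times the coordinate [[h]_i] along [a_i]; [N] clears
   denominators, so it may be taken to be the index of the lattice spanned
   by the [a_i]. *)
Record lattice_coords (N : nat) (c : 'X_{1..d} -> 'I_d -> int) : Prop := LatticeCoords {
  lc_gt0 : (0 < N)%N;
  lcD : forall g h i, c (g + h)%MM i = c g i + c h i;
  lc_ray : forall i j, c (a j) i = (N * (i == j))%N%:Z;
  lc_mem : forall h, H h <-> forall i, 0 <= c h i;
  lc_sub : forall g h, (forall i, c g i <= c h i) -> exists2 k, H k & h = (g + k)%MM;
  lc_omega : forall h, omega F H (zvec h) <-> forall i, 0 < c h i;
  lc_slim : forall h, H h -> exists2 s : seq 'X_{1..d},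
    (forall x, x \in s ->
       [/\ H x, x != 0%MM & (forall i, 0 < c x i) \/ N%:Z <= \sum_i c x i]) &
    h = (\sum_(x <- s) x)%MM }.

Hypotheses (slimH : slim F H) (ha : extremal_rays F H a).

Let A : 'M[int]_d := \matrix_k zvec (a k).

(** Cramer's rule: [z *m \adj A] is [\det A] times the coordinate vector of [z]. The sign makes the
    scaling factor the positive integer [|\det A|]. *)
Definition scaled_coord (z : 'rV[int]_d) (i : 'I_d) : int :=
  sgz (\det A) * (z *m \adj A) 0 i.

Let map_A : map_mx intr A = ray_mx F a.
Proof. by apply/matrixP => i j; rewrite !mxE. Qed.

Let detA : (\det A)%:~R = \det (ray_mx F a) :> F.
Proof. by rewrite -det_map_mx map_A. Qed.

Let detA_neq0 : \det A != 0.
Proof.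
have := ray_mx_unit ha; rewrite unitmxE unitfE -detA.
by apply: contra => /eqP ->.
Qed.

Lemma scaled_coordE z i :
  (scaled_coord z i)%:~R = `|\det A|%N%:R * coord_ray a (real_vec F z) i :> F.
Proof.
have -> : `|\det A|%N%:R = (sgz (\det A))%:~R * \det (ray_mx F a) :> F.
  by rewrite -detA -intrM -abszEsg -pmulrn.
rewrite /scaled_coord intrM -mulrA; congr (_ * _).
have -> : ((z *m \adj A) 0 i)%:~R = (map_mx intr (z *m \adj A)) 0 i :> F.
  by rewrite [RHS]mxE.
rewrite map_mxM map_mx_adj map_A coord_rayE /invmx (ray_mx_unit ha).
rewrite -scalemxAr [in RHS]mxE mulrA divff ?mul1r //.
by rewrite -unitfE -unitmxE (ray_mx_unit ha).
Qed.

Lemma lattice_coordsP :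
  lattice_coords `|\det A|%N (fun h => scaled_coord (zvec h)).
Proof.
have N0 : (0 < `|\det A|)%N by rewrite absz_gt0.
have ge0 z i : (0 <= scaled_coord z i) = (0 <= coord_ray a (real_vec F z) i).
  by rewrite -(ler0z F) scaled_coordE pmulr_rge0 // ltr0n.
have gt0 z i : (0 < scaled_coord z i) = (0 < coord_ray a (real_vec F z) i).
  by rewrite -(ltr0z F) scaled_coordE pmulr_rgt0 // ltr0n.
have [nH _ sH] := slimH.
(* Normality enters here: a lattice point with nonnegative coordinates lies in the cone, hence in
   [H]. This is what makes [H] and [b + H] orthants in the coordinates. *)
have zvecP z : (forall i, 0 <= scaled_coord z i) -> exists2 h, H h & zvec h = z.
  move=> z0; have : [set z | cone F H (real_vec F z)] z.
    by apply/(cone_coord ha) => i; rewrite -ge0.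
  by rewrite -nH => -[h Hh e]; exists h.
have cD z z' i : scaled_coord (z + z') i = scaled_coord z i + scaled_coord z' i.
  by rewrite /scaled_coord mulmxDl mxE mulrDr.
have om h : omega F H (zvec h) <-> forall i, 0 < scaled_coord (zvec h) i.
  split=> [/(relint_coord ha) h0 i|h0]; first by rewrite gt0.
  by apply/(relint_coord ha) => i; rewrite -gt0.
split=> //.
- by move=> g h i; rewrite zvecD cD.
- move=> i j; rewrite /scaled_coord.
  have -> : zvec (a j) = row j A by rewrite rowK.
  rewrite -row_mul mul_mx_adj !mxE eq_sym mulrnAr -abszEsg.
  by case: eqP; rewrite ?muln1 ?muln0.
- move=> h; split=> [Hh i|/zvecP[g Hg /zvec_inj <- //]].
  by rewrite ge0; have /(cone_coord ha) := cone_sg F Hh; exact.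
- move=> g h gh; have [|k Hk e] := zvecP (zvec h - zvec g).
    move=> i; have := cD (zvec h - zvec g) (zvec g) i.
    by rewrite subrK => e; have := gh i; rewrite e lerDr.
  by exists k => //; apply: zvec_inj; rewrite zvecD e addrC subrK.
(* The summands are irreducible, hence in the Hilbert basis, and slimness speaks about those that
   are not interior. *)
- move=> h /(sg_generates_irreducible H).2[s sI ->]; exists s => // x xs.
  have ix := sI _ xs; have [Hx x0 _] := ix; split=> //.
  have [ox|ox] := pselect (omega F H (zvec x)); [left; exact/om|right].
  have := sH _ ha _ (irreducible_hilbert_basis ix) ox.
  rewrite -(@ler_int F) raddf_sum /= => le1.
  rewrite (eq_bigr _ (fun i _ => scaled_coordE (zvec x) i)) -mulr_sumr.
  by rewrite -[X in X <= _]mulr1 ler_pM2l // ltr0n.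
Qed.

End LatticeCoordinates.

(** * The module omega_R / uR by its monomials *)

Section PolyFilter.
Variables (K : fieldType) (d : nat).
Implicit Types (P : pred 'X_{1..d}) (p q : {mpoly K[d]}) (h : 'X_{1..d}).

Definition pfilter P p : {mpoly K[d]} := \sum_(h <- msupp p | P h) p@_h *: 'X_[h].

Lemma mcoeff_pfilter P p h : (pfilter P p)@_h = if P h then p@_h else 0.
Proof.
rewrite /pfilter raddf_sum /=.
have [hp|hp] := boolP (h \in msupp p); last first.
  rewrite (memN_msupp_eq0 hp) if_same big_seq_cond big1 // => k /andP[kp _].
  rewrite mcoeffZ mcoeffX; case: eqP => [e|_]; last by rewrite mulr0.
  by rewrite e (negbTE hp) in kp.
rewrite big_mkcond (bigD1_seq h) ?msupp_uniq //= big1 ?addr0 => [|k kh].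
  by case: ifP; rewrite // mcoeffZ mcoeffX eqxx mulr1.
by case: ifP; rewrite // mcoeffZ mcoeffX (negbTE kh) mulr0.
Qed.

Lemma msupp_pfilter P p h : (h \in msupp (pfilter P p)) = P h && (h \in msupp p).
Proof. by rewrite !mcoeff_msupp mcoeff_pfilter; case: (P h); rewrite ?eqxx. Qed.

Lemma pfilterD P p q : pfilter P (p + q) = pfilter P p + pfilter P q.
Proof.
apply/mpolyP => h; rewrite mcoeffD !mcoeff_pfilter mcoeffD.
by case: (P h); rewrite ?addr0.
Qed.

Lemma pfilterZ P k p : pfilter P (k *: p) = k *: pfilter P p.
Proof.
apply/mpolyP => h; rewrite mcoeffZ !mcoeff_pfilter mcoeffZ.
by case: (P h); rewrite ?mulr0.
Qed.

Lemma pfilter_id P p : (forall h, h \in msupp p -> P h) -> pfilter P p = p.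
Proof.
move=> pP; apply/mpolyP => h; rewrite mcoeff_pfilter; case: ifP => // Ph.
by rewrite memN_msupp_eq0 //; apply/negP => /pP; rewrite Ph.
Qed.

Lemma pfilter_eq0 P p : (forall h, h \in msupp p -> ~~ P h) -> pfilter P p = 0.
Proof.
move=> pP; apply/mpolyP => h; rewrite mcoeff_pfilter mcoeff0; case: ifP => // Ph.
by rewrite memN_msupp_eq0 //; apply/negP => /pP; rewrite Ph.
Qed.

Lemma pfilterC P p : p = pfilter P p + pfilter (predC P) p.
Proof.
apply/mpolyP => h; rewrite mcoeffD !mcoeff_pfilter /=.
by case: (P h); rewrite ?addr0 ?add0r.
Qed.

End PolyFilter.

Section SubmoduleFacts.
Variables (R : comNzRingType) (V : lmodType R).
Implicit Types (A N : set V).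

Lemma submodule_sum N I (r : seq I) (P : pred I) (f : I -> V) : submodule N ->
  (forall i, P i -> N (f i)) -> N (\sum_(i <- r | P i) f i).
Proof. by case=> N0 ND _ fN; apply: big_ind. Qed.

Lemma submodule_sum_seq N (I : eqType) (r : seq I) (f : I -> V) : submodule N ->
  (forall i, i \in r -> N (f i)) -> N (\sum_(i <- r) f i).
Proof. by move=> sN fN; rewrite big_seq; apply: submodule_sum. Qed.

Lemma submoduleN N x : submodule N -> N x -> N (- x).
Proof. by case=> _ _ NZ /(NZ (-1)); rewrite scaleN1r. Qed.

Lemma submoduleB N x y : submodule N -> N x -> N y -> N (x - y).
Proof. by move=> sN Nx /(submoduleN sN); have [_ ND _] := sN; exact: ND. Qed.

Lemma span_submodule A : submodule (span A).
Proof.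
split=> [|x y [s sA ->] [t tA ->]|r x [s sA ->]].
- by exists [::]; rewrite ?big_nil.
- exists (s ++ t); last by rewrite big_cat.
  by move=> p; rewrite mem_cat => /orP[/sA|/tA].
- exists [seq (r * p.1, p.2) | p <- s].
    by move=> _ /mapP[p /sA Ap ->].
  by rewrite big_map scaler_sumr; apply: eq_bigr => p _; rewrite scalerA.
Qed.

Lemma mem_span A x : A x -> span A x.
Proof.
move=> Ax; exists [:: (1, x)]; last by rewrite big_seq1 scale1r.
by move=> p; rewrite inE => /eqP ->.
Qed.

Lemma span_sub A N : submodule N -> A `<=` N -> span A `<=` N.
Proof.
move=> sN AN x [s sA ->]; apply: submodule_sum_seq => // p /sA/AN.
by have [_ _] := sN; exact.
Qed.

Lemma sum_set_submodule A N : submodule A -> submodule N -> submodule (sum_set A N).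
Proof.
move=> [A0 AD AZ] [N0 ND NZ]; split=> [|x y [a Aa [n Nn <-]] [a' Aa' [n' Nn' <-]]|r x [a Aa [n Nn <-]]].
- by exists 0 => //; exists 0; rewrite ?addr0.
- exists (a + a'); first exact: AD.
  by exists (n + n'); [exact: ND|rewrite addrACA].
- exists (r *: a); first exact: AZ.
  by exists (r *: n); [exact: NZ|rewrite scalerDr].
Qed.

End SubmoduleFacts.

Section SemigroupRing.
Variables (K : fieldType) (d : nat) (H : affine_semigroup d).
Local Notation R := (sgring K H).
Local Notation sv := (@sgring_val K d H).
Implicit Types (g h k : 'X_{1..d}) (r s : R) (p : {mpoly K[d]}).

Lemma svD r s : sv (r + s) = sv r + sv s. Proof. exact: (raddfD (val : R -> _)). Qed.
Lemma svB r s : sv (r - s) = sv r - sv s. Proof. exact: (raddfB (val : R -> _)). Qed.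
Lemma svM r s : sv (r * s) = sv r * sv s. Proof. exact: (rmorphM (val : R -> _)). Qed.
Lemma sv0 : sv 0 = 0. Proof. exact: (raddf0 (val : R -> _)). Qed.
Lemma sv1 : sv 1 = 1. Proof. exact: (rmorph1 (val : R -> _)). Qed.
Lemma sv_inj : injective sv. Proof. exact: val_inj. Qed.

Lemma sv_sum I (l : seq I) (P : pred I) (f : I -> R) :
  sv (\sum_(i <- l | P i) f i) = \sum_(i <- l | P i) sv (f i).
Proof. exact: (big_morph _ svD sv0). Qed.

Lemma svP r h : h \in msupp (sv r) -> H h.
Proof. by have /asboolP := valP r; apply. Qed.

Lemma sgring_of p : (forall h, h \in msupp p -> H h) -> exists r, sv r = p.
Proof.
move=> pH; have pP : p \in sgring_pred H by apply/asboolP.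
by exists (SgRing pP).
Qed.

Lemma sgmonE h : H h -> sv (sgmon K H h) = 'X_[h].
Proof.
move=> Hh; apply: insubdK; apply/asboolP => k; rewrite msuppX inE.
by move/eqP ->.
Qed.

Lemma sgmonD g h : H g -> H h -> sgmon K H (g + h)%MM = sgmon K H g * sgmon K H h.
Proof.
by move=> Hg Hh; apply: sv_inj; rewrite svM !sgmonE ?mpolyXD //; exact: sgD.
Qed.

Lemma sgconst_subproof (c : K) : c%:MP \in sgring_pred H.
Proof.
apply/asboolP => h; rewrite msuppC; case: eqP => // _; rewrite inE => /eqP ->.
exact: sg0.
Qed.

Definition sgconst (c : K) : R := SgRing (sgconst_subproof c).

Lemma sgconst_sv (c : K) r : sv (sgconst c * r) = c *: sv r.
Proof. by rewrite svM mul_mpolyC. Qed.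

Lemma sgconst0 : sgconst 0 = 0.
Proof. by apply: sv_inj; rewrite sv0 /= mpolyC0. Qed.

Lemma sgringE r : r = \sum_(h <- msupp (sv r)) sgconst ((sv r)@_h) * sgmon K H h.
Proof.
apply: sv_inj; rewrite sv_sum {1}[sv r]mpolyE; apply: eq_big_seq => h /svP Hh.
by rewrite sgconst_sv sgmonE.
Qed.

Lemma msupp_mul p q h : h \in msupp (p * q) ->
  exists2 g, g \in msupp p & exists2 k, k \in msupp q & h = (g + k)%MM.
Proof. by case/msuppM_le/allpairsP => -[g k] /= [gp kq ->]; exists g => //; exists k. Qed.

Lemma max_idealP r : max_ideal K H r <-> (sv r)@_0%MM = 0.
Proof.
split=> [[l lP ->]|r0].
  rewrite sv_sum raddf_sum /= big_seq big1 // => p /lP[h [Hh h0] e].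
  transitivity ((sv p.1 * sv p.2)@_0%MM); first by rewrite -svM.
  rewrite -e sgmonE //; apply/eqP.
  rewrite mcoeff_eq0; apply/negP => /msupp_mul[g _ [k]].
  rewrite msuppX inE => /eqP -> /esym/eqP; rewrite mnmD_eq0.
  by rewrite (negbTE h0) andbF.
have sm := span_submodule ([set sgmon K H h | h in [set h | H h /\ h != 0%MM]] : set R^o).
rewrite [r]sgringE; apply: (submodule_sum_seq sm) => h hr.
have [_ _ sZ] := sm; apply: (sZ (sgconst _)); apply: mem_span.
exists h => //; split; first exact: svP hr.
by apply/eqP => h0; move: hr; rewrite h0 mcoeff_msupp r0 eqxx.
Qed.

Lemma max_ideal_sgmon h : H h -> h != 0%MM -> max_ideal K H (sgmon K H h).
Proof. by move=> Hh h0; apply/max_idealP; rewrite sgmonE // mcoeffX (negbTE h0). Qed.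

Lemma sgring_split r : exists2 s, max_ideal K H s & r = sgconst ((sv r)@_0%MM) + s.
Proof.
exists (r - sgconst ((sv r)@_0%MM)); last by rewrite addrC subrK.
by apply/max_idealP; rewrite svB mcoeffB /= mcoeffC eqxx mulr1 subrr.
Qed.

Lemma max_ideal_submodule : submodule (max_ideal K H : set R^o).
Proof. exact: span_submodule. Qed.

Lemma ideal_gen1 (u r : R) : ideal_gen [set u] r <-> exists s, r = s * u.
Proof.
split=> [[l lP ->]|[s ->]]; last first.
  exists [:: (s, u)]; last by rewrite big_seq1.
  by move=> p; rewrite inE => /eqP ->.
exists (\sum_(p <- l) p.1); rewrite mulr_suml; apply: eq_big_seq => p /lP /= ->.
by [].
Qed.

End SemigroupRing.

Section CanonicalQuotient.
Variables (F : realType) (K : fieldType) (d : nat) (H : affine_semigroup d).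
Variables (a : 'I_d -> 'X_{1..d}) (b : 'X_{1..d}).
Variables (N : nat) (c : 'X_{1..d} -> 'I_d -> int).
Hypotheses (lc : lattice_coords F H a N c) (hb : omega F H (zvec b)).

Local Notation R := (sgring K H).
Local Notation sv := (@sgring_val K d H).
Local Notation W := (canonical_module K H F).
Local Notation E := (canonical_quot K H F b).
Implicit Types (g h k : 'X_{1..d}) (r s : R) (p q : {mpoly K[d]}) (x y : E).

Definition interior h : bool := [forall i, 0 < c h i].
Definition above h : bool := [forall i, c b i <= c h i].
Definition essential h : bool := interior h && ~~ above h.

Lemma interiorP h : omega F H (zvec h) <-> interior h.
Proof. by split=> [/(lc_omega lc)/forallP|/forallP/(lc_omega lc)]. Qed.

Lemma interior_mem h : interior h -> H h.
Proof. by move/forallP => h0; apply/(lc_mem lc) => i; exact: ltW. Qed.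

Lemma interiorD g h : H g -> interior h -> interior (g + h)%MM.
Proof.
move=> /(lc_mem lc) g0 /forallP h0; apply/forallP => i.
by rewrite (lcD lc) ltr_wpDl.
Qed.

Lemma interior_base : interior b. Proof. exact/interiorP. Qed.

Lemma aboveP h : reflect (exists2 k, H k & h = (b + k)%MM) (above h).
Proof.
apply: (iffP forallP) => [/(lc_sub lc)//|[k /(lc_mem lc) k0 ->] i].
by rewrite (lcD lc) lerDl.
Qed.

Lemma aboveD g h : H g -> above h -> above (g + h)%MM.
Proof.
move=> Hg /aboveP[k Hk ->]; apply/aboveP; exists (g + k)%MM; first exact: sgD.
by rewrite addmA [(g + b)%MM]addmC -addmA.
Qed.

Lemma above_baseD h : H h -> above (b + h)%MM.
Proof. by move=> Hh; apply/aboveP; exists h. Qed.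

Lemma above_interior h : above h -> interior h.
Proof. by case/aboveP => k Hk ->; rewrite addmC; exact: interiorD interior_base. Qed.

Lemma essential_interior h : essential h -> interior h. Proof. by case/andP. Qed.

Lemma essential_lower g h : H g -> interior h -> essential (g + h)%MM -> essential h.
Proof.
move=> Hg hi /andP[_ na]; rewrite /essential hi /=.
by apply: contra na; exact: aboveD.
Qed.

Lemma multiple_baseP r :
  (exists s, r = s * sgmon K H b) <-> forall h, h \in msupp (sv r) -> above h.
Proof.
have Hb := interior_mem interior_base.
split=> [[s ->] h|ra].
  rewrite svM sgmonE // => /msupp_mul[g gs [k]]; rewrite msuppX inE => /eqP -> ->.
  by rewrite addmC; apply: above_baseD; exact: svP gs.
pose s := \sum_(h <- msupp (sv r)) sgconst H ((sv r)@_h) * sgmon K H (h - b)%MM.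
exists s; rewrite [LHS]sgringE mulr_suml; apply: eq_big_seq => h /ra/aboveP[k Hk ->].
by rewrite -mulrA -sgmonD ?[(b + k)%MM]addmC ?addmK.
Qed.

Definition cval (w : W) : {mpoly K[d]} := sv (canonical_val w).

Lemma cvalB (v w : W) : cval (v - w) = cval v - cval w.
Proof. by rewrite /cval -svB. Qed.

Lemma cvalZ r (w : W) : cval (r *: w) = sv r * cval w.
Proof. by rewrite /cval -svM. Qed.

Lemma cvalD (v w : W) : cval (v + w) = cval v + cval w.
Proof. by rewrite /cval -svD. Qed.

Lemma cvalP (w : W) h : h \in msupp (cval w) -> interior h.
Proof. by move=> hw; apply/interiorP; have /asboolP := valP w; apply. Qed.

Lemma canonical_of p : (forall h, h \in msupp p -> interior h) -> exists w : W, cval w = p.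
Proof.
move=> pi; have [|r rp] := @sgring_of K d H p; first by move=> h /pi/interior_mem.
have rP : r \in canonical_pred F (H := H) (K := K).
  by apply/asboolP => h; rewrite rp => /pi/interiorP.
by exists (CanonicalModule rP).
Qed.

Definition cproj (w : W) : E := quot_pi (principal_pred b) w.

Lemma cproj_eq (v w : W) :
  cproj v = cproj w <-> forall h, ~~ above h -> (cval v)@_h = (cval w)@_h.
Proof.
have -> : cproj v = cproj w <-> (v - w) \in principal_pred b.
  by split=> [/eqP|?]; last apply/eqP; rewrite quot_piP.
split=> [/asboolP/ideal_gen1/multiple_baseP vw h nh|vw].
  apply/eqP; rewrite -subr_eq0 -mcoeffB -cvalB mcoeff_eq0.
  by apply: contra nh; exact: vw.
apply/asboolP/ideal_gen1/multiple_baseP => h; apply: contraLR => /vw e.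
by rewrite -[X in _ \notin msupp X]/(cval _) -mcoeff_eq0 cvalB mcoeffB e subrr.
Qed.

Lemma cproj_surj x : exists w, cproj w = x.
Proof. by exists (repr (x : @Quotient.quot _ (quot_pred (principal_pred b)))); exact: quot_piK. Qed.

Lemma cprojD v w : cproj (v + w) = cproj v + cproj w.
Proof. exact: quot_piD. Qed.

Lemma cprojZ r w : cproj (r *: w) = r *: cproj w.
Proof. by rewrite -[RHS]/(quot_scale r _) quot_piZ. Qed.

(** Each class has a single representative without monomials of [x^b R]. Its coefficients are the
    coordinates of the class in the monomial basis, so statements about [E] become statements about
    supports. *)
Definition nf x : {mpoly K[d]} := pfilter (predC above)
  (cval (repr (x : @Quotient.quot _ (quot_pred (principal_pred b))))).

Lemma nf_cproj w : nf (cproj w) = pfilter (predC above) (cval w).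
Proof.
apply/mpolyP => h; rewrite !mcoeff_pfilter; case: ifP => // nh.
set v := repr _; suff /cproj_eq -> : cproj v = cproj w by [].
exact: quot_piK.
Qed.

Lemma nf_inj : injective nf.
Proof.
move=> x y; have [v <-] := cproj_surj x; have [w <-] := cproj_surj y.
rewrite !nf_cproj => e; apply/cproj_eq => h nh.
by move/mpolyP/(_ h): e; rewrite !mcoeff_pfilter /= nh.
Qed.

Lemma nfP x h : h \in msupp (nf x) -> essential h.
Proof.
by have [w <-] := cproj_surj x; rewrite nf_cproj msupp_pfilter => /andP[nh /cvalP hi]; apply/andP.
Qed.

Lemma nf_above x h : above h -> (nf x)@_h = 0.
Proof. by move=> ah; rewrite mcoeff_pfilter /= ah. Qed.

Lemma nfD x y : nf (x + y) = nf x + nf y.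
Proof.
have [v <-] := cproj_surj x; have [w <-] := cproj_surj y.
by rewrite -cprojD !nf_cproj cvalD pfilterD.
Qed.

Lemma nf0 : nf 0 = 0.
Proof. by apply: (@addIr _ (nf 0)); rewrite -nfD !add0r. Qed.

Lemma nfN x : nf (- x) = - nf x.
Proof. by apply: (@addIr _ (nf x)); rewrite -nfD !addNr nf0. Qed.

Lemma nfB x y : nf (x - y) = nf x - nf y.
Proof. by rewrite nfD nfN. Qed.

Lemma nf_sum I (l : seq I) (P : pred I) (f : I -> E) :
  nf (\sum_(i <- l | P i) f i) = \sum_(i <- l | P i) nf (f i).
Proof. exact: (big_morph _ nfD nf0). Qed.

Lemma pfilter_above_mul r p :
  pfilter (predC above) (sv r * pfilter (predC above) p) = pfilter (predC above) (sv r * p).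
Proof.
rewrite {2}[p](pfilterC (predC above)) mulrDr pfilterD -[LHS]addr0; congr (_ + _).
apply/esym/pfilter_eq0 => h /msupp_mul[g gr [k]].
rewrite msupp_pfilter /= negbK => /andP[ka _] ->.
by rewrite negbK; apply: aboveD => //; exact: svP gr.
Qed.

Lemma nfZ r x : nf (r *: x) = pfilter (predC above) (sv r * nf x).
Proof.
have [w <-] := cproj_surj x.
by rewrite -cprojZ !nf_cproj cvalZ pfilter_above_mul.
Qed.

Lemma nfZ_const (t : K) x : nf (sgconst H t *: x) = t *: nf x.
Proof.
rewrite nfZ mul_mpolyC pfilterZ pfilter_id // => h /nfP/andP[_]; exact.
Qed.

Lemma nf_surj p : (forall h, h \in msupp p -> essential h) -> exists x, nf x = p.
Proof.
move=> pe; have [|w wp] := @canonical_of p; first by move=> h /pe/andP[].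
by exists (cproj w); rewrite nf_cproj wp pfilter_id // => h /pe/andP[_].
Qed.

Lemma nf_eq0 x : nf x = 0 -> x = 0.
Proof. by move=> e; apply: nf_inj; rewrite nf0. Qed.

Lemma msupp_nfZ r x h : h \in msupp (nf (r *: x)) ->
  exists2 g, g \in msupp (sv r) & exists2 k, k \in msupp (nf x) & h = (g + k)%MM.
Proof. by rewrite nfZ msupp_pfilter => /andP[_ /msupp_mul]. Qed.

Lemma msupp_nfD x y h : h \in msupp (nf (x + y)) -> h \in msupp (nf x) \/ h \in msupp (nf y).
Proof. by rewrite nfD => /msuppD_le; rewrite mem_cat => /orP. Qed.

(** The class of [x^h] for an essential [h]. For other [h] no normal form is [x^h], and the value is
    the default 0. *)
Definition emon h : E := xget 0 [set x | nf x = 'X_[h]].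

Lemma nf_emon h : essential h -> nf (emon h) = 'X_[h].
Proof.
move=> eh; rewrite /emon; case: xgetP => [x -> //|].
have [|x ex] := @nf_surj 'X_[h]; first by move=> k; rewrite msuppX inE => /eqP ->.
by move/(_ x); case.
Qed.

Lemma emon_expand x :
  x = \sum_(h <- msupp (nf x)) sgconst H ((nf x)@_h) *: emon h.
Proof.
apply: nf_inj; rewrite nf_sum {1}[nf x]mpolyE; apply: eq_big_seq => h /nfP eh.
by rewrite nfZ_const nf_emon.
Qed.

Lemma emonD g h : H g -> interior h -> essential (g + h)%MM ->
  emon (g + h)%MM = sgmon K H g *: emon h.
Proof.
move=> Hg hi egh; have eh := essential_lower Hg hi egh.
apply: nf_inj; rewrite nfZ !nf_emon // sgmonE // -mpolyXD pfilter_id //.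
by move=> k; rewrite msuppX inE => /eqP ->; case/andP: egh.
Qed.

Lemma emon_sub (M : set E) x : submodule M ->
  (forall h, h \in msupp (nf x) -> M (emon h)) -> M x.
Proof.
move=> sM xM; rewrite [x]emon_expand; apply: submodule_sum_seq => // h /xM.
by have [_ _] := sM; exact.
Qed.

(** [omega_R] lies in [R], so [x^b omega_R] lies in [x^b R]. This puts [x^b], and all of [x^b R],
    into every prime of the support. *)
Lemma sgmon_base_kills x : sgmon K H b *: x = 0.
Proof.
apply: nf_eq0; apply/mpolyP => h; rewrite mcoeff0; apply/eqP.
rewrite mcoeff_eq0; apply/negP => hx; have /andP[_ /negP] := nfP hx; apply.
have [g] := msupp_nfZ hx.
rewrite sgmonE; last exact: interior_mem interior_base.
rewrite msuppX inE => /eqP -> [k /nfP kk ->].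
by apply: above_baseD; apply: interior_mem; exact: essential_interior.
Qed.

End CanonicalQuotient.

(** * Lengths and numbers of generators from monomial bases *)

Section Lengths.
Variables (F : realType) (K : fieldType) (d : nat) (H : affine_semigroup d).
Variables (a : 'I_d -> 'X_{1..d}) (b : 'X_{1..d}).
Variables (N : nat) (c : 'X_{1..d} -> 'I_d -> int).
Hypotheses (lc : lattice_coords F H a N c) (hb : omega F H (zvec b)).

Local Notation R := (sgring K H).
Local Notation sv := (@sgring_val K d H).
Local Notation E := (canonical_quot K H F b).
Local Notation m := (max_ideal K H).
Local Notation nf := (nf c).
Local Notation emon h := (emon F K H b c h : E).
Local Notation essential := (essential b c).
Implicit Types (g h k : 'X_{1..d}) (r s : R) (x y : E) (Q : 'X_{1..d} -> Prop).

Definition mono Q : set E := [set x | forall h, h \in msupp (nf x) -> Q h].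

Definition upclosed Q := forall g h, H g -> interior c h -> Q h -> Q (g + h)%MM.

Lemma mono_submodule Q : upclosed Q -> submodule (mono Q).
Proof.
move=> QD; split=> [h|x y Qx Qy h|r x Qx h]; first by rewrite (nf0 K lc hb) msupp0.
  by case/(msupp_nfD lc hb) => [/Qx|/Qy].
case/(msupp_nfZ lc hb) => g /svP Hg [k kx ->].
by apply: QD => //; [exact: essential_interior (nfP lc hb kx)|exact: Qx].
Qed.

(** The exponents of the monomials of [m^n omega_R]: an interior point plus [n] nonzero elements of
    [H]. *)
Fixpoint inpow n h : Prop :=
  if n is n'.+1 then exists g k, [/\ H g, g != 0%MM, inpow n' k & h = (g + k)%MM]
  else interior c h.

Lemma inpow_interior n h : inpow n h -> interior c h.
Proof.
elim: n h => //= n IH h [g [k [Hg _ /IH kk ->]]]; exact: (interiorD lc).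
Qed.

Lemma inpow_upclosed n : upclosed (inpow n).
Proof.
elim: n => [|n IH] g h Hg hi /=; first by move=> _; exact: (interiorD lc).
move=> [g' [k [Hg' g'0 kn e]]]; exists g', (g + k)%MM; split=> //.
  by apply: IH => //; exact: inpow_interior kn.
by rewrite e addmA [(g + g')%MM]addmC -addmA.
Qed.

Lemma iter_max_ideal n : iter n (prod_set m) [set: E] = mono (inpow n).
Proof.
elim: n => [|n IH].
  apply/seteqP; split=> // x _ h /(nfP lc hb); exact: essential_interior.
rewrite iterS IH; apply/seteqP; split.
  apply: span_sub; first exact/mono_submodule/inpow_upclosed.
  move=> _ [r rm [x xn <-]] h /(msupp_nfZ lc hb)[g gr [k kx ->]].
  exists g, k; split=> //; [exact: svP gr| |exact: xn].
  apply/eqP => g0; move: gr; rewrite g0 mcoeff_msupp.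
  by move/max_idealP: rm => ->; rewrite eqxx.
move=> x xn; apply: (emon_sub lc hb (span_submodule _)) => h hx.
have [g [k [Hg g0 kn e]]] := xn _ hx; have := nfP lc hb hx; rewrite e => eh.
have ki := inpow_interior kn.
rewrite (emonD K lc hb) //; apply: mem_span; exists (sgmon K H g).
  exact: max_ideal_sgmon.
exists (emon k) => // h'.
rewrite (nf_emon K lc hb) ?(essential_lower lc Hg ki eh) // msuppX inE.
by move/eqP ->.
Qed.

Section Quotient.
Variables (Q : 'X_{1..d} -> Prop) (S : seq 'X_{1..d}).
Hypothesis QD : upclosed Q.
Hypothesis Suniq : uniq S.
Hypothesis SP : forall h, h \in S <-> essential h /\ ~ Q h.

(** [S] lists a monomial basis of [E] modulo [mono Q], and [cmx] gives the coordinates in that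
    quotient. *)
Definition cmx x : 'rV[K]_(size S) := \row_i (nf x)@_(nth 0%MM S i).

Lemma cmxD x y : cmx (x + y) = cmx x + cmx y.
Proof. by apply/rowP => i; rewrite !mxE (nfD lc hb) mcoeffD. Qed.

Lemma cmxB x y : cmx (x - y) = cmx x - cmx y.
Proof. by apply/rowP => i; rewrite !mxE (nfB lc hb) mcoeffB. Qed.

Lemma cmxZ t x : cmx (sgconst H t *: x) = t *: cmx x.
Proof. by apply/rowP => i; rewrite !mxE (nfZ_const lc hb) mcoeffZ. Qed.

Lemma cmx_ker x : mono Q x <-> cmx x = 0.
Proof.
split=> [Qx|/rowP x0 h hx].
  apply/rowP => i; rewrite !mxE; apply/eqP; rewrite mcoeff_eq0.
  apply/negP => /Qx; have /SP[_] : nth 0%MM S i \in S by exact: mem_nth.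
  by [].
apply: contrapT => Qh; have hS : h \in S by apply/SP; split; [exact: (nfP lc hb hx)|exact: Qh].
have hs : (index h S < size S)%N by rewrite index_mem.
have := x0 (Ordinal hs); rewrite !mxE nth_index // => /eqP.
by rewrite mcoeff_eq0 hx.
Qed.

Lemma cmx_surj v : exists x, cmx x = v.
Proof.
pose p : {mpoly K[d]} := \sum_i v 0 i *: 'X_[nth 0%MM S i].
have pc (i : 'I_(size S)) : p@_(nth 0%MM S i) = v 0 i.
  rewrite /p raddf_sum /= (bigD1 i) //= mcoeffZ mcoeffX eqxx mulr1.
  rewrite big1 ?addr0 // => j ji; rewrite mcoeffZ mcoeffX nth_uniq //.
  by rewrite (inj_eq val_inj) (negbTE ji) mulr0.
have [h|x xp] := @nf_surj F K d H a b N c lc hb p.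
  move/msupp_sum_le/flattenP => [l /mapP[i _ ->]] /msuppZ_le.
  rewrite msuppX inE => /eqP ->.
  by have /SP[] : nth 0%MM S i \in S by exact: mem_nth.
by exists x; apply/rowP => i; rewrite mxE xp pc.
Qed.

(** With [S] sorted by decreasing degree, the elements whose coordinates vanish from position [i] on
    form a submodule, because multiplication never lowers the degree of a monomial. Consecutive ones
    differ by one dimension over [K]. *)
Lemma has_length_mono : has_length (mono Q) [set: E] (size S).
Proof.
pose le := [rel g h : 'X_{1..d} | mdeg h <= mdeg g]%N.
have le_tr : transitive le by move=> h g k /= gh hk; exact: leq_trans hk gh.
have le_tot : total le by move=> g h /=; exact: leq_total.
pose T := sort le S; have Tsz : size T = size S by rewrite size_sort.
have TS : T =i S by move=> h; rewrite mem_sort.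
have Tu : uniq T by rewrite sort_uniq.
have Tle i j : (i < size T)%N -> (j < size T)%N -> (mdeg (nth 0%MM T i) < mdeg (nth 0%MM T j))%N -> (j < i)%N.
  move=> iT jT; apply: contraTT; rewrite -!leqNgt => ij.
  by apply: (sorted_leq_nth le_tr _ 0%MM (sort_sorted le_tot S)) => // h /=.
pose C i : set E := [set x | forall j, (i <= j < size T)%N -> (nf x)@_(nth 0%MM T j) = 0].
have Csub i : submodule (C i).
  split=> [j _|x y xC yC j ij|r x xC j ij].
  - by rewrite (nf0 K lc hb) mcoeff0.
  - by rewrite (nfD lc hb) mcoeffD xC // yC // addr0.
  apply/eqP; rewrite mcoeff_eq0; apply/negP => /(msupp_nfZ lc hb)[g gr [k kx e]].
  have /andP[ij' jT] := ij.
  have : nth 0%MM T j \in T by exact: mem_nth.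
  rewrite TS => /SP[eh Qh].
  have kT : k \in T.
    rewrite TS; apply/SP; split; first exact: (nfP lc hb kx).
    move=> Qk; apply: Qh; rewrite e; apply: QD => //; first exact: svP gr.
    exact: essential_interior (nfP lc hb kx).
  have kj : (j <= index k T)%N.
    have [g0|g0] := eqVneq g 0%MM.
      by rewrite -(add0m k) -g0 -e index_uniq.
    apply: ltnW; apply: Tle; rewrite ?index_mem // nth_index // e mdegD.
    by rewrite -[X in (X < _)%N]add0n ltn_add2r lt0n mdeg_eq0.
  move: kx; rewrite mcoeff_msupp -(nth_index 0%MM kT) xC ?eqxx //.
  by rewrite (leq_trans ij' kj) index_mem.
exists C; split=> //.
- apply/seteqP; split=> x xC.
    apply/cmx_ker/rowP => i; rewrite !mxE.
    have iT : nth 0%MM S i \in T by rewrite TS mem_nth.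
    by rewrite -(nth_index 0%MM iT) xC // index_mem.
  move=> j /= jT; apply/eqP; rewrite mcoeff_eq0; apply/negP => /xC Qh.
  have : nth 0%MM T j \in S by rewrite -TS mem_nth.
  by case/SP.
- by apply/seteqP; split=> // x _ j; rewrite Tsz leqNgt andNb.
move=> i iS; have iT : (i < size T)%N by rewrite Tsz.
have sub : C i `<=` C i.+1.
  by move=> x xC j /andP[ij jT]; apply: xC; rewrite jT (ltnW ij).
set h := nth 0%MM T i.
have hS : h \in S by rewrite -TS mem_nth.
have eh : essential h by have [] := (SP h).1 hS.
split.
  split=> // /(_ (emon h)) sub'; have : C i (emon h).
    apply: sub' => j /andP[ij jT]; rewrite (nf_emon K lc hb) // mcoeffX nth_uniq //.
    by rewrite ltn_eqF.
  move/(_ i); rewrite leqnn iT (nf_emon K lc hb) // mcoeffX eqxx => /(_ isT)/eqP.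
  by rewrite oner_eq0.
move=> L Ls iL Li; have [[x Lx xi]|no] := pselect (exists2 x, L x & (nf x)@_h != 0).
  right; apply/seteqP; split=> // y yC.
  have [L0 LD LZ] := Ls.
  rewrite -(subrK (sgconst H ((nf y)@_h / (nf x)@_h) *: x) y).
  apply: LD; last exact: LZ.
  apply: iL => j /andP[ij jT]; rewrite (nfB lc hb) (nfZ_const lc hb) mcoeffB mcoeffZ.
  move: ij; rewrite leq_eqVlt => /orP[/eqP <-|ij]; first by rewrite divfK ?subrr.
  by rewrite yC ?ij // (Li x) ?ij // mulr0 subr0.
left; apply/seteqP; split=> // x Lx j /andP[ij jT].
move: ij; rewrite leq_eqVlt => /orP[/eqP <-|ij]; last by apply: (Li x); rewrite ?ij.
by apply/eqP; apply: contrapT => /negP xh; apply: no; exists x.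
Qed.

End Quotient.

(** The simple factors of any series above [m^n E] are killed by [m], so [R] acts on them through
    [K] and they are one-dimensional. Hence [l] is the dimension of [E / m^n E]. *)
Lemma has_length_iter_unique n S l : uniq S ->
    (forall h, h \in S <-> essential h /\ ~ inpow n h) ->
  has_length (iter n (prod_set m) [set: E]) [set: E] l -> l = size S.
Proof.
move=> Su SP [C [C0 Cl Cs Cst]]; rewrite iter_max_ideal in C0.
have [ms0 msD msZ] := @max_ideal_submodule K d H.
have cker := cmx_ker SP.
have Cmono i : (i <= l)%N -> mono (inpow n) `<=` C i.
  elim: i => [|i IH] il; first by rewrite C0.
  by apply: subset_trans (IH (ltnW il)) _; have [[]] := Cst i il.
have step i : (i < l)%N -> exists2 x, ~ C i x &
    forall y, C i.+1 y <-> exists t : K, C i (y - sgconst H t *: x).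
  move=> il; have [[Csub Cnsub] simple] := Cst i il.
  have [Ci0 CiD CiZ] := Cs i (ltnW il); have [Cj0 CjD CjZ] := Cs i.+1 il.
  have [x Cx nx] : exists2 x, C i.+1 x & ~ C i x.
    apply: contrapT => no; apply: Cnsub => x Cx; apply: contrapT => nx.
    by apply: no; exists x.
  (* Otherwise [C i + m x] is all of [C i.+1], and [x = y + s x] with [y] in [C i] and [s] in [m].
     Iterating, [x] agrees with [s^n x] modulo [C i], which contains [m^n E]; so [x] would lie in
     [C i]. *)
  have mx r : m r -> C i (r *: x).
    pose L : set E := [set z | exists2 y, C i y & exists2 r, m r & z = y + r *: x].
    have Ls : submodule L.
      split=> [|_ _ [y Cy [q mq ->]] [z Cz [s ms ->]]|s _ [y Cy [q mq ->]]].
      - by exists 0 => //; exists 0 => //; rewrite scale0r addr0.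
      - exists (y + z); first exact: CiD.
        by exists (q + s); [exact: msD|rewrite scalerDl addrACA].
      - exists (s *: y); first exact: CiZ.
        by exists (s * q); [exact: msZ|rewrite scalerDr scalerA].
    have iL : C i `<=` L by move=> y Cy; exists y => //; exists 0; rewrite ?scale0r ?addr0.
    have Li : L `<=` C i.+1.
      move=> _ [y Cy [s ms ->]]; apply: CjD; [exact: Csub|exact: CjZ].
    have [Le|Le] := simple L Ls iL Li => mr.
      by rewrite -Le; exists 0 => //; exists r; rewrite ?add0r.
    have [y Cy [s ms e]] : L x by rewrite Le.
    have pw (j : nat) : C i (x - s ^+ j *: x).
      elim: j => [|j IH]; first by rewrite expr0 scale1r subrr.
      have -> : x - s ^+ j.+1 *: x = y + s *: (x - s ^+ j *: x).
        by rewrite scalerBr scalerA -exprS addrA -e.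
      by apply: CiD => //; exact: CiZ.
    case: nx; rewrite -(subrK (s ^+ n *: x) x); apply: CiD => //.
    apply: (Cmono i (ltnW il)); rewrite -iter_max_ideal.
    elim: (n) => [|k IH] //; rewrite iterS exprS -scalerA.
    by apply: mem_span; exists s => //; exists (s ^+ k *: x).
  exists x => // y; split=> [Cy|[t Ct]]; last first.
    by rewrite -(subrK (sgconst H t *: x) y); apply: CjD; [exact: Csub|exact: CjZ].
  pose L : set E := [set z | exists r, C i (z - r *: x)].
  have Ls : submodule L.
    split=> [|z z' [r Cr] [s Cs']|s z [r Cr]].
    - by exists 0; rewrite scale0r subr0.
    - by exists (r + s); rewrite scalerDl opprD addrACA; exact: CiD.
    - by exists (s * r); rewrite -scalerA -scalerBr; exact: CiZ.
  have iL : C i `<=` L by move=> z Cz; exists 0; rewrite scale0r subr0.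
  have Li : L `<=` C i.+1.
    by move=> z [r Cr]; rewrite -(subrK (r *: x) z); apply: CjD; [exact: Csub|exact: CjZ].
  have [Le|Le] := simple L Ls iL Li.
    by case: nx; rewrite -Le; exists 1; rewrite scale1r subrr.
  have [r Cr] : L y by rewrite Le.
  have [s ms rs] := sgring_split r; exists ((sv r)@_0%MM).
  rewrite -(subrK (s *: x) (_ - _)); apply: CiD; last exact: mx.
  by move: Cr; rewrite {1}rs scalerDl opprD addrA.
(* The rows of the matrix are a basis of the image of [C i] in [K^S]; each step of the series adds
   one row. *)
have [M Mf MP] : exists2 M : 'M[K]_(l, size S), row_free M &
    forall x, C l x <-> (cmx S x <= M)%MS.
  suff : forall i, (i <= l)%N -> exists2 M : 'M[K]_(i, size S), row_free M &
    forall x, C i x <-> (cmx S x <= M)%MS by exact.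
  elim=> [|i IH] il.
    exists 0 => [|x]; first by rewrite /row_free mxrank0.
    rewrite C0; split=> [/cker ->|]; first exact: sub0mx.
    by move/submx0null/cker.
  have [M Mf MP] := IH (ltnW il); have [x nx xP] := step i il.
  exists (col_mx (cmx S x) M : 'M_(1 + i, size S)).
    have rk : \rank (col_mx (cmx S x) M) = \rank (cmx S x + M)%MS by rewrite addsmxE.
    apply/eqP; apply: (etrans rk); rewrite mxrank_disjoint_sum.
      rewrite (eqP Mf) rank_rV; case: eqP => // x0.
      by case: nx; apply/MP; rewrite x0 sub0mx.
    apply/eqP; rewrite -submx0; apply/row_subP => j.
    have := row_sub j (cmx S x :&: M)%MS; rewrite sub_capmx.
    case/andP=> /sub_rVP[t ->] tM; have [->|t0] := eqVneq t 0.
      by rewrite scale0r sub0mx.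
    by case: nx; apply/MP; move: tM; rewrite eqmx_scale.
  have colE (v : 'rV_(size S)) : (v <= col_mx (cmx S x) M)%MS = (v <= cmx S x + M)%MS.
    by rewrite addsmxE.
  move=> y; rewrite xP; split=> [[t /MP]|le].
    rewrite cmxB cmxZ => ytM; suff : (cmx S y <= cmx S x + M)%MS by rewrite -colE.
    rewrite -(subrK (t *: cmx S x) (cmx S y)) addrC.
    by apply: addmx_sub_adds => //; exact: scalemx_sub.
  have /sub_addsmxP[[u v] /= e] : (cmx S y <= cmx S x + M)%MS by rewrite -colE.
  exists (u 0 0); apply/MP; rewrite cmxB cmxZ e.
  by rewrite {1}[u]mx11_scalar mul_scalar_mx addrC addKr submxMl.
have Mfull : row_full M.
  rewrite -sub1mx; apply/row_subP => j.
  by have [x <-] := cmx_surj Su SP (row j 1%:M); apply/MP; rewrite Cl.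
by move: Mf Mfull; rewrite /row_free /row_full => /eqP -> /eqP.
Qed.

(** Graded Nakayama: induction on the degree shows that the monomials outside [m E] generate, and
    the images of any generators span [E / m E], which has dimension [size S]. *)
Lemma min_generators_count S n : uniq S ->
    (forall h, h \in S <-> essential h /\ ~ inpow 1 h) ->
  min_generators E n <-> n = size S.
Proof.
move=> Su SP.
have gen : span [set x | x \in [seq emon h | h <- S]] = [set: E].
  apply/seteqP; split=> // x _; apply: (emon_sub lc hb (span_submodule _)).
  move=> h /(nfP lc hb); have [k] := ubnP (mdeg h); elim: k h => // k IH h hk eh.
  have [hS|hS] := boolP (h \in S).
    by apply: mem_span; exact: map_f.
  have : inpow 1 h by apply: contrapT => nh; move/negP: hS; apply; apply/SP.
  move=> [g [h' [Hg g0 h'i e]]]; rewrite e in hk eh *.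
  rewrite (emonD K lc hb) //; have [_ _ sZ] := span_submodule ([set x | x \in [seq emon h | h <- S]] : set E).
  apply: sZ; apply: IH; last exact: (essential_lower lc Hg h'i eh).
  rewrite -ltnS; apply: leq_trans hk; rewrite ltnS mdegD -[X in (X < _)%N]add0n.
  by rewrite ltn_add2r lt0n mdeg_eq0.
have lower (s : seq E) : span [set x | x \in s] = [set: E] -> (size S <= size s)%N.
  move=> sT; pose M := \matrix_(i < size s) cmx S (nth 0 s i).
  suff : row_full M by move=> /eqP <-; exact: rank_leq_row.
  rewrite -sub1mx; apply/row_subP => j.
  have [x <-] := cmx_surj Su SP (row j 1%:M).
  have [l lP ->] : span [set x | x \in s] x by rewrite sT.
  elim: l lP => [|p l IH] lP.
    rewrite big_nil; suff -> : cmx S 0 = 0 by exact: sub0mx.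
    by apply/rowP => i; rewrite !mxE (nf0 K lc hb) mcoeff0.
  rewrite big_cons cmxD; apply: addmx_sub; last first.
    by apply: IH => q ql; apply: lP; rewrite inE ql orbT.
  (* Modulo [m E] only the constant term of a coefficient counts, so an [R]-combination becomes a
     [K]-combination of rows of [M]. *)
  have [r mr ->] := sgring_split p.1.
  rewrite scalerDl cmxD cmxZ.
  have -> : cmx S (r *: p.2) = 0.
    apply/(cmx_ker SP); have := iter_max_ideal 1; rewrite /= => <-.
    by apply: mem_span; exists r => //; exists p.2.
  rewrite addr0; apply: scalemx_sub.
  have ps : p.2 \in s by exact: lP (mem_head _ _).
  have hs : (index p.2 s < size s)%N by rewrite index_mem.
  have := row_sub (Ordinal hs) M; rewrite rowK /= nth_index //.
split=> [[[s [sT <-]] min]|->].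
  apply/eqP; rewrite eqn_leq lower // andbT.
  by have := min _ gen; rewrite size_map.
split; last exact: lower.
by exists [seq emon h | h <- S]; rewrite size_map.
Qed.

End Lengths.

(** * Counting monomials *)

Section PolynomialGrowth.
Local Open Scope nat_scope.

Lemma leq_exp_base m n k : m <= n -> m ^ k <= n ^ k.
Proof. by case: k => // k mn; rewrite leq_exp2r. Qed.

Lemma ffact_le_exp m k : m ^_ k <= m ^ k.
Proof. by elim: k => // k IH; rewrite ffactnSr expnSr leq_mul // leq_subr. Qed.

Lemma exp_le_ffact m k : (m - k) ^ k <= m ^_ k.
Proof.
elim: k => // k IH; rewrite ffactnSr expnSr leq_mul ?leq_sub2l //.
by apply: leq_trans IH; apply: leq_exp_base; rewrite leq_sub2l.
Qed.

(** Pascal's rule telescopes the difference into [s] binomials with lower index [D]. Each of them,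
    times the factorial of [D], is at most [(n + D)^D]; for the next lemma it is at least
    [(n - s)^D]. *)
Lemma binomial_diff_le n s D : s <= n ->
  D`! * ('C(n + D.+1, D.+1) - 'C(n - s + D.+1, D.+1)) <= s * (n + D) ^ D.
Proof.
elim: s => [|s IH] sn; first by rewrite subn0 subnn muln0.
have e : n - s = (n - s.+1).+1 by rewrite subnS prednK // subn_gt0.
have := IH (ltnW sn); rewrite e addSn binS mulSn.
set x := 'C(n + D.+1, D.+1); set y := 'C(_, D.+1); set z := 'C(_, D) => le.
have zle : D`! * z <= (n + D) ^ D.
  rewrite mulnC bin_ffact; apply: leq_trans (ffact_le_exp _ _) _.
  by apply: leq_exp_base; lia.
apply: leq_trans (leq_add zle le); rewrite -mulnDr leq_mul2l; apply/orP; right; lia.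
Qed.

Lemma binomial_diff_ge n s D : s <= n ->
  s * (n - s) ^ D <= D`! * ('C(n + D.+1, D.+1) - 'C(n - s + D.+1, D.+1)).
Proof.
move=> sn; suff H t : t <= s -> t * (n - s) ^ D <= D`! * ('C(n + D.+1, D.+1) - 'C(n - t + D.+1, D.+1)).
  exact: H.
elim: t => [|t IH] ts //.
have e : n - t = (n - t.+1).+1 by rewrite subnS prednK // subn_gt0; lia.
have := IH (ltnW ts); rewrite e addSn binS mulSn.
have mono : 'C((n - t.+1 + D.+1).+1, D.+1) <= 'C(n + D.+1, D.+1).
  by rewrite -addSn -e; apply: leq_bin2l; lia.
move: mono; rewrite binS.
set x := 'C(n + D.+1, D.+1); set y := 'C(_, D.+1); set z := 'C(_, D) => mono le.
have zge : (n - s) ^ D <= D`! * z.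
  rewrite mulnC bin_ffact; apply: leq_trans (exp_le_ffact _ _).
  by apply: leq_exp_base; lia.
have -> : x - y = z + (x - (y + z)) by lia.
by rewrite mulnDr; exact: leq_add.
Qed.

Lemma exp_shift_le m D : exists A, forall n, 0 < n -> (n + m) ^ D.+1 <= n ^ D.+1 + A * n ^ D.
Proof.
elim: D => [|D [A IH]]; first by exists m => n _; rewrite !expn1 expn0 muln1.
exists (A + m + m * A) => n n0; rewrite expnSr.
apply: leq_trans (leq_mul (IH n n0) (leqnn _)) _.
have le1 : n ^ D <= n ^ D.+1 by rewrite leq_pexp2l.
have [e1 e2] : n ^ D.+2 = n ^ D * n * n /\ n ^ D.+1 = n ^ D * n by rewrite !expnSr.
rewrite e2 in le1 *; rewrite e1; set x := n ^ D in le1 *.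
have -> : (x * n + A * x) * (n + m) = x * n * n + (m + A) * (x * n) + m * A * x by ring.
have -> : (A + m + m * A) * (x * n) = (m + A) * (x * n) + m * A * (x * n) by ring.
by rewrite addnA leq_add2l leq_mul2l le1 orbT.
Qed.

Lemma exp_shift_ge m D : exists A, forall n, m < n -> n ^ D.+1 <= (n - m) ^ D.+1 + A * n ^ D.
Proof.
have [A HA] := exp_shift_le m D; exists A => n mn.
have := HA (n - m); rewrite subn_gt0 => /(_ mn); rewrite subnK; last exact: ltnW.
move/leq_trans; apply; rewrite leq_add2l leq_mul2l leq_exp_base ?orbT //.
exact: leq_subr.
Qed.

End PolynomialGrowth.

Section BoundedMultinomials.
Variable d : nat.
Local Open Scope nat_scope.

(** Built from tuples of ordinals to match the form counted by [card_partial_ord_partitions]. *)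
Definition bounded_mnm n : seq 'X_{1..d} :=
  [seq [multinom (tnth t i : 'I_n.+1) : nat | i < d] |
     t : d.-tuple 'I_n.+1 <- enum [set t : d.-tuple 'I_n.+1 | \sum_(i <- t) i <= n]%SET].

Lemma bounded_mnmP n q : (q \in bounded_mnm n) = (mdeg q <= n).
Proof.
apply/mapP/idP => [[t]|qn].
  rewrite mem_enum inE big_tuple => tn ->.
  by rewrite mdegE (eq_bigr (fun i => tnth t i : nat)) // => i _; rewrite mnmE.
have qi i : q i < n.+1.
  by rewrite ltnS; apply: leq_trans qn; rewrite mdegE (bigD1 i) //= leq_addr.
exists [tuple Ordinal (qi i) | i < d]; last first.
  by apply/mnmP => i; rewrite mnmE tnth_mktuple.
rewrite mem_enum inE big_tuple (eq_bigr (fun i => q i)) -?mdegE // => i _.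
by rewrite tnth_mktuple.
Qed.

Lemma bounded_mnm_uniq n : uniq (bounded_mnm n).
Proof.
rewrite map_inj_uniq ?enum_uniq // => s t /mnmP st; apply: eq_from_tnth => i.
by apply: val_inj; have := st i; rewrite !mnmE.
Qed.

Lemma size_bounded_mnm n : size (bounded_mnm n) = 'C(n + d, d).
Proof. by rewrite size_map -cardE card_partial_ord_partitions addnC. Qed.

Lemma count_above_mnm n v : mdeg v <= n ->
  count (fun q => (v <= q)%MM) (bounded_mnm n) = 'C(n - mdeg v + d, d).
Proof.
move=> vn; rewrite -size_bounded_mnm -size_filter.
rewrite -[RHS](size_map (fun q => (v + q)%MM)); apply: perm_size; apply: uniq_perm.
- by rewrite filter_uniq // bounded_mnm_uniq.
- by rewrite map_inj_uniq ?bounded_mnm_uniq //; exact: addmI.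
move=> q; rewrite mem_filter bounded_mnmP; apply/andP/mapP => [[vq qn]|[q' + ->]].
  exists (q - v)%MM; last by rewrite addmC submK.
  by rewrite bounded_mnmP; move: qn; rewrite -{1}(submK vq) mdegD; lia.
rewrite bounded_mnmP mdegD => ?; split; [exact: lem_addr|lia].
Qed.

Lemma count_not_above_mnm n v : mdeg v <= n ->
  count (fun q => ~~ (v <= q)%MM) (bounded_mnm n) = 'C(n + d, d) - 'C(n - mdeg v + d, d).
Proof.
move=> vn; rewrite -(count_above_mnm vn) -size_bounded_mnm.
rewrite -(count_predC (fun q => (v <= q)%MM)) addKn.
by apply: eq_count.
Qed.

End BoundedMultinomials.

(** * Interior points as pairs of a residue and a vector [q] *)

Section LatticePoints.
Variables (F : realType) (d : nat) (H : affine_semigroup d).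
Variables (a : 'I_d -> 'X_{1..d}) (b : 'X_{1..d}).
Variables (N : nat) (c : 'X_{1..d} -> 'I_d -> int).
Hypotheses (lc : lattice_coords F H a N c) (hb : omega F H (zvec b)).

Implicit Types (g h k q : 'X_{1..d}).
Local Notation residue := {ffun 'I_d -> 'I_N}.
Implicit Types (rho : residue).

Lemma lc0 i : c 0%MM i = 0.
Proof. by apply: (@addIr _ (c 0%MM i)); rewrite -(lcD lc) addm0 add0r. Qed.

Lemma lc_sum I (r : seq I) (P : pred I) (f : I -> 'X_{1..d}) i :
  c (\sum_(j <- r | P j) f j)%MM i = \sum_(j <- r | P j) c (f j) i.
Proof. exact: (big_morph (fun h => c h i) (fun g h => lcD lc g h i) (lc0 i)). Qed.

Lemma lc_muln h n i : c (h *+ n)%MM i = c h i *+ n.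
Proof.
elim: n => [|n IH]; first by rewrite mulm0n mulr0n lc0.
by rewrite mulmS mulrS (lcD lc) IH.
Qed.

Lemma lc_inj g h : (forall i, c g i = c h i) -> g = h.
Proof.
move=> gh; have [|k _ hk] := lc_sub lc (g := g) (h := h); first by move=> i; rewrite gh.
have [|k' _ gk] := lc_sub lc (g := h) (h := g); first by move=> i; rewrite gh.
have /eqP : mdeg h = mdeg g + mdeg k by rewrite {1}hk mdegD.
have /eqP : mdeg g = mdeg h + mdeg k' by rewrite {1}gk mdegD.
move=> e1 e2; have k0 : mdeg k = 0%N by lia.
by move/eqP: k0; rewrite mdeg_eq0 => /eqP k0; rewrite hk k0 addm0.
Qed.

Definition ray_sum q : 'X_{1..d} := (\sum_(i < d) a i *+ q i)%MM.

Lemma lc_ray_sum q i : c (ray_sum q) i = (N * q i)%N%:Z.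
Proof.
rewrite /ray_sum lc_sum (bigD1 i) //= big1 ?addr0 => [|j ji].
  by rewrite lc_muln (lc_ray lc) eqxx muln1 -mulr_natr natz.
by rewrite lc_muln (lc_ray lc) eq_sym (negbTE ji) muln0 mul0rn.
Qed.

Lemma rayP j : H (a j).
Proof. by apply/(lc_mem lc) => i; rewrite (lc_ray lc). Qed.

Lemma ray_neq0 j : a j != 0%MM.
Proof.
apply/eqP => a0; have := lc_ray lc j j; rewrite a0 lc0 eqxx muln1 => -[N0].
by have := lc_gt0 lc; rewrite -N0.
Qed.

(* [c h i - 1] rather than [c h i] is divided by [N], so that interior points
   correspond to all pairs of a realized residue and a [q] in [N^d]. *)
Definition residue_of h : residue :=
  [ffun i => Ordinal (ltn_pmod (`|c h i|%N.-1) (lc_gt0 lc))].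
Definition quo h : 'X_{1..d} := [multinom (`|c h i|%N.-1 %/ N)%N | i < d].

Definition has_residue rho h : Prop := forall i, c h i = (rho i).+1%:Z.
(** The coordinate vectors [c h] may span a proper sublattice of [Z^d], so some residues do not
    occur. *)
Definition realized rho : bool := `[< exists h, has_residue rho h >].
Definition base_pt rho : 'X_{1..d} := xget 0%MM [set h | has_residue rho h].
Definition pt rho q : 'X_{1..d} := (base_pt rho + ray_sum q)%MM.

Lemma lc_base_pt rho i : realized rho -> c (base_pt rho) i = (rho i).+1%:Z.
Proof.
move=> /asboolP[h hr]; rewrite /base_pt; case: xgetP => [x _ xr|/(_ h)//].
exact: xr.
Qed.

Lemma lc_pt rho q i : realized rho -> c (pt rho q) i = (N * q i + (rho i).+1)%N%:Z.
Proof. by move=> rr; rewrite (lcD lc) lc_base_pt // lc_ray_sum -PoszD addnC. Qed.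

Lemma pt_interior rho q : realized rho -> interior c (pt rho q).
Proof. by move=> rr; apply/forallP => i; rewrite lc_pt // ltz_nat addnS. Qed.

Lemma interior_lc h i : interior c h -> c h i = (`|c h i|%N.-1).+1%:Z.
Proof. by move=> /forallP/(_ i); lia. Qed.

Lemma residue_pt rho q : realized rho -> residue_of (pt rho q) = rho.
Proof.
move=> rr; apply/ffunP => i; apply: val_inj; rewrite ffunE /= lc_pt // absz_nat.
by rewrite addnS /= mulnC modnMDl modn_small.
Qed.

Lemma quo_pt rho q : realized rho -> quo (pt rho q) = q.
Proof.
move=> rr; apply/mnmP => i; rewrite mnmE lc_pt // absz_nat addnS /= mulnC.
by rewrite divnMDl ?(lc_gt0 lc) // divn_small ?addn0.
Qed.

Lemma interior_split h : interior c h -> exists2 k, has_residue (residue_of h) k &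
  h = (k + ray_sum (quo h))%MM.
Proof.
move=> hi; have [i|k _ e] := lc_sub lc (g := ray_sum (quo h)) (h := h).
  rewrite lc_ray_sum mnmE (interior_lc i hi) absz_nat lez_nat.
  by rewrite mulnC (leq_trans (leq_trunc_div _ _)).
exists k; last by rewrite addmC.
move=> i; apply: (@addrI _ (c (ray_sum (quo h)) i)).
rewrite -(lcD lc) -e lc_ray_sum mnmE ffunE /= {1}(interior_lc i hi) -PoszD.
by rewrite addnS mulnC -divn_eq.
Qed.

Lemma residue_realized h : interior c h -> realized (residue_of h).
Proof. by move=> /interior_split[k kr _]; apply/asboolP; exists k. Qed.

Lemma pt_split h : interior c h -> h = pt (residue_of h) (quo h).
Proof.
move=> hi; have rr := residue_realized hi; have [k kr e] := interior_split hi.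
rewrite {1}e; congr (_ + _)%MM; apply: lc_inj => i.
by rewrite kr lc_base_pt.
Qed.

Lemma pt_ray rho q j : pt rho (q + U_(j))%MM = (a j + pt rho q)%MM.
Proof.
rewrite /pt addmA [(a j + _)%MM]addmC -addmA; congr (_ + _)%MM.
apply: lc_inj => i; rewrite (lcD lc) !lc_ray_sum (lc_ray lc) -PoszD; congr Posz.
by rewrite mnmDE mnm1E mulnDr addnC eq_sym.
Qed.

(* [thr rho] is the vector v_rho of the introduction. *)
Definition thr rho : 'X_{1..d} :=
  [multinom ((`|c b i| + N.-1 - (rho i).+1) %/ N)%N | i < d].

(** [thr rho i] is the quotient of [c b i - (rho i).+1] by [N], rounded up. The subtraction of
    naturals in it is exact: [c b i] is positive since [b] is interior, and [(rho i).+1 <= N]. *)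
Lemma above_pt rho q : realized rho -> above b c (pt rho q) = (thr rho <= q)%MM.
Proof.
move=> rr; have bi := (interiorP lc b).1 hb; have N0 := lc_gt0 lc.
apply/forallP/mnm_lepP => le i; have := le i;
  rewrite lc_pt // mnmE (interior_lc i bi) !lez_nat absz_nat;
  have := ltn_ord (rho i); move: (`|c b i|.-1) (q i) (nat_of_ord (rho i)) => x y z zN.
  by move=> le'; rewrite -ltnS ltn_divLR //; lia.
by rewrite -ltnS ltn_divLR //; lia.
Qed.

(** Each unit of [quo h] splits off one ray vector. This is one half of the comparison between the
    powers of [m] and the filtration by [|q|]; [quo_inpow] is the other. *)
Lemma inpow_quo n h : interior c h -> (n <= mdeg (quo h))%N -> inpow H c n h.
Proof.
elim: n h => // n IH h hi nq; have rr := residue_realized hi.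
have [j qj] : exists j, quo h j != 0%N.
  apply: contrapT => no; move: nq; rewrite mdegE big1 // => j _.
  by apply/eqP; apply: contrapT => /negP qj; apply: no; exists j.
have qE : quo h = ((quo h - U_(j)) + U_(j))%MM by rewrite submK // lep1mP.
exists (a j), (pt (residue_of h) (quo h - U_(j))%MM); split.
- exact: rayP.
- exact: ray_neq0.
- apply: IH; rewrite ?pt_interior // quo_pt //.
  by move: nq; rewrite {1}qE mdegD mdeg1; lia.
- by rewrite -pt_ray -qE -pt_split.
Qed.

Definition good_generator x : Prop :=
  [/\ H x, x != 0%MM & (forall i, 0 < c x i) \/ N%:Z <= \sum_i c x i].

(** Decomposing the factors by [lc_slim] cannot lower their number, because a nonzero factor has at
    least one summand. *)
Lemma inpow_good n h : inpow H c n h -> exists s k, [/\ (n <= size s)%N,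
  forall x, x \in s -> good_generator x, interior c k & h = (\sum_(x <- s) x + k)%MM].
Proof.
elim: n h => [|n IH] h; first by exists [::], h; split=> //; rewrite big_nil add0m.
move=> [g [k [Hg g0 /IH[s [l [ns sg li ->]]] ->]]].
have [t tg gt] := lc_slim lc Hg; exists (t ++ s), l; split=> //.
- rewrite size_cat; apply: leq_trans (_ : 1 + size s <= _)%N; first by rewrite ltnS.
  by rewrite leq_add2r; case: t gt {tg} g0 => // ->; rewrite big_nil eqxx.
- by move=> x; rewrite mem_cat => /orP[/tg|/sg].
- by rewrite big_cat /= addmA -gt.
Qed.

(* Few interior summands occur in a point outside [b + H], and by slimness each
   of the others has coordinate sum at least [N]. *)
Lemma quo_inpow : exists C, forall n h, ~~ above b c h -> inpow H c n h ->
  (n <= mdeg (quo h) + C)%N.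
Proof.
(* More than [B] interior summands would lift every coordinate above that of [b]. The term [d]
   accounts for the residues, which contribute at most [N] in each coordinate. *)
pose B := (\sum_i `|c b i|)%N; exists (B + d)%N => n h nh hn.
have hi := inpow_interior lc hn; have rr := residue_realized hi.
have [s [k [ns sg ki e]]] := inpow_good hn.
pose P x : bool := interior c x.
have ch i : c h i = \sum_(x <- s | P x) c x i + \sum_(x <- s | ~~ P x) c x i + c k i.
  by rewrite {1}e (lcD lc) lc_sum (bigID P).
have pos i Q : 0 <= \sum_(x <- s | Q x) c x i.
  rewrite big_seq_cond; apply: sumr_ge0 => x /andP[/sg[/(lc_mem lc) + _ _] _]; exact.
have kpos i : 0 < c k i by move/forallP: ki; exact.
have cP : (count P s <= B)%N.
  rewrite leqNgt; apply: contra nh => Bs; apply/forallP => i.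
  apply: (@le_trans _ _ (B%:Z)).
    by rewrite /B (bigD1 i) //= PoszD; have := (forallP ((interiorP lc b).1 hb)) i; lia.
  apply: (@le_trans _ _ (\sum_(x <- s | P x) c x i)); last first.
    rewrite ch -addrA lerDl; apply: addr_ge0; last exact: ltW.
    exact: (pos i (predC P)).
  apply: (@le_trans _ _ (count P s)%:Z); first by rewrite lez_nat ltnW.
  rewrite -sum1_count -natz natr_sum; apply: ler_sum => x /forallP/(_ i).
  by lia.
have cN : (N * count (predC P) s)%N%:Z <= \sum_i c h i.
  apply: (@le_trans _ _ (\sum_(x <- s | ~~ P x) \sum_i c x i)); last first.
    rewrite exchange_big /=; apply: ler_sum => i _; rewrite ch addrAC lerDr.
    by apply: addr_ge0; [exact: pos|exact: ltW].
  rewrite -sum1_count big_distrr /= -natz natr_sum big_seq_cond [leRHS]big_seq_cond.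
  apply: ler_sum => x /andP[/sg[_ _ [x0|Nx]] /negP xP]; last by rewrite muln1 natz.
  by case: xP; apply/forallP.
have cH : \sum_i c h i <= (N * mdeg (quo h) + N * d)%N%:Z.
  rewrite (pt_split hi) (eq_bigr _ (fun i _ => lc_pt (quo h) i rr)).
  rewrite quo_pt // mdegE big_distrr /= -[X in (N * X)%N]card_ord.
  rewrite -sum1_card big_distrr /= -big_split /= -natz natr_sum.
  by apply: ler_sum => i _; rewrite natz lez_nat muln1 leq_add2l ltn_ord.
have : (N * count (predC P) s <= N * (mdeg (quo h) + d))%N.
  by rewrite -lez_nat mulnDr; exact: le_trans cN cH.
rewrite leq_pmul2l ?(lc_gt0 lc) // => le2.
apply: leq_trans ns _; rewrite -(count_predC P s).
by apply: leq_trans (leq_add cP le2) _; rewrite addnCA.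
Qed.

End LatticePoints.

(** * The Hilbert function of [E] and its leading coefficient *)

Section HilbertFunction.
Variables (F : realType) (d : nat) (H : affine_semigroup d).
Variables (a : 'I_d -> 'X_{1..d}) (b : 'X_{1..d}).
Variables (N : nat) (c : 'X_{1..d} -> 'I_d -> int).
Hypotheses (lc : lattice_coords F H a N c) (hb : omega F H (zvec b)).
Local Open Scope nat_scope.

Implicit Types (g h k q : 'X_{1..d}).
Local Notation realized := (@realized d N c).
Local Notation pt := (@pt d a N c).
Local Notation thr := (@thr d b N c).
Local Notation quo := (@quo d N c).
Local Notation above := (above b c).
Local Notation essential := (essential b c).
Local Notation inpow := (inpow H c).

Definition points n : seq 'X_{1..d} :=
  [seq pt rho q | rho <- enum realized, q <- bounded_mnm d n].

Lemma mem_points n h : (h \in points n) = interior c h && (mdeg (quo h) <= n).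
Proof.
apply/allpairsP/andP => [[[rho q] /= [+ + ->]]|[hi qn]].
  rewrite mem_enum bounded_mnmP => rr qn; rewrite (pt_interior lc) //.
  by rewrite (quo_pt lc).
exists (residue_of lc h, quo h); split=> /=.
- by rewrite mem_enum; exact: residue_realized.
- by rewrite bounded_mnmP.
- exact: pt_split.
Qed.

Lemma points_uniq n : uniq (points n).
Proof.
apply: allpairs_uniq; [exact: enum_uniq|exact: bounded_mnm_uniq|].
move=> [rho q] [rho' q'] /allpairsP[[r1 q1] /= [+ _ [-> ->]]] /allpairsP[[r2 q2] /= [+ _ [-> ->]]].
rewrite !mem_enum => rr1 rr2 e.
by rewrite -(residue_pt lc q1 rr1) e (residue_pt lc q2 rr2) -(quo_pt lc q1 rr1) e (quo_pt lc q2 rr2).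
Qed.

(** A monomial basis of [E / m^n E]. It is complete because by [inpow_quo] an essential exponent
    outside [inpow n] has [|q| < n]. *)
Definition standard n : seq 'X_{1..d} :=
  [seq h <- points n | ~~ above h && ~~ `[< inpow n h >]].

Lemma standard_uniq n : uniq (standard n).
Proof. by rewrite filter_uniq // points_uniq. Qed.

Lemma standardP n h : h \in standard n <-> essential h /\ ~ inpow n h.
Proof.
rewrite mem_filter mem_points /essential; split.
  by move=> /andP[/andP[-> /negP nh] /andP[-> _]]; split=> // /asboolP.
move=> [/andP[hi ->] nh]; rewrite hi /=; apply/andP; split.
  by apply/negP => /asboolP.
rewrite leqNgt; apply/negP => /ltnW qn; apply: nh; exact: (inpow_quo lc).
Qed.

Definition mult : nat := \sum_(rho | realized rho) mdeg (thr rho).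

Lemma size_points_not_above n : size [seq h <- points n | ~~ above h] =
  \sum_(rho | realized rho) count (fun q => ~~ (thr rho <= q)%MM) (bounded_mnm d n).
Proof.
rewrite size_filter count_flatten sumnE !big_map big_enum /=.
apply: eq_bigr => rho rr; rewrite count_map; apply: eq_count => q /=.
by rewrite (above_pt lc hb).
Qed.

Lemma mdeg_thr_le rho : realized rho -> mdeg (thr rho) <= mult.
Proof. by move=> rr; rewrite /mult (bigD1 rho) //= leq_addr. Qed.

Lemma size_standard_le n D : d = D.+1 -> mult <= n ->
  D`! * size (standard n) <= mult * (n + D) ^ D.
Proof.
move=> dD en; apply: (@leq_trans (D`! * size [seq h <- points n | ~~ above h])).
  rewrite leq_mul2l /standard; apply/orP; right; rewrite !size_filter.
  by apply: sub_count => h /andP[].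
rewrite size_points_not_above big_distrr /mult big_distrl /=.
apply: leq_sum => rho rr; have le := leq_trans (mdeg_thr_le rr) en.
rewrite count_not_above_mnm //; move: (mdeg _) le => s le.
by rewrite dD; exact: binomial_diff_le.
Qed.

Lemma size_standard_ge D : d = D.+1 -> exists C, forall n, C <= n ->
  mult * (n - C) ^ D <= D`! * size (standard n).
Proof.
move=> dD; have [C CP] := quo_inpow lc hb.
(* By the choice of [C], points outside [b + H] with [|q| <= n'] are not in [inpow n]. The extra
   [mult] keeps every [mdeg (thr rho)] below [n']. *)
exists (C.+1 + mult) => n nC; pose n' := n - C.+1.
apply: (@leq_trans (D`! * size [seq h <- points n' | ~~ above h])); last first.
  rewrite leq_mul2l; apply/orP; right; apply: uniq_leq_size.
    by rewrite filter_uniq // points_uniq.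
  move=> h; rewrite mem_filter mem_points => /andP[nh /andP[hi qn]].
  apply/standardP; split; first exact/andP.
  by move=> /(CP _ _ nh); move: qn; rewrite /n'; lia.
rewrite size_points_not_above big_distrr /mult big_distrl /=.
apply: leq_sum => rho rr; have le := mdeg_thr_le rr.
have le' : mdeg (thr rho) <= n' by rewrite /n'; lia.
rewrite count_not_above_mnm //; move: (mdeg _) le le' => s le le'.
have := binomial_diff_ge D le'; rewrite -dD; apply: leq_trans.
by rewrite leq_mul2l leq_exp_base ?orbT //; rewrite /n' -subnDA leq_sub2l // leq_add2l.
Qed.

Lemma standard_growth D : d = D.+2 -> exists A n0, forall n, n0 <= n ->
  mult * n ^ D.+1 <= D.+1`! * size (standard n) + A * n ^ D /\
  D.+1`! * size (standard n) <= mult * n ^ D.+1 + A * n ^ D.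
Proof.
move=> dD; have [C CP] := size_standard_ge dD.
have [A1 HA1] := exp_shift_le D.+1 D; have [A2 HA2] := exp_shift_ge C D.
exists (mult * (A1 + A2)), (C + mult).+1 => n nn; split.
  apply: leq_trans (_ : mult * (n - C) ^ D.+1 + mult * (A1 + A2) * n ^ D <= _); last first.
    by rewrite leq_add2r; apply: CP; lia.
  rewrite -mulnA -mulnDr leq_mul2l; apply/orP; right.
  apply: leq_trans (HA2 n _) _; first lia.
  by rewrite leq_add2l leq_mul2r leq_addl orbT.
apply: leq_trans (size_standard_le dD _) _; first lia.
rewrite -mulnA -mulnDr leq_mul2l; apply/orP; right.
apply: leq_trans (HA1 n _) _; first lia.
by rewrite leq_add2l leq_mul2r leq_addr orbT.
Qed.

Lemma standard1E : exists2 T : {set {ffun 'I_d -> 'I_N}},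
  (forall rho, rho \in T <->
     [/\ realized rho, thr rho != 0%MM & ~ inpow 1 (pt rho 0%MM)]) &
  size (standard 1) = #|T|.
Proof.
pose T := finset (fun rho : {ffun 'I_d -> 'I_N} =>
  [&& realized rho, thr rho != 0%MM & ~~ `[< inpow 1 (pt rho 0%MM) >]]).
have TP rho : rho \in T <-> [/\ realized rho, thr rho != 0%MM & ~ inpow 1 (pt rho 0%MM)].
  rewrite inE; split=> [/and3P[? ? /negP nh]|[-> -> nh]]; first by split=> // /asboolP.
  by apply/negP => /asboolP.
exists T => //.
have -> : size (standard 1) = size [seq pt rho 0%MM | rho <- enum T].
  apply: perm_size; apply: uniq_perm; first exact: standard_uniq.
    rewrite map_inj_in_uniq ?enum_uniq // => rho rho'.
    rewrite !mem_enum => /TP[rr _ _] /TP[rr' _ _] e.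
    by rewrite -(residue_pt lc 0%MM rr) e (residue_pt lc).
  have le0 q : (q <= 0)%MM = (q == 0%MM).
    apply/mnm_lepP/eqP => [q0|-> //]; apply/mnmP => i.
    by have := q0 i; rewrite mnm0E leqn0 => /eqP.
  move=> h; apply/idP/mapP => [/standardP[/andP[hi nh] n1]|[rho]].
    have rr := residue_realized lc hi; have e := pt_split lc hi.
    have q0 : quo h = 0%MM.
      apply/eqP; rewrite -mdeg_eq0 -leqn0 leqNgt; apply/negP => q0.
      by apply: n1; exact: (inpow_quo lc).
    rewrite q0 in e; exists (residue_of lc h) => //; rewrite mem_enum; apply/TP.
    by split; rewrite -?e // -le0 -(above_pt lc hb) // -e.
  rewrite mem_enum => /TP[rr t0 n1] ->; apply/standardP; split=> //.
  by rewrite /essential (pt_interior lc) // (above_pt lc hb) // le0.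
by rewrite size_map cardE.
Qed.

(** A residue contributes to [standard 1] at most one point, and none if its threshold is zero, so
    never more than [mdeg (thr rho)]. Equality of the sums is therefore equality for every
    residue. *)
Lemma standard1_mult : 0 < d ->
  size (standard 1) = mult <->
  forall h, inpow 1 h -> mdeg (thr (residue_of lc h)) <= mdeg (quo h).
Proof.
move=> d0; have [T TP ->] := standard1E.
have TE : #|T| = \sum_(rho | realized rho) (rho \in T).
  rewrite -sum1_card big_mkcond [RHS]big_mkcond /=; apply: eq_bigr => rho _.
  by case: ifP => [/TP[-> _ _]|_] //; case: ifP.
have Tle rho : realized rho -> (rho \in T) <= mdeg (thr rho).
  by move=> rr; case: (boolP (_ \in _)) => // /TP[_ t0 _]; rewrite lt0n mdeg_eq0.
have -> : #|T| = mult <-> forall rho, realized rho -> (rho \in T : nat) = mdeg (thr rho).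
  rewrite TE /mult; split=> [e rho rr|e]; last exact: eq_bigr.
  have [_] := leqif_sum (fun rho rr => leqif_eq (Tle rho rr)).
  by rewrite e eqxx => /esym/forallP/(_ rho)/implyP/(_ rr)/eqP.
split=> [e h h1|e rho rr].
  have hi := inpow_interior lc h1; have rr := residue_realized lc hi.
  rewrite -e //; case: (boolP (_ \in _)) => // /TP[_ _ n1].
  rewrite lt0n mdeg_eq0; apply/eqP => q0; apply: n1.
  by rewrite -q0 -(pt_split lc hi).
apply/eqP; rewrite eqn_leq Tle //=; case: (boolP (_ \in _)) => /= [rT|rT].
  (* The point of this residue with [q] a unit vector lies in [m omega_R], so the condition gives
     [mdeg (thr rho) <= 1]. *)
  have := e (pt rho U_(Ordinal d0)%MM); rewrite (residue_pt lc) // (quo_pt lc) // mdeg1.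
  apply; apply: (inpow_quo lc); first exact: (pt_interior lc).
  by rewrite (quo_pt lc) // mdeg1.
(* If the threshold is nonzero, the condition at [q = 0] shows that the base point is not in
   [inpow 1]; so [rho] belongs to [T] after all. *)
rewrite leqn0 mdeg_eq0; apply: contraT => t0; move/negP: rT; case.
apply/TP; split=> // /e; rewrite (residue_pt lc) // (quo_pt lc) // mdeg0 leqn0 mdeg_eq0.
by rewrite (negbTE t0).
Qed.

End HilbertFunction.

(** * Bounds on chains of primes and on regular sequences *)

Section Words.

(** Exponent vectors of length [n] with entries below [k]; [wmon] turns them into monomials in
    [x 0, x 1, ...]. *)
Fixpoint words (k n : nat) : seq (seq nat) :=
  if n is n'.+1 then [seq j :: w | j <- iota 0 k, w <- words k n'] else [:: [::]].

Lemma size_words k n : size (words k n) = (k ^ n)%N.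
Proof. by elim: n => // n IH; rewrite /= size_allpairs size_iota IH expnS. Qed.

Lemma words_uniq k n : uniq (words k n).
Proof.
elim: n => // n IH; apply: allpairs_uniq => //; first exact: iota_uniq.
by move=> [j w] [j' w'] _ _ /= [-> ->].
Qed.

Fixpoint wmon (R : comNzRingType) (x : nat -> R) (w : seq nat) : R :=
  if w is j :: w' then x 0%N ^+ j * wmon (fun i => x i.+1) w' else 1.

End Words.

Section Independence.
Variables (R : comNzRingType) (V : lmodType R).

Lemma power_series_cancel (M : set V) (x : R) k (f : nat -> V) j :
    (forall v, M (x *: v) -> M v) -> (j < k)%N -> (forall i, (i < j)%N -> f i = 0) ->
  M (\sum_(i < k) x ^+ i *: f i) -> exists g, M (f j + x *: g).
Proof.
move=> Mx; elim: j k f => [|j IH] [|k] f // jk f0; rewrite big_ord_recl expr0 scale1r.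
  under eq_bigr do rewrite exprS -scalerA.
  by rewrite -scaler_sumr => Mf; exists (\sum_(i < k) x ^+ i *: f i.+1).
rewrite f0 // add0r; under eq_bigr do rewrite exprS -scalerA.
rewrite -scaler_sumr => /Mx; apply: (IH _ (fun i => f i.+1)) => // i ij.
exact: f0.
Qed.

(* A lexicographically first monomial of a relation can be isolated: cancel the
   lowest power of [x 0], then reduce modulo [x 0], i.e. pass to [M 1]. *)
Lemma chain_independent k n (M : nat -> set V) (x : nat -> R) (e : V) (c : seq nat -> R) :
    (forall i, (i <= n)%N -> submodule (M i)) ->
    (forall i, (i < n)%N -> M i `<=` M i.+1) ->
    (forall i v, (i < n)%N -> M i (x i *: v) -> M i v) ->
    (forall i v, (i < n)%N -> M i.+1 (x i *: v)) -> ~ M n e ->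
    (forall w, c w = 0 \/ exists u, u * c w = 1) ->
    M 0%N (\sum_(w <- words k n) (c w * wmon x w) *: e) ->
  forall w, w \in words k n -> c w = 0.
Proof.
elim: n M x c => [|n IH] M x c sM MS Mreg Mx ne cu.
  rewrite big_seq1 /= mulr1 => Mce w; rewrite inE => /eqP ->.
  have [//|[u uc]] := cu [::]; case: ne; rewrite -[e]scale1r -uc -scalerA.
  by have [_ _] := sM 0%N isT; exact.
rewrite /= big_allpairs_dep -[k in iota 0 k]subn0.
pose f j := \sum_(w <- words k n) (c (j :: w) * wmon (fun i => x i.+1) w) *: e.
have -> : \sum_(i <- index_iota 0 k) \sum_(j <- words k n)
    (c (i :: j) * (x 0%N ^+ i * wmon (fun i0 : nat => x i0.+1) j)) *: e =
    \sum_(i < k) x 0%N ^+ i *: f i.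
  rewrite big_mkord; apply: eq_bigr => i _; rewrite scaler_sumr.
  by apply: eq_bigr => w _; rewrite scalerA mulrCA.
move=> M0; suff all0 j : (j < k)%N -> forall w, w \in words k n -> c (j :: w) = 0.
  move=> w /allpairsP[[j v] /= [+ vw ->]].
  by rewrite mem_iota add0n subn0 /= => jk; exact: all0.
have [m] := ubnP j; elim: m j => // m IHm j jm jk.
have [i ij|g Mg] := @power_series_cancel (M 0%N) (x 0%N) k f j (fun v => Mreg 0%N v isT) jk _ M0.
  rewrite /f big_seq big1 // => w ww.
  have im : (i < m)%N by apply: leq_trans ij _; rewrite -ltnS.
  by rewrite (IHm i im (ltn_trans ij jk) w ww) mul0r scale0r.
apply: (IH (fun i => M i.+1) (fun i => x i.+1) (fun w => c (j :: w))).
- by move=> i ?; apply: sM.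
- by move=> i ?; apply: MS.
- by move=> i v ?; apply: Mreg.
- by move=> i v ?; apply: Mx.
- by [].
- by move=> w; apply: cu.
have s1 := sM 1%N isT; rewrite -[X in M 1%N X](addrK (x 0%N *: g)).
by apply: (submoduleB s1); [exact: MS Mg|exact: Mx].
Qed.

End Independence.

Section Dependence.
Variables (F : realType) (K : fieldType) (d : nat) (H : affine_semigroup d).
Variables (a : 'I_d -> 'X_{1..d}) (b : 'X_{1..d}).
Variables (N : nat) (c : 'X_{1..d} -> 'I_d -> int).
Hypotheses (lc : lattice_coords F H a N c) (hb : omega F H (zvec b)).
Local Notation R := (sgring K H).
Local Notation sv := (@sgring_val K d H).
Local Notation above := (above b c).
Implicit Types (h : 'X_{1..d}) (r : R).

Definition coords_le (L : nat) h : Prop := forall i, c h i <= L%:Z.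

Lemma card_ord_lt (m k : nat) : (#|[pred x : 'I_m | x < k]| <= k)%N.
Proof.
rewrite cardE -(size_map val) -[leqRHS](size_iota 0).
apply: uniq_leq_size; first by rewrite map_inj_uniq ?enum_uniq //; exact: val_inj.
by move=> _ /mapP[x + ->]; rewrite mem_enum mem_iota.
Qed.

Lemma card_ffun_lt D (L k : nat) (i : 'I_d) : d = D.+1 ->
  (#|[pred f : {ffun 'I_d -> 'I_L.+1} | f i < k]| <= k * L.+1 ^ D)%N.
Proof.
move=> dD; pose G (j : 'I_d) := [pred x : 'I_L.+1 | (j == i) ==> (x < k)%N].
have -> : #|[pred f : {ffun 'I_d -> 'I_L.+1} | (f i < k)%N]| = #|family G|%N.
  apply: eq_card => f; rewrite inE; apply/idP/familyP => [fi j|/(_ i)].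
    by rewrite inE; apply/implyP => /eqP ->.
  by rewrite inE eqxx.
rewrite card_family foldrE big_map big_enum /= (bigD1 i) //= leq_mul //.
  apply: leq_trans (card_ord_lt L.+1 k); apply: subset_leq_card.
  by apply/fintype.subsetP => x; rewrite !inE eqxx.
rewrite (eq_bigr (fun=> L.+1)) ?prod_nat_const.
  by rewrite leq_eqVlt; apply/orP; left; rewrite cardC1 card_ord dD.
by move=> j ji; rewrite -[RHS]card_ord; apply: eq_card => x; rewrite !inE (negbTE ji).
Qed.

(* Outside [b + H] some coordinate is bounded, so the number of points with
   all coordinates at most [L] grows with exponent [d - 1] only. *)
Lemma not_above_count D : d = D.+1 -> exists A, forall L, exists2 s : seq 'X_{1..d},
  (size s <= A * L.+1 ^ D)%N &
  forall h, H h -> ~~ above h -> coords_le L h -> h \in s.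
Proof.
move=> dD; pose k := (\sum_i `|c b i|)%N; exists (d * k)%N => L.
pose hh (f : {ffun 'I_d -> 'I_L.+1}) := xget 0%MM [set h | forall i, c h i = (f i : nat)%:Z].
pose P := [pred f : {ffun 'I_d -> 'I_L.+1} | [exists i, f i < k]%N].
exists [seq hh f | f <- enum P].
  rewrite size_map -cardE -sum1_card.
  apply: (@leq_trans (\sum_(f : {ffun 'I_d -> 'I_L.+1}) \sum_(i < d) (f i < k))%N).
    rewrite [leqLHS]big_mkcond; apply: leq_sum => f _.
    by case: ifP => // /existsP[i fi]; rewrite (bigD1 i) //= fi.
  rewrite exchange_big /= -[d in (d * k)%N]card_ord -mulnA -sum_nat_const.
  apply: leq_sum => i _; apply: leq_trans (card_ffun_lt L k i dD).
  rewrite -sum1_card [leqRHS]big_mkcond; apply: leq_sum => f _ /=.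
  by rewrite inE; case: (f i < k)%N.
move=> h /(lc_mem lc) h0 nh hL; apply/mapP.
pose f : {ffun 'I_d -> 'I_L.+1} := [ffun i => inord `|c h i|].
have fE i : (f i : nat)%:Z = c h i.
  rewrite ffunE inordK ?gez0_abs // ltnS -lez_nat gez0_abs //; exact: hL.
exists f; last first.
  apply: (lc_inj lc) => i; rewrite /hh; case: xgetP => [x _ ->//|/(_ h) nx].
  by case: nx => j; rewrite fE.
rewrite mem_enum inE; move: nh; rewrite negb_forall => /existsP[i].
rewrite -ltNge => hi; apply/existsP; exists i; rewrite -ltz_nat fE.
apply: lt_le_trans hi _; rewrite /k (bigD1 i) //= PoszD.
by have := normr_ge0 (c b i); lia.
Qed.

Lemma coords_bound r : exists B, forall h, h \in msupp (sv r) -> coords_le B h.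
Proof.
exists (\sum_(h <- msupp (sv r)) \sum_i `|c h i|)%N => h hr i.
rewrite (big_rem h) //= (bigD1 i) //=; lia.
Qed.

Lemma coords_le_mul r r' B B' :
    (forall h, h \in msupp (sv r) -> coords_le B h) ->
    (forall h, h \in msupp (sv r') -> coords_le B' h) ->
  forall h, h \in msupp (sv (r * r')) -> coords_le (B + B') h.
Proof.
move=> rB rB' h; rewrite svM => /msupp_mul[g gr [k kr ->]] i.
by rewrite (lcD lc) PoszD lerD ?rB ?rB'.
Qed.

Lemma coords_le1 B h : h \in msupp (sv 1) -> coords_le B h.
Proof. by rewrite sv1 msupp1 inE => /eqP -> i; rewrite (lc0 lc). Qed.

Lemma coords_leW B B' h : (B <= B')%N -> coords_le B h -> coords_le B' h.
Proof. by move=> BB hB i; apply: le_trans (hB i) _; rewrite lez_nat. Qed.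

Lemma coords_le_exp r B j : (forall h, h \in msupp (sv r) -> coords_le B h) ->
  forall h, h \in msupp (sv (r ^+ j)) -> coords_le (j * B) h.
Proof.
move=> rB; elim: j => [|j IH] h; first by rewrite expr0; exact: coords_le1.
by rewrite exprS mulSn; apply: coords_le_mul.
Qed.

Lemma coords_le_wmon k n (x : nat -> R) B w :
    (forall i h, (i < n)%N -> h \in msupp (sv (x i)) -> coords_le B h) -> w \in words k n ->
  forall h, h \in msupp (sv (wmon x w)) -> coords_le (n * (k * B)) h.
Proof.
elim: n x w => [|n IH] x w xB; first by rewrite inE => /eqP -> h /=; exact: coords_le1.
move=> /allpairsP[[j v] /= [+ vw ->]]; rewrite mem_iota /= => jk.
rewrite mulSn; apply: coords_le_mul; last by apply: IH vw => i h ?; exact: xB.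
move=> h hx; apply: coords_leW (coords_le_exp (B := B) _ hx); first by rewrite leq_mul2r ltnW ?orbT.
by move=> g; exact: xB.
Qed.

(** The [k^n] products have coordinates of size [O(k)], and outside [b + H] only [O(k^D)] such
    exponents are available, so for large [k] there is a relation modulo [x^b R]. The factor [p]
    carries over to relations on an element of [E]. *)
Lemma monomials_dependent D n (x : nat -> R) (p : R) : d = D.+1 -> (D < n)%N ->
  exists k (t : seq nat -> K), (exists2 w, w \in words k n & t w != 0) /\
    forall h, ~~ above h ->
      (sv (\sum_(w <- words k n) sgconst H (t w) * (wmon x w * p)))@_h = 0.
Proof.
move=> dD Dn; have [A HA] := not_above_count dD.
have [B xB] : exists B, forall i h, (i < n)%N -> h \in msupp (sv (x i)) -> coords_le B h.
  elim: (n) => [|m [B IH]]; first by exists 0%N.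
  have [B' HB'] := coords_bound (x m); exists (B + B')%N => i h.
  rewrite ltnS leq_eqVlt => /orP[/eqP ->|im] hx.
    by apply: coords_leW (HB' _ hx); rewrite leq_addl.
  by apply: coords_leW (IH _ _ im hx); rewrite leq_addr.
have [B0 pB] := coords_bound p.
(* The coordinates are at most [L = n * (k * B) + B0], and [L.+1 <= k * (n * B + B0).+1]. With this
   [k] the number of exponents is at most [(k - 1) * k^D], which is less than [k^D.+1]. *)
pose k := (A * (n * B + B0).+1 ^ D).+1; exists k.
have [s ssz sP] := HA (n * (k * B) + B0)%N.
have lt : (size s < size (words k n))%N.
  rewrite size_words; apply: leq_trans (_ : k ^ D.+1 <= _)%N; last first.
    by rewrite leq_pexp2l.
  apply: leq_ltn_trans ssz _.
  apply: leq_ltn_trans (_ : A * (k * (n * B + B0).+1) ^ D < _)%N.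
    rewrite leq_mul2l leq_exp_base ?orbT // mulnS mulnDr mulnCA.
    by rewrite -addn1 addnC leq_add // leq_add2l leq_pmull.
  have -> : (A * (k * (n * B + B0).+1) ^ D = k.-1 * k ^ D)%N.
    by rewrite expnMn mulnCA mulnC.
  by rewrite expnS ltn_pmul2r ?expn_gt0.
pose M := \matrix_(i < size (words k n), j < size s)
  (sv (wmon x (nth [::] (words k n) i) * p))@_(nth 0%MM s j).
have /rowV0Pn[v vM v0] : kermx M != 0.
  by rewrite kermx_eq0 /row_free ltn_eqF // (leq_ltn_trans (rank_leq_col M)).
pose t w := if insub (index w (words k n)) is Some i then v 0 i else 0.
have tE (i : 'I_(size (words k n))) : t (nth [::] (words k n) i) = v 0 i.
  by rewrite /t index_uniq ?words_uniq // valK.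
exists t; split.
  apply: contrapT => no; case/eqP: v0; apply/rowP => i; rewrite mxE -tE.
  apply/eqP; apply: contrapT => /negP ti; apply: no.
  by exists (nth [::] (words k n) i); rewrite ?mem_nth.
move=> h nh; rewrite sv_sum raddf_sum.
have [hs|hs] := boolP (h \in s).
  have hi : (index h s < size s)%N by rewrite index_mem.
  move: vM => /sub_kermxP/rowP/(_ (Ordinal hi)); rewrite !mxE => vM0.
  rewrite -[RHS]vM0 (big_nth [::]) big_mkord; apply: eq_bigr => i _.
  by rewrite sgconst_sv /= mcoeffZ tE !mxE /= nth_index.
rewrite big_seq big1 // => w ww.
transitivity (mcoeff h (t w *: sv (wmon x w * p))); first by rewrite -sgconst_sv.
rewrite mcoeffZ.
apply/eqP; rewrite mulf_eq0 mcoeff_eq0; apply/orP; right.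
apply: contra hs => hw; apply: sP => //; first exact: svP hw.
exact: coords_le_mul (coords_le_wmon xB ww) pB _ hw.
Qed.

End Dependence.

(** * Krull dimension of [E] and the upper bound on depth *)

Section Dimension.
Variables (F : realType) (K : fieldType) (d : nat) (H : affine_semigroup d).
Variables (a : 'I_d -> 'X_{1..d}) (b : 'X_{1..d}).
Variables (N : nat) (c : 'X_{1..d} -> 'I_d -> int).
Hypotheses (lc : lattice_coords F H a N c) (hb : omega F H (zvec b)).
Variable D : nat.
Hypothesis dD : d = D.+1.
Local Notation R := (sgring K H).
Local Notation sv := (@sgring_val K d H).
Local Notation E := (canonical_quot K H F b).
Local Notation nf := (nf c).
Implicit Types (h : 'X_{1..d}) (r s x y : R).

Lemma sgconst_inv (t : K) : sgconst H t = 0 \/ exists u, u * sgconst H t = 1.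
Proof.
have [->|t0] := eqVneq t 0; [by left; exact: sgconst0|right].
exists (sgconst H t^-1); apply: sv_inj.
by rewrite sgconst_sv sv1 /= -mul_mpolyC -mpolyCM mulVf.
Qed.

Lemma sgconst_eq0 (t : K) : sgconst H t = 0 -> t = 0.
Proof.
move/(congr1 sv); rewrite sv0 => /(congr1 (mcoeff 0%MM)).
by rewrite /= mcoeffC eqxx mulr1 mcoeff0.
Qed.

(** Choose [x i] in [p i.+1] outside [p i]. A relation modulo [x^b R] among their monomials lies in
    the annihilator, hence in [p 0], against [chain_independent]. *)
Lemma support_chain_le n : support_chain E n -> (n <= D)%N.
Proof.
move=> [p [pP pS]]; rewrite leqNgt; apply/negP => Dn.
have psub i : (i <= n)%N -> submodule (p i : set R^o) by move=> /pP[[]].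
have pick i : exists x, (i < n)%N -> p i.+1 x /\ ~ p i x.
  have [i_n|ni] := pselect (i < n)%N; last by exists 0 => /ni.
  have [_ nsub] := pS i i_n; apply: contrapT => no; apply: nsub => x px.
  by apply: contrapT => nx; apply: no; exists x.
have {pick}[x xP] := choice pick.
have [k [t [[w ww tw] dep]]] := monomials_dependent b lc x 1 dD Dn.
case/eqP: tw; apply: sgconst_eq0.
have [[_ p0n _] pann] := pP 0%N isT.
apply: (@chain_independent R R^o k n p x 1 (fun w => sgconst H (t w))) ww => //.
- by move=> i i_n; have [] := pS i i_n.
- move=> i v i_n; have [[_ _ prime] _] := pP i (ltnW i_n).
  by case/prime => //; have [] := xP i i_n.
- move=> i v i_n; have [_ _ pZ] := psub i.+1 i_n.
  by rewrite -[x i *: v]/(x i * v) mulrC; apply: (pZ v); have [] := xP i i_n.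
- by have [[]] := pP n (leqnn n).
- by move=> v; exact: sgconst_inv.
have [_ _ pZ] := psub 0%N isT.
set z : R^o := \sum_(v <- _) _.
have [|s ->] := (multiple_baseP lc hb z).2.
  move=> h; rewrite mcoeff_msupp; apply: contraNT => /dep e; rewrite -[X in _ == X]e.
  apply/eqP; congr ((sv _)@_h); apply: eq_bigr => v _.
  by rewrite mulr1 -[_ *: _]/(_ * _) mulr1.
apply: (pZ s); apply: pann => y; exact: (sgmon_base_kills lc hb).
Qed.

(** The relation is applied to an [e] outside [(s) E], lifted to [R] as [nf e]. It vanishes in [E],
    against [chain_independent] for the submodules generated by initial segments of [s]. *)
Lemma regular_sequence_le (s : seq R) : regular_sequence E s -> (size s <= D)%N.
Proof.
move=> [reg ne]; rewrite leqNgt; apply/negP => Ds.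
pose M i : set E := prod_set [set r | r \in take i s] [set: E].
have sM i : submodule (M i) by exact: span_submodule.
have [e neM] : exists e, ~ M (size s) e.
  apply: contrapT => no; apply: ne; rewrite -[s in [set r | r \in s]]take_size.
  by apply/seteqP; split=> // e _; apply: contrapT => nM; apply: no; exists e.
have [p pe] : exists p : R, sv p = nf e.
  apply: sgring_of => h /(nfP lc hb)/essential_interior; exact: interior_mem lc _.
have [k [t [[w ww tw] dep]]] := monomials_dependent b lc (fun i => s`_i) p dD Ds.
case/eqP: tw; apply: sgconst_eq0.
apply: (@chain_independent R E k (size s) M (fun i => s`_i) e (fun w => sgconst H (t w))) ww => //.
- move=> i i_s; apply: span_sub => // x [r /= rs [y _ <-]].
  apply: mem_span; exists r; last by exists y.
  by rewrite /= (take_nth 0) // mem_rcons inE rs orbT.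
- move=> i v i_s; apply: mem_span; exists s`_i; last by exists v.
  by rewrite /= (take_nth 0) // mem_rcons inE eqxx.
- by move=> v; exact: sgconst_inv.
set z := \sum_(v <- _) _; suff -> : z = 0 by have [] := sM 0%N.
apply: (nf_eq0 lc hb); apply/mpolyP => h; rewrite mcoeff0.
have [ah|nh] := boolP (above b c h); first exact: nf_above.
rewrite -[RHS](dep h nh) /z (nf_sum lc hb) sv_sum !raddf_sum.
apply: eq_bigr => v _; rewrite /= (nfZ lc hb) mcoeff_pfilter /= nh.
by rewrite -pe -svM mulrA.
Qed.

Definition face_prime (A : {set 'I_d}) : set R :=
  [set r | forall h, h \in msupp (sv r) -> exists2 i, i \in A & 0 < c h i].

Lemma face_prime_submodule A : submodule (face_prime A : set R^o).
Proof.
split=> [h|x y xA yA h|r x xA h]; first by rewrite sv0 msupp0.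
  by rewrite svD => /msuppD_le; rewrite mem_cat => /orP[/xA|/yA].
rewrite -[r *: x]/(r * x) svM => /msupp_mul[g /svP/(lc_mem lc) g0 [k /xA[i iA ki] ->]].
by exists i => //; rewrite (lcD lc) ltr_wpDl.
Qed.

(* The monomials outside [face_prime A] span the semigroup ring of a face, so
   the quotient embeds into a polynomial ring. *)
Lemma face_primeP A : prime_ideal (face_prime A).
Proof.
pose onface h := [forall i in A, c h i == 0].
have offE h : H h -> ~~ onface h -> exists2 i, i \in A & 0 < c h i.
  move=> /(lc_mem lc) h0; rewrite negb_forall => /existsP[i].
  by rewrite negb_imply => /andP[iA ci]; exists i; rewrite // lt_neqAle eq_sym ci h0.
have facePE r : face_prime A r <-> pfilter onface (sv r) = 0.
  split=> [rA|r0 h hr].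
    apply: pfilter_eq0 => h /rA[i iA hi]; rewrite negb_forall; apply/existsP; exists i.
    by rewrite negb_imply iA gt_eqF.
  apply: offE; first exact: svP hr.
  apply/negP => hf; have := mcoeff_pfilter onface (sv r) h.
  by move: hr; rewrite hf r0 mcoeff0 mcoeff_msupp => /eqP + /esym.
have onD g h : H g -> H h -> onface (g + h)%MM = onface g && onface h.
  move=> /(lc_mem lc) g0 /(lc_mem lc) h0; apply/forall_inP/andP => [gh|[/forall_inP gA /forall_inP hA] i iA].
    by split; apply/forall_inP => i iA; have := gh i iA; rewrite (lcD lc) paddr_eq0 // => /andP[].
  by rewrite (lcD lc) (eqP (gA i iA)) (eqP (hA i iA)) addr0.
split; first exact: face_prime_submodule.
  move/(_ 0%MM); rewrite sv1 msupp1 inE eqxx => /(_ isT)[i _].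
  by rewrite (lc0 lc) ltxx.
move=> x y; rewrite !facePE => xy.
have on_id r r' : pfilter onface (pfilter onface (sv r) * pfilter onface (sv r')) =
    pfilter onface (sv r) * pfilter onface (sv r').
  apply: pfilter_id => h /msupp_mul[g + [k + ->]].
  by rewrite !msupp_pfilter => /andP[fg /svP Hg] /andP[fk /svP Hk]; rewrite onD // fg.
have off0 r r' : pfilter onface (pfilter (predC onface) (sv r) * sv r') = 0.
  apply: pfilter_eq0 => h /msupp_mul[g + [k /svP Hk ->]].
  by rewrite msupp_pfilter => /andP[fg /svP Hg]; rewrite onD // negb_and (_ : ~~ onface g).
have onM r r' : pfilter onface (sv r * sv r') = pfilter onface (pfilter onface (sv r) * sv r').
  by rewrite {1}[sv r](pfilterC onface) mulrDl pfilterD off0 addr0.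
have [x' x'E] : exists x', sv x' = pfilter onface (sv x).
  by apply: sgring_of => h; rewrite msupp_pfilter => /andP[_ /svP].
have e : pfilter onface (sv x) * pfilter onface (sv y) = pfilter onface (sv (x * y)).
  by rewrite -on_id -x'E mulrC -onM svM [RHS]onM -x'E mulrC.
move/eqP: e; rewrite xy mulf_eq0 => /orP[]/eqP; [left|right]; exact.
Qed.

(** Some coordinate [l] of [h] lies below that of [b]. Every prime [face_prime A] with [l] in [A]
    contains the annihilator, and enlarging [A] one index at a time gives the chain. *)
Lemma support_chain_faces h : essential b c h -> support_chain E D.
Proof.
move=> eh; have [l hl] : exists l, c h l < c b l.
  have /andP[_] := eh; rewrite negb_forall => /existsP[l].
  by rewrite -ltNge; exists l.
have d0 : (0 < d)%N by rewrite dD.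
pose i0 : 'I_d := Ordinal d0.
(* The transposition puts [l] first, so that every [A j] contains it. *)
pose A j := finset (fun i => (tperm l i0 i <= j)%N).
exists (fun j => face_prime (A j)); split=> [j jD|j jD].
  split; first exact: face_primeP.
  move=> r rann g gr; exists l; first by rewrite inE tpermL.
  (* The coefficient of [x^(h + g)] in [r x^h] is the nonzero one of [x^g] in [r]. As [r] kills the
     class of [x^h], the exponent [h + g] is above [b], and [g] must raise coordinate [l]. *)
  have := congr1 (fun x : E => (nf x)@_(h + g)%MM) (rann (emon F K H b c h)).
  rewrite (nf0 K lc hb) mcoeff0 (nfZ lc hb) mcoeff_pfilter (nf_emon K lc hb) //.
  rewrite mcoeffMX; case: ifP => [_ /eqP|].
    by rewrite mcoeff_eq0 gr.
  move=> /negbFE/forallP/(_ l); rewrite (lcD lc) => le _; lia.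
split.
  move=> r rA g /rA[i iA gi]; exists i => //; move: iA; rewrite !inE => /leq_trans; exact.
have jd : (j.+1 < d)%N by rewrite dD ltnS.
pose i := tperm l i0 (Ordinal jd).
have Hi : H (a i) by exact: rayP lc i.
move=> /(_ (sgmon K H (a i))) sub.
have : face_prime (A j.+1) (sgmon K H (a i)).
  move=> g; rewrite sgmonE // msuppX inE => /eqP ->; exists i; first by rewrite inE tpermK.
  by rewrite (lc_ray lc) eqxx muln1 ltz_nat (lc_gt0 lc).
move/sub/(_ (a i)); rewrite sgmonE // msuppX inE eqxx => /(_ isT)[i' + i'0].
have /eqP -> : i' == i.
  by apply: contraLR i'0 => ii; rewrite (lc_ray lc) (negbTE ii) muln0.
by rewrite inE tpermK ltnn.
Qed.

Lemma krull_dim_quot h : essential b c h -> krull_dim E D.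
Proof. by move=> /support_chain_faces; split=> // k; exact: support_chain_le. Qed.

End Dimension.

(** * The regular sequence of ray differences *)

Section Pushforward.
Variables (K : fieldType) (d : nat) (kappa : 'X_{1..d} -> 'X_{1..d}).
Implicit Types (p q : {mpoly K[d]}) (g h k : 'X_{1..d}).

Definition push p : {mpoly K[d]} := \sum_(h <- msupp p) p@_h *: 'X_[kappa h].

Lemma push_widen p s : uniq s -> {subset msupp p <= s} ->
  push p = \sum_(h <- s) p@_h *: 'X_[kappa h].
Proof.
move=> us ps; rewrite (bigID (mem (msupp p))) /= [X in _ + X]big1 ?addr0.
  rewrite /push -[RHS]big_filter; apply: perm_big; apply: uniq_perm.
  - exact: msupp_uniq.
  - exact: filter_uniq.
  - by move=> h; rewrite mem_filter; case: (boolP (h \in msupp p)) => //= /ps.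
by move=> h /memN_msupp_eq0 ->; rewrite scale0r.
Qed.

Lemma pushD p q : push (p + q) = push p + push q.
Proof.
pose s := undup (msupp (p + q) ++ msupp p ++ msupp q).
have us : uniq s by exact: undup_uniq.
rewrite !(@push_widen _ s) // -?big_split; first last.
- by move=> h; rewrite mem_undup !mem_cat => ->.
- by move=> h; rewrite mem_undup !mem_cat => ->; rewrite orbT.
- by move=> h; rewrite mem_undup !mem_cat => ->; rewrite !orbT.
by apply: eq_bigr => h _; rewrite mcoeffD scalerDl.
Qed.

Lemma push0 : push 0 = 0.
Proof. by rewrite /push msupp0 big_nil. Qed.

Lemma pushN p : push (- p) = - push p.
Proof. by apply: (@addIr _ (push p)); rewrite -pushD !addNr push0. Qed.

Lemma pushB p q : push (p - q) = push p - push q.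
Proof. by rewrite pushD pushN. Qed.

Lemma pushX h : push 'X_[h] = 'X_[kappa h].
Proof. by rewrite /push msuppX big_seq1 mcoeffX eqxx scale1r. Qed.

Lemma msupp_push p k : k \in msupp (push p) -> exists2 h, h \in msupp p & k = kappa h.
Proof.
move/msupp_sum_le/flattenP => [l /mapP[h + ->]] /msuppZ_le.
by rewrite filter_predT msuppX inE => hp /eqP ->; exists h.
Qed.

Lemma push_mulX g g' p : (forall h, h \in msupp p -> kappa (g + h)%MM = (g' + kappa h)%MM) ->
  push ('X_[g] * p) = 'X_[g'] * push p.
Proof.
move=> gg'; rewrite (@push_widen _ [seq (g + h)%MM | h <- msupp p]).
- rewrite big_map mulr_sumr; apply: eq_big_seq => h hp.
  by rewrite -scalerAr -mpolyXD -gg' // mulrC mcoeffMX.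
- by rewrite map_inj_uniq ?msupp_uniq //; exact: addmI.
- move=> h /msupp_mul[g1 + [k kp ->]]; rewrite msuppX inE => /eqP ->.
  exact: map_f.
Qed.

End Pushforward.

(** * Identification of the first ray variables *)

Section Collapse.
Variables (F : realType) (K : fieldType) (D : nat) (H : affine_semigroup D.+1).
Variables (a : 'I_D.+1 -> 'X_{1..D.+1}) (b : 'X_{1..D.+1}).
Variables (N : nat) (c : 'X_{1..D.+1} -> 'I_D.+1 -> int).
Hypotheses (lc : lattice_coords F H a N c) (hb : omega F H (zvec b)).
Local Notation d := D.+1.
Local Notation R := (sgring K H).
Local Notation sv := (@sgring_val K d H).
Local Notation E := (canonical_quot K H F b).
Local Notation nf := (nf c).
Local Notation interior := (interior c).
Local Notation above := (above b c).
Local Notation pt := (@pt d a N c).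
Local Notation quo := (@quo d N c).
Local Notation res := (residue_of lc).
Local Notation thr := (@thr d b N c).
Implicit Types (p w : {mpoly K[d]}) (g h k q v : 'X_{1..d}) (m : nat) (i j l : 'I_d).

Lemma res_ray j h : interior h -> res (a j + h)%MM = res h.
Proof.
move=> hi; have rr := residue_realized lc hi.
by rewrite {1}(pt_split lc hi) -(pt_ray lc) (residue_pt lc).
Qed.

Lemma quo_ray j h : interior h -> quo (a j + h)%MM = (quo h + U_(j))%MM.
Proof.
move=> hi; have rr := residue_realized lc hi.
by rewrite {1}(pt_split lc hi) -(pt_ray lc) (quo_pt lc).
Qed.

Lemma ray_interior j h : interior h -> interior (a j + h)%MM.
Proof. by apply: (interiorD lc); exact: rayP lc j. Qed.

(* Modulo the differences [x^(a 0) - x^(a j)], [j <= m], the exponents along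
   [a 0, ..., a m] can be gathered on [a 0]. *)
Definition gather m q : 'X_{1..d} := [multinom
  if i == ord0 then (\sum_(j < d | j <= m) q j)%N else if (i <= m)%N then 0%N else q i | i < d].

Definition gather_ix m j : 'I_d := if (j <= m)%N then ord0 else j.

Lemma gatherE m q i : gather m q i =
  if i == ord0 then (\sum_(j < d | j <= m) q j)%N else if (i <= m)%N then 0%N else q i.
Proof. by rewrite mnmE. Qed.

Lemma gatherD m q v : gather m (q + v)%MM = (gather m q + gather m v)%MM.
Proof.
apply/mnmP => i; rewrite mnmDE !gatherE; case: eqP => _.
  by rewrite -big_split; apply: eq_bigr => j _; rewrite mnmDE.
by case: ifP; rewrite ?mnmDE.
Qed.

Lemma gatherU m j : gather m U_(j)%MM = U_(gather_ix m j)%MM.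
Proof.
apply/mnmP => i; rewrite gatherE [RHS]mnm1E /gather_ix; have [->|i0] := eqVneq i ord0.
  have [jm|jm] := leqP j m.
    rewrite eqxx (bigD1 j) //= mnm1E eqxx big1 // => k /andP[_ kj].
    by rewrite mnm1E eq_sym (negbTE kj).
  rewrite big1 => [|k km]; last by rewrite mnm1E; case: eqP km jm => // ->; lia.
  by case: eqP jm => // ->.
have [jm|jm] := leqP j m.
  rewrite eq_sym (negbTE i0); case: ifP => // im; rewrite mnm1E.
  by case: eqP => // ji; rewrite -ji jm in im.
by rewrite mnm1E; case: ifP => // im; case: eqP => // ji; rewrite -ji leqNgt jm in im.
Qed.

Lemma gather0 m : gather m 0%MM = 0%MM.
Proof.
apply/mnmP => i; rewrite gatherE mnm0E big1 => [|j _]; last by rewrite mnm0E.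
by case: ifP => //; case: ifP.
Qed.

Lemma gather_id m q : (forall i, i != ord0 -> (i <= m)%N -> q i = 0%N) -> gather m q = q.
Proof.
move=> q0; apply/mnmP => i; rewrite gatherE; have [->|i0] := eqVneq i ord0.
  rewrite (bigD1 ord0) //= big1 ?addn0 // => j /andP[jm j0]; exact: q0.
by case: ifP => // /(q0 _ i0).
Qed.

Lemma gather_eq0 m q : gather m q = 0%MM -> q = 0%MM.
Proof.
move=> /mnmP q0; apply/mnmP => i; have := q0 ord0; have := q0 i.
rewrite !gatherE !mnm0E; have [->|i0] := eqVneq i ord0.
  by rewrite (bigD1 ord0) //= => /eqP; rewrite addn_eq0 => /andP[/eqP].
case: (leqP i m) => // im _; rewrite (bigD1 i) //= => /eqP.
by rewrite addn_eq0 => /andP[/eqP].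
Qed.

Lemma gather_mid m q i : i != ord0 -> (i <= m)%N -> gather m q i = 0%N.
Proof. by move=> i0 im; rewrite gatherE (negbTE i0) im. Qed.

Lemma gather_idem m q : gather m (gather m q) = gather m q.
Proof. by apply: gather_id => i; exact: gather_mid. Qed.

Lemma gather_le m q v : (q <= v)%MM -> (gather m q <= gather m v)%MM.
Proof. by move=> qv; rewrite -(submK qv) gatherD; exact: lem_addl. Qed.

Lemma gather_full q : gather D q ord0 = mdeg q.
Proof.
rewrite gatherE eqxx mdegE; apply: eq_bigl => j; by rewrite -ltnS ltn_ord.
Qed.

(** The exponent that represents [x^h] after [y_0, ..., y_m] are identified; the residue is kept. *)
Definition collapse m h : 'X_{1..d} := pt (res h) (gather m (quo h)).
(** The identification turns [y^(v_rho)] into the monomial with exponent [gather m (thr rho)]; the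
    good exponents are those whose images are multiples of it. *)
Definition good m h : bool := (gather m (thr (res h)) <= gather m (quo h))%MM.

Lemma collapse_interior m h : interior h -> interior (collapse m h).
Proof. by move=> hi; apply: (pt_interior lc); exact: residue_realized. Qed.

Lemma res_collapse m h : interior h -> res (collapse m h) = res h.
Proof. by move=> hi; rewrite (residue_pt lc) //; exact: residue_realized. Qed.

Lemma quo_collapse m h : interior h -> quo (collapse m h) = gather m (quo h).
Proof. by move=> hi; rewrite (quo_pt lc) //; exact: residue_realized. Qed.

Lemma good_collapse m h : interior h -> good m (collapse m h) = good m h.
Proof. by move=> hi; rewrite /good res_collapse // quo_collapse // gather_idem. Qed.

Lemma collapse_ray m j h : interior h ->
  collapse m (a j + h)%MM = (a (gather_ix m j) + collapse m h)%MM.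
Proof.
by move=> hi; rewrite /collapse res_ray // quo_ray // gatherD gatherU (pt_ray lc).
Qed.

Lemma above_good m h : above h -> good m h.
Proof.
move=> ah; have hi := above_interior lc hb ah; have rr := residue_realized lc hi.
by apply: gather_le; rewrite -(above_pt lc hb) // -(pt_split lc hi).
Qed.

Lemma good_full h : good D h = (mdeg (thr (res h)) <= mdeg (quo h))%N.
Proof.
apply/mnm_lepP/idP => [/(_ ord0)|le i]; rewrite ?gather_full //.
have [->|i0] := eqVneq i ord0; first by rewrite !gather_full.
by rewrite !gather_mid // -ltnS.
Qed.

Definition isupp p : Prop := forall h, h \in msupp p -> interior h.
Definition asupp p : Prop := forall h, h \in msupp p -> above h.
Local Notation "'diff_ray' j" := ('X_[a ord0] - 'X_[a j] : {mpoly K[d]}) (at level 10, j at level 8).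

(** A test by coefficients for membership in the sum of [x^b R] and of the
    [(x^(a_0) - x^(a_j)) omega_R] with [j <= m]. Such elements pass it by [zsum_asupp] and
    [zsum_diff]; the converse is [zsum_complete]. *)
Definition zsum m p : Prop :=
  isupp p /\ forall k, interior k -> ~~ good m k -> (push (collapse m) p)@_k = 0.

Lemma asupp_isupp p : asupp p -> isupp p.
Proof. by move=> pa h /pa; exact: (above_interior lc hb). Qed.

Lemma isuppX j p : isupp p -> isupp ('X_[a j] * p).
Proof.
move=> pi h /msupp_mul[g + [k /pi ki ->]]; rewrite msuppX inE => /eqP ->.
exact: ray_interior.
Qed.

Lemma isuppD p w : isupp p -> isupp w -> isupp (p + w).
Proof. by move=> pi wi h /msuppD_le; rewrite mem_cat => /orP[/pi|/wi]. Qed.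

Lemma isuppN p : isupp p -> isupp (- p).
Proof. by move=> pi h; rewrite (perm_mem (msuppN p)); exact: pi. Qed.

Lemma isupp_diff j p : isupp p -> isupp (diff_ray j * p).
Proof.
by move=> pi; rewrite mulrBl; apply: isuppD; [|apply: isuppN]; exact: isuppX.
Qed.

Lemma zsumD m p w : zsum m p -> zsum m w -> zsum m (p + w).
Proof.
move=> [pi p0] [wi w0]; split; first exact: isuppD.
by move=> k ki kg; rewrite pushD mcoeffD p0 // w0 // addr0.
Qed.

Lemma zsumN m p : zsum m p -> zsum m (- p).
Proof.
move=> [pi p0]; split; first exact: isuppN.
by move=> k ki kg; rewrite pushN mcoeffN p0 // oppr0.
Qed.

Lemma zsum0 m : zsum m 0.
Proof. by split=> [h|k _ _]; rewrite ?msupp0 // push0 mcoeff0. Qed.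

Lemma zsum_good m p : isupp p -> (forall h, h \in msupp p -> good m h) -> zsum m p.
Proof.
move=> pi pg; split=> // k ki kg; apply/eqP; rewrite mcoeff_eq0; apply/negP.
move/msupp_push => [h hp kh]; move: kg; rewrite kh good_collapse ?pg //; exact: pi.
Qed.

Lemma zsum_asupp m p : asupp p -> zsum m p.
Proof.
move=> pa; apply: zsum_good; first exact: asupp_isupp.
by move=> h /pa; exact: above_good.
Qed.

Lemma push_ray m j p : isupp p ->
  push (collapse m) ('X_[a j] * p) = 'X_[a (gather_ix m j)] * push (collapse m) p.
Proof. by move=> pi; apply: push_mulX => h /pi; exact: collapse_ray. Qed.

Lemma zsum_diff m j p : (j <= m)%N -> isupp p -> zsum m (diff_ray j * p).
Proof.
move=> jm pi; split; first exact: isupp_diff.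
move=> k _ _; rewrite mulrBl pushB !push_ray //.
by rewrite /gather_ix jm leq0n subrr mcoeff0.
Qed.

Lemma zsumX_good m h : interior h -> zsum m 'X_[h] -> good m h.
Proof.
move=> hi [_ /(_ (collapse m h) (collapse_interior m hi))].
rewrite good_collapse // pushX mcoeffX eqxx => h0; apply: contraT => /h0/eqP.
by rewrite oner_eq0.
Qed.

Lemma zsum_above_part m p : zsum m p -> zsum m (pfilter (predC above) p).
Proof.
move=> pz; have -> : pfilter (predC above) p = p - pfilter above p.
  by rewrite {2}[p](pfilterC above) addrC addKr.
apply: zsumD => //; apply: zsumN; apply: zsum_asupp => h.
by rewrite msupp_pfilter => /andP[].
Qed.

Section Completeness.
Variables (m : nat) (S : {mpoly K[d]} -> Prop).
Hypothesis SD : forall p w, S p -> S w -> S (p + w).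
Hypothesis Sabove : forall p, asupp p -> S p.
Hypothesis Sdiff : forall j p, (j <= m)%N -> isupp p -> S (diff_ray j * p).

Let S_X t h : above h -> S (t *: 'X_[h]).
Proof.
move=> ah; apply: Sabove => k /msuppZ_le; rewrite msuppX inE => /eqP ->.
exact: ah.
Qed.

(** A multiple of [x^(a_0) - x^(a_j)] with [0 < j <= m] moves one unit of the exponent from [y_j] to
    [y_0]; the induction is on the units still to be moved. *)
Let S_gather t rho q : realized c rho ->
  S (t *: ('X_[pt rho q] - 'X_[pt rho (gather m q)])).
Proof.
move=> rr; have [n] := ubnP (\sum_(i < d | (i != ord0) && (i <= m)%N) q i)%N.
elim: n q => // n IH q; rewrite ltnS => qn.
have [|no] := pselect (exists j, [/\ j != ord0, (j <= m)%N & q j != 0%N]); last first.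
  have -> : gather m q = q.
    apply: gather_id => i i0 im; apply/eqP; apply: contrapT => /negP qi.
    by apply: no; exists i.
  by rewrite subrr scaler0; apply: Sabove => h; rewrite msupp0.
move=> [j [j0 jm qj]]; pose q' := (q - U_(j))%MM.
have qE : q = (q' + U_(j))%MM by rewrite submK // lep1mP.
have gE : gather m (q' + U_(ord0))%MM = gather m q.
  by rewrite [in RHS]qE !gatherD !gatherU /gather_ix jm.
have := IH (q' + U_(ord0))%MM; rewrite gE => IH'.
have -> : t *: ('X_[pt rho q] - 'X_[pt rho (gather m q)]) =
    diff_ray j * (- t *: 'X_[pt rho q']) +
    t *: ('X_[pt rho (q' + U_(ord0))%MM] - 'X_[pt rho (gather m q)]) :> {mpoly K[d]}.
  rewrite {1}qE !(pt_ray lc) !mpolyXD -scalerAr scaleNr -scalerN -scalerDr.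
  by congr (_ *: _); rewrite mulrBl; ring.
apply: SD; last first.
  apply: IH'; apply: leq_trans qn; rewrite (bigD1 j) ?j0 //= [ltnRHS](bigD1 j) ?j0 //=.
  have -> : q j = (q' j).+1 by rewrite {1}qE mnmDE mnm1E eqxx addn1.
  rewrite mnmDE mnm1E eq_sym (negbTE j0) addn0 addSn ltnS leq_add2l.
  apply: leq_sum => i /andP[/andP[i0 _] ij].
  by rewrite [leqRHS](_ : q i = q' i) ?mnmDE ?mnm1E 1?eq_sym ?(negbTE i0) ?addn0 // {1}qE mnmDE mnm1E eq_sym (negbTE ij) addn0.
apply: Sdiff => // h /msuppZ_le; rewrite msuppX inE => /eqP ->.
exact: (pt_interior lc).
Qed.

Let S_collapse t h : interior h -> S (t *: ('X_[h] - 'X_[collapse m h])).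
Proof.
move=> hi; rewrite {1}(pt_split lc hi); apply: S_gather; exact: residue_realized.
Qed.

Let S_good t h : interior h -> good m h -> S (t *: 'X_[collapse m h]).
Proof.
move=> hi hg; have rr := residue_realized lc hi.
(* This [q] dominates the threshold and gathers to the same vector as [quo h], so a point of [b + H]
   has the same collapse as [h]. *)
pose v := thr (res h); pose q := (v + (gather m (quo h) - gather m v))%MM.
have gq : gather m q = gather m (quo h).
  rewrite gatherD [gather m (_ - _)%MM]gather_id ?[(gather m v + _)%MM]addmC ?submK //.
  by move=> i i0 im; rewrite mnmBE !gather_mid.
have := S_gather (- t) q rr; rewrite gq => Sq.
have -> : t *: 'X_[collapse m h] = t *: 'X_[pt (res h) q] +
    - t *: ('X_[pt (res h) q] - 'X_[collapse m h]) :> {mpoly K[d]}.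
  by rewrite scaleNr -scalerN -scalerDr opprB addrC subrK.
apply: SD => //; apply: S_X; rewrite (above_pt lc hb) //.
exact: lem_addr.
Qed.

(** Replacing each monomial by its collapse costs an element of [S]. Collapsed monomials that are
    not good cancel by hypothesis, and the good ones are in [S]. The predicate is abstract so as to
    serve for submodules of [E] and for ideals of [R]. *)
Lemma zsum_complete p : zsum m p -> S p.
Proof.
move=> [pi p0].
have S_sum (I : eqType) (s : seq I) (f : I -> {mpoly K[d]}) :
    (forall x, x \in s -> S (f x)) -> S (\sum_(x <- s) f x).
  move=> sf; rewrite big_seq; apply: big_ind => //.
  by apply: Sabove => h; rewrite msupp0.
have -> : p = \sum_(h <- msupp p) (p@_h *: ('X_[h] - 'X_[collapse m h]) +
    (if good m h then p@_h *: 'X_[collapse m h] else 0)).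
  have bad0 : \sum_(h <- msupp p) (if good m h then 0 else p@_h *: 'X_[collapse m h]) = 0
      :> {mpoly K[d]}.
    apply/mpolyP => k; rewrite mcoeff0.
    have [ki|nki] := boolP (interior k && ~~ good m k).
      have /andP[ki' kg] := ki; rewrite -[RHS](p0 k ki' kg) /push !raddf_sum /=.
      apply: eq_big_seq => h /pi hi; rewrite !mcoeffZ; case: ifP => hg.
        rewrite mcoeff0 mcoeffX; case: eqP => [e|_]; last by rewrite mulr0.
        by rewrite -e good_collapse // hg in kg.
      by rewrite mcoeffZ.
    rewrite raddf_sum big_seq big1 // => h /pi hi /=; case: ifP => hg; first by rewrite mcoeff0.
    rewrite mcoeffZ mcoeffX; case: eqP => [e|_]; last by rewrite mulr0.
    by rewrite -e collapse_interior // good_collapse // hg in nki.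
  rewrite {1}[p]mpolyE -[LHS]subr0 -[X in _ - X]bad0 -sumrB; apply: eq_bigr => h _.
  by rewrite scalerBr; case: ifP => _; rewrite ?subr0 ?addr0 ?subrK.
apply: S_sum => h /pi hi; apply: SD; first exact: S_collapse.
by case: ifP => hg; [exact: S_good|apply: Sabove => k; rewrite msupp0].
Qed.

End Completeness.

End Collapse.

Section RegularSequence.
Variables (F : realType) (K : fieldType) (D : nat) (H : affine_semigroup D.+1).
Variables (a : 'I_D.+1 -> 'X_{1..D.+1}) (b : 'X_{1..D.+1}).
Variables (N : nat) (c : 'X_{1..D.+1} -> 'I_D.+1 -> int).
Hypotheses (lc : lattice_coords F H a N c) (hb : omega F H (zvec b)).
Local Notation d := D.+1.
Local Notation R := (sgring K H).
Local Notation sv := (@sgring_val K d H).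
Local Notation E := (canonical_quot K H F b).
Local Notation nf := (nf c).
Local Notation interior := (interior c).
Local Notation above := (above b c).
Local Notation pt := (@pt d a N c).
Local Notation quo := (@quo d N c).
Local Notation res := (residue_of lc).
Local Notation thr := (@thr d b N c).
Local Notation isupp := (@isupp K D c).
Local Notation asupp := (@asupp K D b c).
Local Notation zsum := (zsum b lc).
Local Notation good := (good b lc).
Implicit Types (p w : {mpoly K[d]}) (g h k q v : 'X_{1..d}) (m : nat) (i j l : 'I_d).

(* A monomial of [p] below the threshold with maximal exponent along [a i]
   survives in the product, as the only monomial which could cancel it would
   have a larger exponent along [a i]. *)
Lemma ray_difference_regular (i j l : 'I_d) (tau : {ffun 'I_d -> 'I_N} -> nat) p :
    i != j -> l != i -> isupp p ->
    (forall k, k \in msupp p -> (quo k l < tau (res k))%N ->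
       (p * ('X_[a i] - 'X_[a j]))@_(a i + k)%MM = 0) ->
  forall k, k \in msupp p -> (tau (res k) <= quo k l)%N.
Proof.
move=> ij li pi p0 k kp; rewrite leqNgt; apply/negP => kl.
have step k1 : k1 \in msupp p -> (quo k1 l < tau (res k1))%N ->
    exists k2, [/\ k2 \in msupp p, (quo k2 l < tau (res k2))%N & quo k2 i = (quo k1 i).+1].
  move=> k1p k1l; have := p0 _ k1p k1l; rewrite mulrBr mcoeffB.
  rewrite mcoeffMX => /eqP; rewrite subr_eq0 => /eqP e.
  have : (a i + k1)%MM \in msupp (p * 'X_[a j]) by rewrite mcoeff_msupp -e -mcoeff_msupp.
  move=> /msupp_mul[k2 k2p [g]]; rewrite msuppX inE => /eqP -> {g} e2.
  have e3 : (a i + k1 = a j + k2)%MM by rewrite e2 addmC.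
  have [k1i k2i] := (pi _ k1p, pi _ k2p).
  have re : res k1 = res k2 by rewrite -(res_ray lc i k1i) e3 (res_ray lc).
  have qe x : (quo k1 x + (i == x) = quo k2 x + (j == x))%N.
    have /mnmP/(_ x) : quo (a i + k1)%MM = quo (a j + k2)%MM by rewrite e3.
    by rewrite !(quo_ray lc) // !mnmDE !mnm1E.
  exists k2; split=> //.
    by rewrite -re; apply: leq_ltn_trans k1l; have := qe l; rewrite [i == l]eq_sym (negbTE li); lia.
  by have := qe i; rewrite eqxx [j == i]eq_sym (negbTE ij); lia.
have big n : exists k1, [/\ k1 \in msupp p, (quo k1 l < tau (res k1))%N & (n <= quo k1 i)%N].
  elim: n => [|n [k1 [k1p k1l nk1]]]; first by exists k.
  by have [k2 [? ? e]] := step _ k1p k1l; exists k2; rewrite e.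
have [k1 [k1p _]] := big (\sum_(h <- msupp p) quo h i).+1%N.
by rewrite (big_rem k1) //= ltnNge leq_addr.
Qed.

Local Notation diff_ray j := ('X_[a ord0] - 'X_[a j] : {mpoly K[d]}).

(** As [m < j], the rays [0] and [j] are not identified, and the collapsed product is the collapse
    of [p] times the same difference. The threshold is then checked one coordinate at a time. *)
Lemma zsum_cancel m j p : (m < j)%N -> isupp p -> zsum m (diff_ray j * p) -> zsum m p.
Proof.
move=> mj pi [_ z0]; apply: contrapT => nz.
have j0 : j != ord0 by apply: contraL mj => /eqP ->.
pose P := push (collapse lc m) p.
have PE : push (collapse lc m) (diff_ray j * p) = P * diff_ray j.
  have gj : gather_ix m j = j by rewrite /gather_ix leqNgt mj.
  have g0 : gather_ix m (ord0 : 'I_d) = ord0 by [].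
  by rewrite mulrBl pushB !(push_ray lc) // gj g0 -mulrBl mulrC.
have Psupp k : k \in msupp P -> exists2 h, interior h & k = collapse lc m h.
  by move=> /msupp_push[h /pi hi ->]; exists h.
have Pi : isupp P by move=> k /Psupp[h hi ->]; exact: collapse_interior.
have Pq k : k \in msupp P -> gather m (quo k) = quo k.
  by move=> /Psupp[h hi ->]; rewrite (quo_collapse lc) // gather_idem.
pose tau l (rho : {ffun 'I_d -> 'I_N}) := gather m (thr rho) l.
have bad i l k : (m < i)%N || (i == ord0) -> l != i -> k \in msupp P ->
    (quo k l < tau l (res k))%N -> (P * diff_ray j)@_(a i + k)%MM = 0.
  move=> ii li kP kl; have ki := Pi _ kP; rewrite -PE; apply: z0.
    exact: (ray_interior lc).
  rewrite /good (res_ray lc) // (quo_ray lc) // gatherD Pq // gatherU.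
  have -> : gather_ix m i = i.
    by rewrite /gather_ix; case: leqP ii => //= im /eqP ->.
  apply/negP => /mnm_lepP/(_ l); rewrite mnmDE mnm1E eq_sym (negbTE li) addn0.
  by rewrite leqNgt -[X in (_ < X)%N]/(tau l (res k)) kl.
(* The growing exponent in [ray_difference_regular] has to belong to another ray than the tested
   coordinate [l], so the two rays swap roles when [l] is 0. *)
have tauP l k : k \in msupp P -> (tau l (res k) <= quo k l)%N.
  have [->|l0] := eqVneq l ord0; last first.
    apply: (ray_difference_regular (i := ord0) (j := j)) => //; first by rewrite eq_sym.
    by move=> k1 k1P k1l; apply: (bad _ l) => //; rewrite eqxx orbT.
  apply: (ray_difference_regular (i := j) (j := ord0)) => //; first by rewrite eq_sym.
  move=> k1 k1P k1l; rewrite -[_ - _]opprB mulrN mcoeffN (bad j ord0) ?oppr0 ?mj //.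
  by rewrite eq_sym.
apply: nz; split=> // k ki kg; apply/eqP; rewrite mcoeff_eq0; apply/negP => kP.
move/negP: kg; apply; apply/mnm_lepP => l; rewrite (Pq _ kP); exact: tauP.
Qed.

Definition ray_diff j : R := sgmon K H (a ord0) - sgmon K H (a j).

Lemma sv_ray_diff j : sv (ray_diff j) = diff_ray j.
Proof. by rewrite svB !sgmonE //; exact: rayP lc _. Qed.

Definition ray_diffs : seq R := [seq ray_diff (inord n.+1) | n <- iota 0 D].

Lemma nth_ray_diffs (n : nat) : (n < D)%N -> ray_diffs`_n = ray_diff (inord n.+1).
Proof. by move=> nD; rewrite (nth_map 0%N) ?size_iota // nth_iota. Qed.

Lemma take_ray_diffs m (r : R) : (m <= D)%N ->
  r \in take m ray_diffs <-> exists j, [/\ j != ord0, (j <= m)%N & r = ray_diff j].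
Proof.
move=> mD; rewrite -map_take take_iota (minn_idPl mD); split.
  move=> /mapP[i]; rewrite mem_iota /= add0n => im ->; exists (inord i.+1).
  have ei : (inord i.+1 : 'I_d) = i.+1 :> nat by rewrite inordK // ltnS (leq_trans im).
  by split=> //; rewrite ?ei // -(inj_eq val_inj) /= ei.
move=> [[j jd] [j0 jm ->]]; apply/mapP; exists j.-1.
  by rewrite mem_iota /=; move: j0 jm; rewrite -(inj_eq val_inj) /=; lia.
congr ray_diff; apply: val_inj; rewrite /= inordK.
  by rewrite prednK // lt0n; move: j0; rewrite -(inj_eq val_inj).
by rewrite prednK // lt0n; move: j0; rewrite -(inj_eq val_inj).
Qed.

Definition ray_submodule m : set E := prod_set [set r | r \in take m ray_diffs] [set: E].

Lemma nf_isupp (x : E) : isupp (nf x).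
Proof. by move=> h /(nfP lc hb); exact: essential_interior. Qed.

Lemma ray_submoduleP m (x : E) : (m <= D)%N -> ray_submodule m x <-> zsum m (nf x).
Proof.
move=> mD; have sub := span_submodule [set r *: y | r in [set r | r \in take m ray_diffs] & y in [set: E]].
split=> [[l lP ->]|xz].
  rewrite (nf_sum lc hb) big_seq; apply: big_ind; [exact: zsum0|by move=> *; exact: zsumD|].
  move=> u /lP[_ /(take_ray_diffs _ mD)[j [_ jm ->]] [y _ <-]].
  rewrite scalerA mulrC -scalerA (nfZ lc hb); apply: zsum_above_part => //.
  by rewrite sv_ray_diff; apply: zsum_diff => //; exact: nf_isupp.
suff [y yN e] : exists2 y, ray_submodule m y & nf y = pfilter (predC above) (nf x).
  have -> : x = y.
    by apply: (nf_inj lc hb); rewrite e pfilter_id // => h /(nfP lc hb)/andP[].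
  exact: yN.
(* Polynomials supported in [omega_H] whose class in [E] lies in the submodule, stated through
   normal forms. *)
pose S p := exists2 y, ray_submodule m y & nf y = pfilter (predC above) p.
apply: (@zsum_complete _ _ _ _ _ _ _ _ lc hb m S _ _ _ _ xz).
- move=> p w [y yN ey] [z zN ez]; exists (y + z); last by rewrite (nfD lc hb) ey ez pfilterD.
  by have [_ sD _] := sub; exact: sD.
- move=> p pa; exists 0; first by have [] := sub.
  by rewrite (nf0 K lc hb) pfilter_eq0 // => h /pa ha; rewrite negbK.
- move=> j p jm pi; have [->|j0] := eqVneq j ord0.
    exists 0; first by have [] := sub.
    by rewrite subrr mul0r (nf0 K lc hb) pfilter_eq0 // => h; rewrite msupp0.
  have [|y ey] := @nf_surj F K d H a b N c lc hb (pfilter (predC above) p).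
    by move=> h; rewrite msupp_pfilter => /andP[nh /pi hi]; exact/andP.
  exists (ray_diff j *: y).
    apply: mem_span; exists (ray_diff j); last by exists y.
    by apply/(take_ray_diffs _ mD); exists j.
  by rewrite (nfZ lc hb) ey (pfilter_above_mul b lc) sv_ray_diff.
Qed.

(** The base point of the residue of [h] has [q = 0], so no identification changes it. It is good
    only if the threshold is zero, which the existence of [h] excludes. *)
Lemma ray_submodule_neqT m h : (m <= D)%N -> essential b c h -> ray_submodule m <> [set: E].
Proof.
move=> mD /andP[hi nh] eT; have rr := residue_realized lc hi.
pose k := pt (res h) 0%MM.
have ki : interior k by exact: (pt_interior lc).
have nk : ~~ above k.
  apply: contra nh; rewrite {1}(pt_split lc hi) !(above_pt lc hb) // => /mnm_lepP le0.
  by apply/mnm_lepP => i; have := le0 i; rewrite mnm0E leqn0 => /eqP ->.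
have ek : essential b c k by exact/andP.
have : ray_submodule m (emon F K H b c k) by rewrite eT.
move/(ray_submoduleP _ mD); rewrite (nf_emon K lc hb) // => /(zsumX_good ki).
rewrite /good (residue_pt lc) // (quo_pt lc) // gather0 => /mnm_lepP le0.
have t0 : thr (res h) = 0%MM.
  apply: (@gather_eq0 D m); apply/mnmP => i.
  by have := le0 i; rewrite mnm0E leqn0 => /eqP.
by move/negP: nk; apply; rewrite (above_pt lc hb) // t0; apply/mnm_lepP => i; rewrite mnm0E.
Qed.

Lemma ray_diffs_regular h : essential b c h -> regular_sequence E ray_diffs.
Proof.
have sz : size ray_diffs = D by rewrite size_map size_iota.
move=> eh; split=> [i x|]; last first.
  rewrite -[ray_diffs in [set r | r \in ray_diffs]]take_size sz.
  exact: (ray_submodule_neqT (leqnn D) eh).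
rewrite sz => iD /=; have iD' := ltnW iD.
move=> /(ray_submoduleP _ iD') xz; apply/(ray_submoduleP _ iD').
have xi := @nf_isupp x; pose j : 'I_d := inord i.+1.
have ej : j = i.+1 :> nat by rewrite inordK.
apply: (@zsum_cancel i j); rewrite ?ej //.
have {}xz : zsum i (nf (ray_diff j *: x)) by rewrite -(nth_ray_diffs iD).
move: xz; rewrite (nfZ lc hb) sv_ray_diff => xz.
rewrite [_ * nf x](pfilterC above); apply: zsumD => //.
by apply: zsum_asupp => // g; rewrite msupp_pfilter => /andP[].
Qed.

Lemma ray_diffs_max_ideal r : r \in ray_diffs -> max_ideal K H r.
Proof.
move=> /mapP[j _ ->]; apply: (submoduleB (@max_ideal_submodule K d H));
  by apply: max_ideal_sgmon; [exact: rayP lc _|exact: (ray_neq0 lc)].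
Qed.

Local Notation W := (canonical_ideal K H F : set R^o).
Local Notation J := (ideal_gen [set r | exists i j : 'I_d,
                 r = (sgmon K H (a i) - sgmon K H (a j))%R] : set R).

Lemma canonical_idealP (r : R) : canonical_ideal K H F r <-> isupp (sv r).
Proof.
by split=> ri h /ri hi; exact/(interiorP lc).
Qed.

Lemma canonical_idealM (r s : R) : canonical_ideal K H F s -> canonical_ideal K H F (r * s).
Proof.
move=> /canonical_idealP si; apply/canonical_idealP => h; rewrite svM.
by move=> /msupp_mul[g /svP Hg [k /si ki ->]]; exact: (interiorD lc).
Qed.

Lemma prod_set_max_ideal (y : R) : prod_set (max_ideal K H) W y ->
  forall h, h \in msupp (sv y) -> inpow H c 1 h.
Proof.
pose M : set R^o := [set y | forall h, h \in msupp (sv y) -> inpow H c 1 h].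
have Ms : submodule M.
  split=> [h|x z xM zM h|r x xM h]; first by rewrite sv0 msupp0.
    by rewrite svD => /msuppD_le; rewrite mem_cat => /orP[/xM|/zM].
  rewrite -[r *: x]/(r * x) svM => /msupp_mul[g /svP Hg [k /xM kM ->]].
  exact: (inpow_upclosed lc Hg (inpow_interior lc kM) kM).
suff : prod_set (max_ideal K H) W `<=` M by apply.
apply: span_sub => // _ [r /max_idealP r0 [x /canonical_idealP xi <-]] h.
rewrite -[r *: x]/(r * x) svM => /msupp_mul[g gr [k /xi ki ->]].
exists g, k; split=> //; first exact: svP gr.
by apply/eqP => g0; move: gr; rewrite g0 mcoeff_msupp r0 eqxx.
Qed.

Lemma zsum_prod_set (y : R) : prod_set J W y -> zsum D (sv y).
Proof.
have le i : (i <= D)%N by rewrite -ltnS.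
pose T : set R^o := [set r | forall x, isupp (sv x) -> zsum D (sv (r * x))].
have Ts : submodule T.
  split=> [x _|r s rT sT x xi|r s sT x xi].
  - by rewrite mul0r sv0; exact: zsum0.
  - by rewrite mulrDl svD; apply: zsumD; [exact: rT|exact: sT].
  - rewrite -[r *: s]/(r * s) -mulrA mulrCA; apply: sT.
    by apply/canonical_idealP; apply: canonical_idealM; exact/canonical_idealP.
have JT : J `<=` T.
  apply: (span_sub Ts) => _ [i [j ->]] x xi.
  have -> : sgmon K H (a i) - sgmon K H (a j) = ray_diff j - ray_diff i.
    by rewrite /ray_diff opprB [RHS]addrC addrA subrK.
  rewrite mulrBl svB !svM !sv_ray_diff; apply: zsumD; last apply: zsumN;
    by apply: zsum_diff.
move=> [l lP ->]; rewrite sv_sum big_seq; apply: big_ind; [exact: zsum0|by move=> *; exact: zsumD|].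
move=> u /lP[r /JT rT [x /canonical_idealP xi <-]].
rewrite -[_ *: _]/(u.1 * (r * x)) mulrCA; apply: rT.
by apply/canonical_idealP; apply: canonical_idealM; exact/canonical_idealP.
Qed.

(** For [m = D] all [y_i] are identified and [good D] compares total degrees. As [m omega_R] is
    spanned by monomials, the inclusion can be tested on them. *)
Lemma inclusion_thr :
  prod_set (max_ideal K H) W
    `<=` sum_set (ideal_gen [set sgmon K H b] : set R^o) (prod_set J W) <->
  forall h, inpow H c 1 h -> (mdeg (thr (res h)) <= mdeg (quo h))%N.
Proof.
split=> [sub h h1|le y /prod_set_max_ideal y1].
  have hi := inpow_interior lc h1; have Hh := interior_mem lc hi.
  rewrite -(good_full b lc); apply: (@zsumX_good F K) => //.
  have : prod_set (max_ideal K H) W (sgmon K H h).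
    have [g [k [Hg g0 ki ->]]] := h1; have Hk := interior_mem lc ki.
    rewrite sgmonD //; apply: mem_span; exists (sgmon K H g); first exact: max_ideal_sgmon.
    exists (sgmon K H k) => //; apply/canonical_idealP => k'.
    by rewrite sgmonE // msuppX inE => /eqP ->.
  move=> /sub[x /ideal_gen1/(multiple_baseP lc hb) xa [z /zsum_prod_set zz e]].
  rewrite -(sgmonE K Hh) -e svD; apply: zsumD => //; exact: zsum_asupp.
have yz : zsum D (sv y).
  have yi : isupp (sv y) by move=> h /y1 h1; exact: (inpow_interior lc h1).
  apply: zsum_good => // h /y1 h1.
  by rewrite good_full; exact: le.
pose G : set R^o := sum_set (ideal_gen [set sgmon K H b] : set R^o) (prod_set J W).
have Gs : submodule G by apply: sum_set_submodule; exact: span_submodule.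
pose S p := exists2 z : R, sv z = p & G z.
suff [z /sv_inj <-] : S (sv y) by [].
apply: (@zsum_complete _ _ _ _ _ _ _ _ lc hb D S _ _ _ _ yz).
- move=> p w [x <- xG] [z <- zG]; exists (x + z); first by rewrite svD.
  by have [_ sD _] := Gs; exact: sD.
- move=> p pa; have [|x xp] := @sgring_of K d H p.
    by move=> h /pa/(above_interior lc hb)/(interior_mem lc).
  exists x => //; exists x; first by apply/ideal_gen1/(multiple_baseP lc hb); rewrite xp.
  by exists 0; [have [] := span_submodule [set r *: x | r in J & x in W]|rewrite addr0].
- move=> j p _ pi; have [|x xp] := @sgring_of K d H p.
    by move=> h /pi/(interior_mem lc).
  exists (ray_diff j * x); first by rewrite svM sv_ray_diff xp.
  exists 0; first by have [] := span_submodule ([set sgmon K H b] : set R^o).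
  exists (ray_diff j * x); last by rewrite add0r.
  apply: mem_span; exists (ray_diff j); first by apply: mem_span; exists ord0, j.
  by exists x => //; apply/canonical_idealP; rewrite xp.
Qed.

End RegularSequence.

(** * Multiplicity and the Ulrich property *)

Section Limits.
Implicit Types (f : nat -> rat) (e : nat).

Definition tends_to f (x : rat) : Prop := forall eps : rat, 0 < eps ->
  exists N : nat, forall n, (N <= n)%N -> `|f n - x| < eps.

Lemma growth_limit (f : nat -> nat) e A n0 D :
    (forall n, (n0 <= n)%N -> (e * n ^ D.+1 <= f n + A * n ^ D)%N /\
       (f n <= e * n ^ D.+1 + A * n ^ D)%N) ->
  tends_to (fun n => (f n)%:R / (n ^ D.+1)%:R) e%:R.
Proof.
(* Beyond [M] one has [A < eps * n], so the error [A * n^D] is less than [eps * n^D.+1]. *)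
move=> fP eps eps0; pose M := Num.bound (A%:R / eps); exists (n0 + M).+1 => n nN.
have n_gt0 : (0 < n)%N by exact: leq_trans nN.
have [lo hi] : (e * n ^ D.+1 <= f n + A * n ^ D)%N /\ (f n <= e * n ^ D.+1 + A * n ^ D)%N.
  by apply: fP; lia.
have p0 : 0 < (n ^ D.+1)%:R :> rat by rewrite ltr0n expn_gt0 n_gt0.
have -> : (f n)%:R / (n ^ D.+1)%:R - e%:R = ((f n)%:R - (e * n ^ D.+1)%:R) / (n ^ D.+1)%:R :> rat.
  by rewrite mulrBl natrM mulfK ?gt_eqF.
rewrite normrM [X in _ * X]ger0_norm ?invr_ge0 ?ltW // ltr_pdivrMr //.
apply: (@le_lt_trans _ _ (A * n ^ D)%:R).
  move: lo hi; rewrite -!(ler_nat rat) !natrD => lo hi; rewrite ler_norml.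
  by apply/andP; split; lra.
have -> : eps * (n ^ D.+1)%:R = n%:R * eps * (n ^ D)%:R.
  by rewrite expnS natrM mulrA [eps * _]mulrC.
rewrite natrM ltr_pM2r ?ltr0n ?expn_gt0 ?n_gt0 // -ltr_pdivrMr //; apply: lt_trans (archi_boundP _) _; first by rewrite divr_ge0 // ltW.
by rewrite ltr_nat -/M; lia.
Qed.

Lemma tends_to_nat_unique f e e' : tends_to f e%:R -> tends_to f e'%:R -> e = e'.
Proof.
move=> fe fe'; have h0 : 0 < 1 / 2%:R :> rat by [].
have [n1 H1] := fe _ h0; have [n2 H2] := fe' _ h0.
have := H1 _ (leq_addr n2 n1); have := H2 _ (leq_addl n1 n2).
set x := f _; rewrite !ltr_norml => /andP[a1 a2] /andP[b1 b2].
by apply/eqP; rewrite eqn_leq; apply/andP; split; rewrite -ltnS -(ltr_nat rat) -natr1; lra.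
Qed.

End Limits.

Section Ulrich.
Variables (F : realType) (K : fieldType) (D : nat) (H : affine_semigroup D.+2).
Variables (a : 'I_D.+2 -> 'X_{1..D.+2}) (b : 'X_{1..D.+2}).
Variables (N : nat) (c : 'X_{1..D.+2} -> 'I_D.+2 -> int).
Hypotheses (lc : lattice_coords F H a N c) (hb : omega F H (zvec b)).
Local Notation E := (canonical_quot K H F b).
Local Notation m := (max_ideal K H).
Local Notation std n := (standard H a b N c n).
Local Notation mult := (mult b N c).

Lemma trivial_quot : (forall x : E, x = 0) <-> forall h, ~~ essential b c h.
Proof.
split=> [x0 h|ne x].
  apply/negP => eh; have := nf_emon K lc hb eh; rewrite (x0 (emon F K H b c h)) (nf0 K lc hb).
  by move/(congr1 (mcoeff h))/eqP; rewrite mcoeff0 mcoeffX eqxx eq_sym oner_eq0.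
apply: (nf_eq0 lc hb); apply/mpolyP => h; rewrite mcoeff0; apply/eqP.
by rewrite mcoeff_eq0; apply/negP => /(nfP lc hb) eh; have := ne h; rewrite eh.
Qed.

(** The case [E = 0], which is Ulrich by convention: all thresholds vanish, so the numerical
    criterion holds as well. *)
Lemma standard_mult_trivial : (forall h, ~~ essential b c h) -> size (std 1) = mult.
Proof.
move=> ne; apply/(standard1_mult lc hb) => // h h1.
have hi := inpow_interior lc h1; have rr := residue_realized lc hi.
have := ne (pt a c (residue_of lc h) 0%MM); rewrite negb_and (pt_interior lc) //= negbK.
rewrite (above_pt lc hb) // => /mnm_lepP t0; rewrite mdegE big1 // => i _.
by have := t0 i; rewrite mnm0E leqn0 => /eqP.
Qed.

Lemma depth_quot h : essential b c h -> depth E m D.+1.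
Proof.
move=> eh; split; last by move=> s _; exact: (regular_sequence_le lc hb (erefl D.+2)).
exists (ray_diffs K H a); split.
- by move=> r rs; apply/asboolP; exact: (ray_diffs_max_ideal lc rs).
- exact: (ray_diffs_regular K lc hb eh).
- by rewrite size_map size_iota.
Qed.

Lemma min_generatorsP n : min_generators E n <-> n = size (std 1).
Proof.
apply: (min_generators_count K lc hb); first exact: (standard_uniq b lc).
exact: (standardP b lc).
Qed.

Lemma standard_tends_to : tends_to
  (fun n => (D.+1`! * size (std n))%:R / (n ^ D.+1)%:R) mult%:R.
Proof.
have [A [n0 HA]] := standard_growth lc hb (erefl D.+2).
exact: growth_limit HA.
Qed.

(** The dimension and the lengths in the definition are determined, by maximality and by
    [has_length_iter_unique]; so every admissible limit is that of [standard_tends_to]. *)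
Lemma multiplicityP h e : essential b c h -> multiplicity E m e <-> e = mult.
Proof.
move=> eh; have kd := krull_dim_quot K lc hb (erefl D.+2) eh.
split=> [[D' [l [[kD' maxD'] lP lim]]]|->].
  have eD : D' = D.+1.
    by apply/eqP; rewrite eqn_leq; case: kd => k1 k2; rewrite k2 // maxD'.
  apply: tends_to_nat_unique lim _; rewrite eD.
  have le n : l n = size (std n).
    apply: (has_length_iter_unique lc hb) (lP n); first exact: (standard_uniq b lc).
    exact: (standardP b lc).
  move=> eps /standard_tends_to[n0 H0]; exists n0 => n /H0.
  by rewrite le.
exists D.+1, (fun n => size (std n)); split=> //; last exact: standard_tends_to.
move=> n; rewrite (iter_max_ideal K lc hb).
exact: (has_length_mono K lc hb (@inpow_upclosed _ _ _ _ _ _ lc n)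
  (standard_uniq b lc n) (standardP b lc n)).
Qed.

(** A nonzero [E] is Cohen-Macaulay in any case, so only the equality of the two numbers remains. *)
Lemma ulrichP : ulrich E m <-> size (std 1) = mult.
Proof.
have [[h eh]|no] := pselect (exists h, essential b c h); last first.
  have ne h : ~~ essential b c h by apply/negP => eh; apply: no; exists h.
  split=> _; first exact: standard_mult_trivial.
  by left; exact/trivial_quot.
split=> [[/trivial_quot/(_ h)|[_ [n [/min_generatorsP -> /(multiplicityP _ eh)]]]]|e] //.
  by rewrite eh.
right; split; first by exists D.+1; split; [exact: (krull_dim_quot K lc hb (erefl D.+2) eh)|exact: (depth_quot eh)].
exists (size (std 1)); split; first exact/min_generatorsP.
exact/(multiplicityP _ eh).
Qed.

End Ulrich.

Theorem theorem3p2 (F : realType) (K : fieldType) (d : nat) (hd : (2 <= d)%N)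
    (H : affine_semigroup d) (hH : slim F H)
    (a : 'I_d -> 'X_{1..d}) (ha : extremal_rays F H a)
    (b : 'X_{1..d}) (hb : omega F H (zvec b)) :
  let R := sgring K H in
  let m : set R := max_ideal K H in
  let w : set R := canonical_ideal K H F in
  let u : R := sgmon K H b in
  let J : set R :=
    ideal_gen [set r | exists i j : 'I_d,
                 r = (sgmon K H (a i) - sgmon K H (a j))%R] in
  ulrich_element K H F b <->
  prod_set m (w : set R^o)
    `<=` sum_set (ideal_gen [set u] : set R^o) (prod_set J (w : set R^o)).
Proof.
(* For [d = D.+2] the dimension of [E] is [D.+1 > 0], which leaves room for an error term of order
   [n^D] in the growth estimate. *)
move: d hd H hH a ha b hb => [//|[//|D]] _ H hH a ha b hb /=.
have lc := lattice_coordsP hH ha.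
split=> [[_ /(ulrichP K lc hb)/(standard1_mult lc hb isT) le]|].
  exact/(inclusion_thr K lc hb).
move=> /(inclusion_thr K lc hb)/(standard1_mult lc hb isT)/(ulrichP K lc hb) ul.
by split.
Qed.
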